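(* Let $G$ be a finitely generated virtually abelian group. (1) Every rational subset $R\subseteq G$ has rational weighted growth series $\mathbb S_{R,\Sigma}(z)$, for every finite monoid generating set $\Sigma$ of $G$ and every weight function $\|\cdot\|:\Sigma\to\mathbb Z_{>0}$. (2) The following sets are rational, and therefore have rational weighted growth series with respect to any finite generating set and any weight function of the ambient group: (a) every subgroup of $G$ (as a subset of $G$); (b) coset representatives of a fixed subgroup: for every subgroup $H\le G$, every finite monoid generating set $\Sigma$ of $G$ and every weight function on $\Sigma$, there exists a polyhedral geodesic system $(U^\pi)_{\pi\in P}$ for the partition of $G$ into cosets $gH$, and for such a system the set $\{\overline w: w\in\bigcup_{\pi\in P}U^\pi\}\subseteq G$ (which contains exactly one element, of minimal weight, from each coset) is rational; (c) every algebraic set $V\subseteq G^q$, $q\ge 1$, is a rational subset of $G^q$; (d) every definable set $V\subseteq G^q$, $q\ge1$, is a rational subset of $G^q$; (e) conjugacy representatives: for every finite monoid generating set $\Sigma$ of $G$ and every weight function on $\Sigma$, there exists a polyhedral geodesic system $(U^\pi)_{\pi\in P}$ for the partition of $G$ into conjugacy classes, and for such a system the set $\{\overline w: w\in\bigcup_{\pi\in P}U^\pi\}\subseteq G$ (which contains exactly one element, of minimal weight, from each conjugacy class) is rational.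
   Context: $\mathbb N=\{0,1,2,\dots\}$. Fix a normal free abelian subgroup $\mathbb Z^k\le G$ of finite index $d$. Rational sets. For a group $M$ with finite monoid generating set $A$, a subset $R\subseteq M$ is rational if it is the image of a regular language $L\subseteq A^*$ under the natural projection $A^*\to M$ (independent of the choice of $A$). Growth. For a finite monoid generating set $\Sigma$ of a group $M$ with weights $\|s\|\in\mathbb Z_{>0}$ ($s\in\Sigma$), put $\|s_1\cdots s_l\|=\sum\|s_i\|$ for words, write $\overline w\in M$ for the element represented by $w\in\Sigma^*$, and put $\|g\|=\min\{\|w\|: w\in\Sigma^*,\overline w=g\}$. For $U\subseteq M$, $\mathbb S_{U,\Sigma}(z)=\sum_{n\ge0}\#\{g\in U:\|g\|=n\}z^n$. It is rational if it equals $p/q$ with $p,q\in\mathbb Z[z]$. For subsets of $G^q$ (which is again finitely generated virtually abelian) growth is taken with respect to weighted finite monoid generating sets of $G^q$. Algebraic and definable sets. An algebraic set in $G^q$ is the set of solutions in $G^q$ of a (finite) system of equations in $q$ variables with coefficients in $G$. A set $V\subseteq G^q$ is definable if there are a first-order formula $\Phi(x_1,\dots,x_q,y_1,\dots,y_n)$ in the language of groups and parameters $m_1,\dots,m_n\in G$ such that $V=\{\overline g\in G^q:\Phi(\overline g,m_1,\dots,m_n)\text{ holds in }G\}$. Polyhedral sets. An elementary region of $\mathbb Z^r$ is a set $\{z:u\cdot z=a\}$, $\{z:u\cdot z\equiv a \bmod b\}$ or $\{z:u\cdot z>a\}$ with $u\in\mathbb Z^r$, $a\in\mathbb Z$, $b\in\mathbb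 N$ ($\cdot$ the Euclidean scalar product). A polyhedral set is a finite union of finite intersections of elementary regions. Patterned words. Given a weighted finite monoid generating set $\Sigma$ of $G$, let $S\subseteq G$ be the set of elements expressible as products of at least 1 and at most $d$ elements of $\Sigma$; the weight of $s\in S$ is the minimum of $\sum\|s_i\|$ over such expressions $s=s_1\cdots s_j$, $1\le j\le d$. Extend weights additively to $S^*$, and write $\overline w\in G$ for the element represented by $w\in S^*$ (element weights with respect to $S$ and $\Sigma$ agree). Let $X=S\cap\mathbb Z^k=\{x_1,\dots,x_r\}$ and $Y=S\setminus X$. A pattern is a word $\pi=\pi_1\cdots\pi_l\in Y^*$ ($\pi_i\in Y$), with length $|\pi|=l$; $P$ is the finite set of patterns of length at most $d$. Put $m_\pi=lr+r$. $W^\pi\subseteq S^*$ is the set of words $$x_1^{i_1}\cdots x_r^{i_r}\,\pi_1\,x_1^{i_{r+1}}\cdots x_r^{i_{2r}}\,\pi_2\cdots\pi_l\,x_1^{i_{lr+1}}\cdots x_r^{i_{lr+r}},\qquad i_j\in\mathbb N,$$ and $\phi_\pi:W^\pi\to\mathbb N^{m_\pi}$ is the bijection sending this word to $(i_1,\dots,i_{lr+r})$. Polyhedral geodesic system. For a partition of $G$ into classes, a polyhedral geodesic system is a family of sets $U^\pi\subseteq W^\pi$ ($\pi\in P$) such that: (1) for each class $C$, the disjoint union $\bigcup_{\pi\in P}U^\pi$ contains exactly one word representing an element of $C$, and this word has minimal weight among all words over $S$ representing elements of $C$; (2) each $\phi_\pi(U^\pi)$ is a polyhedral subset of $\mathbb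 Z^{m_\pi}$. *)

(* Defs.v *)
From mathcomp Require Import all_boot all_order all_algebra.
From mathcomp Require Import finmap boolp classical_sets functions cardinality.

Set Implicit Arguments.
Unset Strict Implicit.
Unset Printing Implicit Defensive.

Local Open Scope classical_set_scope.
Local Open Scope nat_scope.

Section Subgroups.
Variable G : groupType.
Implicit Types H A N : set G.

Definition is_subgroup H : Prop := group_closed (mem H).

Definition lcoset H (g : G) : set G := [set (g * h)%g | h in H].

Definition conj_class (g : G) : set G := [set (g ^ h)%g | h in [set: G]].

Definition is_normal N : Prop :=
  is_subgroup N /\ forall x g, N x -> N (x ^ g)%g.

Definition has_index H (d : nat) : Prop := (range (lcoset H) #= `I_d)%card.

Definition finite_index H : Prop := finite_set (range (lcoset H)).

Definition free_abelian_rank (k : nat) A : Prop :=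
  exists f : 'rV[int]_k -> G,
    [/\ forall u v, f (u + v)%R = (f u * f v)%g, injective f & range f = A].

End Subgroups.

Definition finitely_generated (G : groupType) : Prop :=
  exists A : {fset G}, smallest (@is_subgroup G) [set` A] = setT.

Definition virtually_abelian (G : groupType) : Prop :=
  exists A : set G,
    [/\ is_subgroup A, forall x y, A x -> A y -> commute x y & finite_index A].

Definition word_val (M : groupType) (w : seq M) : M := (\prod_(s <- w) s)%g.

Definition monoid_generating (M : groupType) (A : {fset M}) : Prop :=
  forall g : M, exists2 w : seq M, {subset w <= A} & word_val w = g.

Definition regular (A : finType) (L : set (seq A)) : Prop :=
  exists (Q : finType) (q0 : Q) (delta : Q -> A -> Q) (F : {set Q}),
    forall w : seq A, L w <-> foldl delta q0 w \in F.

(* Quantifying existentially over the generating set A is harmless: the notion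
   does not depend on A. *)
Definition rational_set (M : groupType) (R : set M) : Prop :=
  exists2 A : {fset M}, monoid_generating A &
    exists2 L : set (seq A), regular L &
      R = [set word_val [seq val a | a <- w] | w in L].

(* the least element of a nonempty set (and 0 for the empty set) *)
Definition nat_min (A : set nat) : nat :=
  xget 0 [set n | A n /\ forall m, A m -> n <= m].

Definition word_weight (M : groupType) (wt : M -> nat) (w : seq M) : nat :=
  \sum_(s <- w) wt s.

(* Only the values of wt on Sigma matter. *)
Definition weighted_generating (M : groupType) (Sigma : {fset M})
    (wt : M -> nat) : Prop :=
  monoid_generating Sigma /\ forall s, s \in Sigma -> 0 < wt s.

Definition elt_weight (M : groupType) (Sigma : {fset M}) (wt : M -> nat)
    (g : M) : nat :=
  nat_min [set word_weight wt w |
             w in [set w : seq M | {subset w <= Sigma} /\ word_val w = g]].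

(* The sphere is finite as soon as weighted_generating Sigma wt holds, and then
   fset_set turns it into the corresponding {fset M}. *)
Definition growth_coef (M : groupType) (Sigma : {fset M}) (wt : M -> nat)
    (U : set M) (n : nat) : nat :=
  #|` fset_set [set g | U g /\ elt_weight Sigma wt g = n] |.

(* the formal power series sum_n a_n z^n is p / q, i.e. q * sum_n a_n z^n = p *)
Definition rational_series (a : nat -> nat) : Prop :=
  exists p q : {poly int}, q != 0%R /\
    forall n, (\sum_(i < n.+1) q`_i * (a (n - i)%N)%:Z = p`_n)%R.

Definition rational_growth (M : groupType) (U : set M) : Prop :=
  forall (Sigma : {fset M}) (wt : M -> nat),
    weighted_generating Sigma wt -> rational_series (growth_coef Sigma wt U).

Inductive gterm (V : Type) : Type :=
| TVar of V
| TOne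
| TMul of gterm V & gterm V
| TInv of gterm V.
Arguments TOne {V}.

Fixpoint gterm_eval (G : groupType) (V : Type) (e : V -> G) (t : gterm V) : G :=
  match t with
  | TVar v => e v
  | TOne => 1%g
  | TMul t1 t2 => (gterm_eval e t1 * gterm_eval e t2)%g
  | TInv t1 => (gterm_eval e t1)^-1%g
  end.

(* First-order formulas of the language of groups with free variables in V;
   a quantifier binds the variable None of its body. *)
Inductive gformula (V : Type) : Type :=
| FEq of gterm V & gterm V
| FFalse
| FNot of gformula V
| FAnd of gformula V & gformula V
| FOr of gformula V & gformula V
| FImp of gformula V & gformula V
| FAll of gformula (option V)
| FEx of gformula (option V).
Arguments FFalse {V}.

Fixpoint holds (G : groupType) (V : Type) (e : V -> G) (f : gformula V) : Prop :=
  match f with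
  | FEq t1 t2 => gterm_eval e t1 = gterm_eval e t2
  | FFalse => False
  | FNot f1 => ~ holds e f1
  | FAnd f1 f2 => holds e f1 /\ holds e f2
  | FOr f1 f2 => holds e f1 \/ holds e f2
  | FImp f1 f2 => holds e f1 -> holds e f2
  | FAll f1 => forall g : G, holds (fun v => oapp e g v) f1
  | FEx f1 => exists g : G, holds (fun v => oapp e g v) f1
  end.

(* An equation t = t' in q variables with coefficients in G is a pair of terms
   over G + 'I_q: coefficients (inl) and variables (inr). *)
Definition algebraic_set (G : groupType) (q : nat)
    (V : set {ffun 'I_q -> G}) : Prop :=
  exists (n : nat) (lhs rhs : 'I_n -> gterm (G + 'I_q)),
    V = [set x | forall j : 'I_n,
           let e v := match v with inl c => c | inr i => x i end in
           gterm_eval e (lhs j) = gterm_eval e (rhs j)].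

Definition definable_set (G : groupType) (q : nat)
    (V : set {ffun 'I_q -> G}) : Prop :=
  exists (n : nat) (Phi : gformula ('I_q + 'I_n)) (m : 'I_n -> G),
    V = [set g | holds (fun v => match v with inl i => g i | inr j => m j end)
                       Phi].

Definition dotz (r : nat) (u z : 'rV[int]_r) : int :=
  (\sum_j u ord0 j * z ord0 j)%R.

Inductive elementary_region (r : nat) : set 'rV[int]_r -> Prop :=
| RegionEq (u : 'rV[int]_r) (a : int) :
    elementary_region [set z | dotz u z = a]
| RegionMod (u : 'rV[int]_r) (a : int) (b : nat) :
    elementary_region [set z | (dotz u z = a %[mod b%:Z])%Z]
| RegionGt (u : 'rV[int]_r) (a : int) :
    elementary_region [set z | (a < dotz u z)%R].

Definition polyhedral (r : nat) (D : set 'rV[int]_r) : Prop :=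
  exists (n : nat) (c : 'I_n -> nat)
         (E : forall i : 'I_n, 'I_(c i) -> set 'rV[int]_r),
    (forall i j, elementary_region (E i j)) /\
    D = \bigcup_i \bigcap_j E i j.

(* With S := short_products, the words considered below have letters in S, each
   letter s weighing short_weight s; x lists X = S `&` N, and a pattern pi is a
   word of length at most d over S `\` N.  For i = (i_1, ..., i_m), where
   l = size pi and m = l r + r, pattern_word pi i is the word
     x_1^{i_1} ... x_r^{i_r} pi_1 x_1^{i_{r+1}} ... x_r^{i_{2r}} pi_2 ...
       pi_l x_1^{i_{lr+1}} ... x_r^{i_{lr+r}}
   and i is determined by this word (as x is duplicate-free and the letters of
   pi are not in x). *)
Section Patterns.
Variables (G : groupType) (N : set G) (d : nat).
Variables (Sigma : {fset G}) (wt : G -> nat).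

Definition short_words : set (seq G) :=
  [set w | {subset w <= Sigma} /\ 1 <= size w <= d].

Definition short_products : set G := [set word_val w | w in short_words].

Definition short_weight (s : G) : nat :=
  nat_min [set word_weight wt w |
             w in [set w | short_words w /\ word_val w = s]].

Definition short_product_word (w : seq G) : Prop :=
  forall s, s \in w -> short_products s.

Definition enumerates_X (r : nat) (x : r.-tuple G) : Prop :=
  uniq x /\ [set` x] = short_products `&` N.

Definition patterns : set (seq G) :=
  [set pi | size pi <= d /\
            forall y, y \in pi -> (short_products `\` N) y].

Variables (r : nat) (x : r.-tuple G).

Definition pattern_dim (pi : seq G) : nat := size pi * r + r.

Definition X_block (i : seq nat) (j : nat) : seq G :=
  flatten [seq nseq (nth 0 i (j * r + t)) (nth 1%g x t) | t <- iota 0 r].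

Definition pattern_word (pi : seq G) (i : (pattern_dim pi).-tuple nat) : seq G :=
  X_block i 0 ++
  flatten [seq nth 1%g pi j :: X_block i j.+1 | j <- iota 0 (size pi)].

Definition patterned_words (pi : seq G) : set (seq G) := range (@pattern_word pi).

(* the vectors of exponents of the words of U, when U is included in
   patterned_words pi *)
Definition pattern_exponents (pi : seq G) (U : set (seq G)) :
    set 'rV[int]_(pattern_dim pi) :=
  [set (\row_j (tnth i j)%:Z)%R |
     i in [set i : (pattern_dim pi).-tuple nat | U (pattern_word i)]].

(* Distinct patterns pi have disjoint sets patterned_words pi, so that this
   union is disjoint. *)
Definition system_words (U : seq G -> set (seq G)) : set (seq G) :=
  \bigcup_(pi in patterns) U pi.

Definition system_elements (U : seq G -> set (seq G)) : set G :=
  [set word_val w | w in system_words U].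

Record polyhedral_geodesic_system (classes : set (set G))
    (U : seq G -> set (seq G)) : Prop := {
  pgs_sub : forall pi, patterns pi -> U pi `<=` patterned_words pi;
  pgs_unique : forall C, classes C ->
    exists! w, system_words U w /\ C (word_val w);
  pgs_minimal : forall C w, classes C -> system_words U w -> C (word_val w) ->
    forall v, short_product_word v -> C (word_val v) ->
    word_weight short_weight w <= word_weight short_weight v;
  pgs_polyhedral : forall pi, patterns pi ->
    polyhedral (pattern_exponents (U pi) : set 'rV[int]_(pattern_dim pi))
}.

End Patterns.

Definition minimal_representatives (G : groupType) (Sigma : {fset G})
    (wt : G -> nat) (classes : set (set G)) (T : set G) : Prop :=
  forall C, classes C -> exists2 g, T `&` C = [set g] &
    forall h, C h -> elt_weight Sigma wt g <= elt_weight Sigma wt h.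

(* Main.v *)
(* In coordinates g = f(v) c_j, where f : Z^I -> G is a homomorphism onto a normal
   subgroup of finite index and the c_j represent its cosets, the group operations
   are affine on each coset, so first-order definable sets are Presburger sets of
   coordinates, and quantifier elimination makes these polyhedral.  Rational sets
   are Presburger because a right multiplication by a letter translates v, so that
   Kleene's algorithm in Z^I yields semilinear sets.  Conversely, Elliott's method
   writes polyhedral sets of natural vectors as disjoint unions of free affine
   pieces, which are rational, and whose counting series are products of geometric
   series.  The weight of an element is Presburger as the least weight of a word,
   hence rational sets have rational growth.  Every word can be rearranged into a
   patterned word of no larger weight, and the exponents of the first patterned
   word of minimal weight in each class form a Presburger set. *)

Require Import Defs.
From mathcomp Require Import all_boot all_order all_algebra.
From mathcomp Require Import finmap boolp classical_sets functions cardinality.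
From mathcomp Require Import zify.

Set Implicit Arguments.
Unset Strict Implicit.
Unset Printing Implicit Defensive.

Import Order.TTheory GRing.Theory Num.Theory.

Local Open Scope classical_set_scope.
Local Open Scope ring_scope.

(** * Presburger arithmetic *)

(** Growth counts each element once, so a set has to be described without ambiguity. The semilinear
    sets that Kleene's algorithm produces overlap; they are therefore first turned into Presburger
    predicates, and these are decomposed into disjoint images under injective maps. Where
    coordinates are not unique, the lexicographically least ones are selected, which is again a
    Presburger condition. The bound [d] on the length of patterns comes from following the cosets of
    [N] reached by the prefixes of a word over [Sigma]. The word is cut into runs, each ending at
    the first visit of a new coset, so that there are at most [d] visits to record. A coset repeated
    within the current run closes a loop of length at most [d]; its value lies in [N], hence is a
    letter of X. The product read since the first visit of that coset lies in [N] too, and [N] is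
    abelian, so the letter can be moved back to the block at that first visit. The values of the
    runs are the letters of the pattern. *)

Definition lin (V : Type) : Type := (seq (int * V) * int)%type.

(** Combinations are kept unreduced, with repeated variables allowed, so that [V] needs neither
    decidable equality nor finiteness; exponents will later be indexed by [nat]. *)
Definition leval V (e : V -> int) (l : lin V) : int :=
  l.2 + \sum_(p <- l.1) p.1 * e p.2.

Definition lconst V (a : int) : lin V := ([::], a).
Definition lvar V (v : V) : lin V := ([:: (1, v)], 0).
Definition ladd V (l1 l2 : lin V) : lin V := (l1.1 ++ l2.1, l1.2 + l2.2).
Definition lscale V (a : int) (l : lin V) : lin V :=
  ([seq (a * p.1, p.2) | p <- l.1], a * l.2).
Definition lsubst V W (s : V -> lin W) (l : lin V) : lin W :=
  foldr (fun p acc => ladd (lscale p.1 (s p.2)) acc) (lconst W l.2) l.1.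

Lemma leval_const V (e : V -> int) a : leval e (lconst V a) = a.
Proof. by rewrite /leval big_nil addr0. Qed.

Lemma leval_var V (e : V -> int) v : leval e (lvar v) = e v.
Proof. by rewrite /leval big_seq1 /= mul1r add0r. Qed.

Lemma leval_add V (e : V -> int) l1 l2 :
  leval e (ladd l1 l2) = leval e l1 + leval e l2.
Proof. by rewrite /leval /= big_cat addrACA. Qed.

Lemma leval_scale V (e : V -> int) a l :
  leval e (lscale a l) = a * leval e l.
Proof.
rewrite /leval /= big_map mulrDr mulr_sumr; congr (_ + _).
by apply: eq_bigr => p _; rewrite mulrA.
Qed.

Lemma leval_subst V W (e : W -> int) (s : V -> lin W) l :
  leval e (lsubst s l) = leval (fun v => leval e (s v)) l.
Proof.
case: l => l a; rewrite /lsubst /=; elim: l => [|p l IH] /=.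
  by rewrite leval_const /leval big_nil addr0.
rewrite leval_add leval_scale IH /leval /= big_cons /=; lia.
Qed.

Definition lsplit V (l : lin (option V)) : int * lin V :=
  (\sum_(p <- l.1) (if p.2 is None then p.1 else 0),
   (pmap (fun p => omap (fun v => (p.1, v)) p.2) l.1, l.2)).

Lemma leval_split V (e : V -> int) x l :
  leval (oapp e x) l = (lsplit l).1 * x + leval e (lsplit l).2.
Proof.
case: l => l a; rewrite /lsplit /leval /=; elim: l => [|[c [v|]] l IH] /=.
- by rewrite !big_nil mul0r !addr0 add0r.
- by rewrite !big_cons /= add0r; lia.
- by rewrite !big_cons /=; lia.
Qed.

Opaque lsplit.

Inductive qf (V : Type) : Type :=
| QGt of lin V
| QDvd of nat & lin V
| QNot of qf V
| QAnd of qf V & qf V.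

(* QDvd m t expresses divisibility by m + 1, so that moduli are positive. *)
Fixpoint qsat V (e : V -> int) (F : qf V) : bool :=
  match F with
  | QGt t => 0 < leval e t
  | QDvd m t => (m.+1%:Z %| leval e t)%Z
  | QNot F1 => ~~ qsat e F1
  | QAnd F1 F2 => qsat e F1 && qsat e F2
  end.

Fixpoint qsubst V W (s : V -> lin W) (F : qf V) : qf W :=
  match F with
  | QGt t => QGt (lsubst s t)
  | QDvd m t => QDvd m (lsubst s t)
  | QNot F1 => QNot (qsubst s F1)
  | QAnd F1 F2 => QAnd (qsubst s F1) (qsubst s F2)
  end.

Lemma qsat_subst V W (s : V -> lin W) F (e : W -> int) :
  qsat e (qsubst s F) = qsat (fun v => leval e (s v)) F.
Proof.
elim: F => [t|m t|F IH|F1 IH1 F2 IH2] /=; rewrite ?leval_subst ?IH ?IH1 ?IH2 //.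
Qed.

Definition qor V (F1 F2 : qf V) := QNot (QAnd (QNot F1) (QNot F2)).
Definition qfalse V : qf V := QGt (lconst V 0).

Lemma qsat_or V (e : V -> int) F1 F2 :
  qsat e (qor F1 F2) = qsat e F1 || qsat e F2.
Proof. by rewrite /= negb_and !negbK. Qed.

Lemma qsat_false V (e : V -> int) : qsat e (qfalse V) = false.
Proof. by rewrite /= leval_const ltxx. Qed.

Definition qbigor V (s : seq (qf V)) : qf V := foldr (@qor V) (qfalse V) s.

Lemma qsat_bigor V (e : V -> int) s :
  qsat e (qbigor s) = has (qsat e) s.
Proof.
elim: s => [|F s IH]; first exact: qsat_false.
by rewrite -[qbigor _]/(qor F (qbigor s)) qsat_or IH.
Qed.

(* Cooper's elimination of the variable None, with thresholds (n, t) standing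
   for the rational number t / (n + 1).  A shift of the variable by the period
   towards the threshold 0 preserves the truth value unless it crosses some
   threshold, so a solution exists as soon as one lies near a threshold. *)

Fixpoint qperiod V (F : qf V) : nat :=
  match F with
  | QGt _ => 1
  | QDvd m _ => m.+1
  | QNot F1 => qperiod F1
  | QAnd F1 F2 => qperiod F1 * qperiod F2
  end%N.

Lemma qperiod_gt0 V (F : qf V) : (0 < qperiod F)%N.
Proof. by elim: F => //= F1 H1 F2 H2; rewrite muln_gt0 H1. Qed.

Fixpoint qthresholds V (F : qf (option V)) : seq (nat * lin V) :=
  match F with
  | QGt t =>
    let: (a, s) := lsplit t in
    match a with
    | Posz n.+1 => [:: (n, lscale (-1) s)]
    | Posz 0 => [::]
    (* [(n+1) x < s] is read as [(n+1) x <= s - 1], so that both signs of the coefficient change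
       truth value under the same half-open crossing condition in [qsat_shift]. *)
    | Negz n => [:: (n, ladd s (lconst V (-1)))]
    end
  | QDvd _ _ => [::]
  | QNot F1 => qthresholds F1
  | QAnd F1 F2 => qthresholds F1 ++ qthresholds F2
  end.

Lemma qsat_shift V (F : qf (option V)) (e : V -> int) (D : nat) x :
  (0 < D)%N -> (qperiod F %| D)%N ->
  all (fun p => ~~ (p.1.+1%:Z * (x - D%:Z) <= leval e p.2 < p.1.+1%:Z * x))
      (qthresholds F) ->
  qsat (oapp e (x - D%:Z)) F = qsat (oapp e x) F.
Proof.
move=> D0; elim: F => [t _|m t|F IH|F1 IH1 F2 IH2] /=.
- rewrite !leval_split; case: (lsplit t) => -[[|n]|n] s /=.
  + by rewrite !mul0r.
  + rewrite leval_scale andbT => H.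
    have : (n.+1%:Z * D%:Z > 0) by lia.
    move: H; rewrite mulrBr; move: (n.+1%:Z * x) (n.+1%:Z * D%:Z) (leval e s).
    lia.
  + rewrite leval_add leval_const andbT NegzE => H.
    have : (n.+1%:Z * D%:Z > 0) by lia.
    move: H; rewrite !mulNr mulrBr.
    move: (n.+1%:Z * x) (n.+1%:Z * D%:Z) (leval e s).
    lia.
- move=> mD _; rewrite !leval_split.
  case: (lsplit t) => a s /=.
  have -> : a * (x - D%:Z) + leval e s = (a * x + leval e s) - a * D%:Z by lia.
  by rewrite rpredBr // dvdz_mull.
- by move=> /IH/[apply] ->.
- move=> H; rewrite all_cat => /andP[H1 H2].
  rewrite IH1 ?IH2 //.
    by apply: dvdn_trans H; rewrite dvdn_mull.
  by apply: dvdn_trans H; rewrite dvdn_mulr.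
Qed.

(** Puts the rational number [t / (n+1)] in place of the variable by clearing the denominator: an
    atom is multiplied by [n+1], and so is its modulus, whose predecessor is stored by the
    convention of [QDvd]. *)
Fixpoint qfracsubst V (n : nat) (t : lin V) (F : qf (option V)) : qf V :=
  match F with
  | QGt l => let: (a, s) := lsplit l in
      QGt (ladd (lscale a t) (lscale n.+1%:Z s))
  | QDvd m l => let: (a, s) := lsplit l in
      QDvd (n.+1 * m.+1).-1 (ladd (lscale a t) (lscale n.+1%:Z s))
  | QNot F1 => QNot (qfracsubst n t F1)
  | QAnd F1 F2 => QAnd (qfracsubst n t F1) (qfracsubst n t F2)
  end.

Lemma qsat_fracsubst V (n : nat) (t : lin V) F e x :
  n.+1%:Z * x = leval e t ->
  qsat e (qfracsubst n t F) = qsat (oapp e x) F.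
Proof.
move=> E; elim: F => [l|m l|F IH|F1 IH1 F2 IH2] /=.
- rewrite leval_split; case: (lsplit l) => a s /=.
  rewrite leval_add !leval_scale -E.
  have -> : a * (n.+1%:Z * x) + n.+1%:Z * leval e s =
            n.+1%:Z * (a * x + leval e s) by lia.
  by rewrite pmulr_rgt0.
- rewrite leval_split; case: (lsplit l) => a s.
  rewrite -[RHS](@dvdz_mul2l n.+1%:Z) //= leval_add !leval_scale -E.
  congr (_ %| _)%Z; lia.
- by rewrite IH.
- by rewrite IH1 IH2.
Qed.

(** The candidates are the integers at distance at most one period from a threshold: after
    multiplication by [n+1] the offset has absolute value at most [K], and [j - K] runs over these
    offsets. The conjunct [QDvd] keeps only the integral candidates. The added threshold 0 is where
    the descent on [|x|] stops. *)
Definition cooper V (F : qf (option V)) : qf V :=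
  let s := (0%N, lconst V 0) :: qthresholds F in
  let K n := (n.+1 * qperiod F)%N in
  qbigor [seq (let p := nth (0%N, lconst V 0) s i in
    qbigor [seq (let t := ladd p.2 (lconst V (j%:Z - (K p.1)%:Z)) in
                 QAnd (QDvd p.1 t) (qfracsubst p.1 t F))
           | j <- iota 0 (K p.1 + K p.1 + 1)]) | i <- iota 0 (size s)].

Lemma qsat_cooper V (F : qf (option V)) e :
  qsat e (cooper F) <-> exists x, qsat (oapp e x) F.
Proof.
rewrite /cooper qsat_bigor has_map; set D := qperiod F.
set p0 := (0%N, lconst V 0); set s := p0 :: _.
have D0 : (0 < D)%N by exact: qperiod_gt0.
split.
  move=> /hasP[i _] /=; rewrite qsat_bigor has_map.
  move=> /hasP[j _] /= /andP[/dvdzP[x Ex] H]; exists x.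
  by rewrite -(qsat_fracsubst F (etrans (mulrC _ _) (esym Ex))).
case=> x; have [m] := ubnP `|x|%N; elim: m x => // m IH x mx Hx.
(* A solution within one period of a threshold is itself one of the candidates. *)
have near i (j : int) (p := nth p0 s i) : (i < size s)%N ->
    p.1.+1%:Z * x = leval e p.2 + j -> `|j| <= (p.1.+1 * D)%:Z ->
    has (fun i => let p := nth p0 s i in
      qsat e (qbigor
       [seq (let t := ladd p.2 (lconst V (j%:Z - (p.1.+1 * D)%:Z)) in
                 QAnd (QDvd p.1 t) (qfracsubst p.1 t F))
           | j <- iota 0 (p.1.+1 * D + p.1.+1 * D + 1)])) (iota 0 (size s)).
  move=> si Ej jD; apply/hasP; exists i; first by rewrite mem_iota.
  rewrite /= -/p qsat_bigor has_map; apply/hasP.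
  exists `|(j + (p.1.+1 * D)%N%:Z)%R|%N; first by rewrite mem_iota; lia.
  rewrite /=.
  have -> : `|(j + (p.1.+1 * D)%N%:Z)%R|%N%:Z - (p.1.+1 * D)%N%:Z = j by lia.
  rewrite leval_add leval_const -Ej dvdz_mulr //=.
  by rewrite (@qsat_fracsubst _ _ _ _ _ x) // leval_add leval_const.
have [xD|xD] := boolP (`|x| <= D%:Z).
  by apply: (near 0%N x); rewrite //= ?leval_const; lia.
have [x0|x0] := lerP 0 x.
- have [A|/(all_nthP p0)] := boolP (all (fun p =>
      ~~ (p.1.+1%:Z * (x - D%:Z) <= leval e p.2 < p.1.+1%:Z * x))
      (qthresholds F)).
    apply: (IH (x - D%:Z)); first lia.
    by rewrite (@qsat_shift _ F e D).
  move=> /existsNP[i /not_implyP[si /negP/negPn/andP[H1 H2]]].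
  apply: (near i.+1 ((nth p0 s i.+1).1.+1%:Z * x - leval e (nth p0 s i.+1).2)) => //=.
    by lia.
  by lia.
(* A negative solution moves upwards to 0, so the shift lemma is applied at [x + D]. *)
- have [A|/(all_nthP p0)] := boolP (all (fun p =>
      ~~ (p.1.+1%:Z * (x + D%:Z - D%:Z) <= leval e p.2 < p.1.+1%:Z * (x + D%:Z)))
      (qthresholds F)).
    apply: (IH (x + D%:Z)); first lia.
    by rewrite -(@qsat_shift _ F e D (x + D%:Z)) // addrK.
  move=> /existsNP[i /not_implyP[si /negP/negPn/andP[H1 H2]]].
  apply: (near i.+1 ((nth p0 s i.+1).1.+1%:Z * x - leval e (nth p0 s i.+1).2)) => //=.
    by lia.
  by lia.
Qed.

(** A semantic notion: elimination is hidden in closure under quantifiers, so that later predicates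
    can be written as ordinary propositions instead of formulas. *)
Definition pres (V : Type) (P : (V -> int) -> Prop) : Prop :=
  exists F : qf V, forall e, P e <-> qsat e F.

Definition islin (V : Type) (L : (V -> int) -> int) : Prop :=
  exists l : lin V, forall e, L e = leval e l.

Section Linear.
Variable V : Type.
Implicit Types L : (V -> int) -> int.

Lemma islin_var (v : V) : islin (fun e : V -> int => e v).
Proof. by exists (lvar v) => e; rewrite leval_var. Qed.

Lemma islin_const a : islin (fun e : V -> int => a).
Proof. by exists (lconst V a) => e; rewrite leval_const. Qed.

Lemma islinD L1 L2 : islin L1 -> islin L2 -> islin (fun e => L1 e + L2 e).
Proof.
by move=> [l1 H1] [l2 H2]; exists (ladd l1 l2) => e; rewrite leval_add H1 H2.
Qed.

Lemma islinZ a L : islin L -> islin (fun e => a * L e).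
Proof. by move=> [l H]; exists (lscale a l) => e; rewrite leval_scale H. Qed.

Lemma islinZr a L : islin L -> islin (fun e => L e * a).
Proof. by move=> [l H]; exists (lscale a l) => e; rewrite leval_scale H mulrC. Qed.

Lemma islin_opp L : islin L -> islin (fun e => - L e).
Proof. by move=> [l H]; exists (lscale (-1) l) => e; rewrite leval_scale H mulN1r. Qed.

Lemma islinB L1 L2 : islin L1 -> islin L2 -> islin (fun e => L1 e - L2 e).
Proof. by move=> H1 H2; apply: islinD => //; apply: islin_opp. Qed.

Lemma islin_sum (T : Type) (s : seq T) (P : pred T) (L : (V -> int) -> T -> int) :
  (forall t, islin (fun e => L e t)) -> islin (fun e => \sum_(t <- s | P t) L e t).
Proof.
move=> H; elim: s => [|t s IH].
  by have [l Hl] := islin_const 0; exists l => e; rewrite big_nil.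
have [l1 H1] := H t; have [l2 H2] := IH.
exists (if P t then ladd l1 l2 else l2) => e.
by rewrite big_cons; case: ifP => _; rewrite ?leval_add H2 ?H1.
Qed.

End Linear.

Lemma islin_subst V W (L : (W -> int) -> int) (s : (V -> int) -> W -> int) :
  (forall w, islin (fun e => s e w)) -> islin L -> islin (fun e => L (s e)).
Proof.
move=> /choice[l Hl] [m Hm]; exists (lsubst l m) => e.
rewrite leval_subst Hm; congr (leval _ m).
by apply/funext => w; exact: Hl.
Qed.

Section PresClosure.
Variable V : Type.
Implicit Types P Q : (V -> int) -> Prop.

Lemma pres_ext P Q : (forall e, P e <-> Q e) -> pres P -> pres Q.
Proof. by move=> H [F HF]; exists F => e; rewrite -H. Qed.

Lemma pres_not P : pres P -> pres (fun e => ~ P e).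
Proof.
by move=> [F H]; exists (QNot F) => e; rewrite H /=; split => [/negP|/negP].
Qed.

Lemma pres_and P Q : pres P -> pres Q -> pres (fun e => P e /\ Q e).
Proof.
move=> [F1 H1] [F2 H2]; exists (QAnd F1 F2) => e; rewrite H1 H2 /=.
by split => [[-> ->]|/andP].
Qed.

Lemma pres_or P Q : pres P -> pres Q -> pres (fun e => P e \/ Q e).
Proof.
move=> [F1 H1] [F2 H2]; exists (qor F1 F2) => e; rewrite H1 H2 qsat_or.
by split => [/orP|/orP].
Qed.

Lemma pres_imp P Q : pres P -> pres Q -> pres (fun e => P e -> Q e).
Proof.
move=> HP HQ; apply: pres_ext (pres_or (pres_not HP) HQ) => e.
by split => [[|]//|H]; have [/H|] := pselect (P e); [right|left].
Qed.

Lemma pres_const (B : Prop) : pres (fun e : V -> int => B).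
Proof.
have [b|b] := pselect B.
  by exists (QNot (qfalse V)) => e; rewrite /= leval_const ltxx.
by exists (qfalse V) => e; rewrite /= leval_const ltxx.
Qed.

Lemma pres_lt L1 L2 : islin L1 -> islin L2 -> pres (fun e : V -> int => L1 e < L2 e).
Proof.
move=> H1 H2; have [l Hl] := islinB H2 H1; exists (QGt l) => e /=.
by rewrite -Hl subr_gt0.
Qed.

Lemma pres_le L1 L2 : islin L1 -> islin L2 -> pres (fun e : V -> int => L1 e <= L2 e).
Proof.
move=> H1 H2; apply: pres_ext (pres_not (pres_lt H2 H1)) => e.
by rewrite leNgt; split => [/negP|/negP].
Qed.

Lemma pres_eq L1 L2 : islin L1 -> islin L2 -> pres (fun e : V -> int => L1 e = L2 e).
Proof.
move=> H1 H2; apply: pres_ext (pres_and (pres_le H1 H2) (pres_le H2 H1)) => e.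
by split => [[H3 H4]|->//]; apply/eqP; rewrite eq_le H3 H4.
Qed.

Lemma pres_all_seq (T : eqType) (s : seq T) (P : (V -> int) -> T -> Prop) :
  (forall t, t \in s -> pres (fun e => P e t)) ->
  pres (fun e => forall t, t \in s -> P e t).
Proof.
elim: s => [|t s IH] H.
  by apply: pres_ext (pres_const True) => e; split.
have H1 : pres (fun e => P e t) by apply: H; rewrite mem_head.
have H2 := IH (fun t' ts => H t' (mem_behead (s := t :: s) ts)).
apply: pres_ext (pres_and H1 H2) => e; split.
  by move=> [Pt Ps] t'; rewrite inE => /predU1P[->//|/Ps].
by move=> Pts; split => [|t' t's]; apply: Pts; rewrite ?mem_head // inE t's orbT.
Qed.

Lemma pres_ex_seq (T : eqType) (s : seq T) (P : (V -> int) -> T -> Prop) :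
  (forall t, t \in s -> pres (fun e => P e t)) ->
  pres (fun e => exists2 t, t \in s & P e t).
Proof.
move=> H; have := pres_not (@pres_all_seq T s (fun e t => ~ P e t) _).
move/(_ (fun t ts => pres_not (H t ts))); apply: pres_ext => e; split.
  by move/existsNP => [t /not_implyP[ts /contrapT Pt]]; exists t.
by move=> [t ts Pt] /(_ t ts).
Qed.

Lemma pres_all_fin (T : finType) (P : (V -> int) -> T -> Prop) :
  (forall t, pres (fun e => P e t)) -> pres (fun e => forall t, P e t).
Proof.
move=> H; apply: pres_ext (pres_all_seq (s := enum T) (fun t _ => H t)) => e.
by split => [Pe t|Pe t _]; apply: Pe; rewrite mem_enum.
Qed.

Lemma pres_ex_fin (T : finType) (P : (V -> int) -> T -> Prop) :
  (forall t, pres (fun e => P e t)) -> pres (fun e => exists t, P e t).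
Proof.
move=> H; apply: pres_ext (pres_ex_seq (s := enum T) (fun t _ => H t)) => e.
by split => [[t _ Pt]|[t Pt]]; exists t; rewrite ?mem_enum.
Qed.

Lemma pres_subst W (Q : (W -> int) -> Prop) (s : (V -> int) -> W -> int) :
  (forall w, islin (fun e => s e w)) -> pres Q -> pres (fun e => Q (s e)).
Proof.
move=> /choice[l Hl] [F HF]; exists (qsubst l F) => e.
rewrite qsat_subst HF; have -> // : s e = fun w => leval e (l w).
by apply/funext => w; exact: Hl.
Qed.

Lemma pres_ex (Q : (V -> int) -> int -> Prop) :
  pres (fun e : option V -> int => Q (fun v => e (Some v)) (e None)) ->
  pres (fun e => exists x, Q e x).
Proof.
move=> [F HF]; exists (cooper F) => e; rewrite qsat_cooper.
by split => -[x Hx]; exists x; move: Hx; rewrite -(HF (oapp e x)).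
Qed.

End PresClosure.

Lemma pres_all (V : Type) (Q : (V -> int) -> int -> Prop) :
  pres (fun e : option V -> int => Q (fun v => e (Some v)) (e None)) ->
  pres (fun e => forall x, Q e x).
Proof.
move=> H; have := pres_not (@pres_ex V (fun e x => ~ Q e x) (pres_not H)).
apply: pres_ext => e; split; first by move/forallNP => H' x; apply: contrapT.
by move=> H' [x]; apply.
Qed.

(** Coordinates of [x] are quantified one at a time; in [step] those in [s] are already bound, while
    the others are still read from the free variables [inr t]. *)
Lemma pres_ex_fun (T : finType) (V : Type) (Q : (V -> int) -> (T -> int) -> Prop) :
  pres (fun e : V + T -> int => Q (fun v => e (inl v)) (fun t => e (inr t))) ->
  pres (fun e => exists x, Q e x).
Proof.
move=> H.
pose upd (x : T -> int) (t : T) z := fun t' => if t' == t then z else x t'.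
have step (s : seq T) : pres (fun e : V + T -> int => exists x,
    Q (fun v => e (inl v)) (fun t => if t \in s then x t else e (inr t))).
  elim: s => [|t s IH].
    apply: pres_ext H => e; split => [HQ|[x]]; last by [].
    by exists (fun _ => 0).
  pose sg (e : option (V + T) -> int) (u : V + T) : int :=
    match u with
    | inl v => e (Some (inl v))
    | inr t' => upd (fun t => e (Some (inr t))) t (e None) t'
    end.
  have Hsg u : islin (fun e => sg e u).
    case: u => [v|t'] /=; first exact: islin_var.
    by rewrite /upd; case: eqP => _; exact: islin_var.
  have K := pres_subst Hsg IH.
  apply: pres_ext (@pres_ex (V + T) (fun e z => exists x : T -> int,
      Q (fun v => e (inl v)) (fun t' => if t' \in s then x t' else
        upd (fun t => e (inr t)) t z t')) K) => e; split.
    move=> [z [x Hx]]; exists (fun t' => if t' \in s then x t' else z).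
    move: Hx; congr Q; apply/funext => t'.
    by rewrite inE /upd; case: eqP => [->|_] //=; case: (t' \in s).
  move=> [x Hx]; exists (x t), x; move: Hx; congr Q; apply/funext => t'.
  by rewrite inE /upd; case: eqP => [->|_] //=; rewrite if_same.
pose sg (e : V -> int) (u : V + T) : int := if u is inl v then e v else 0.
have Hsg u : islin (fun e => sg e u).
  by case: u => [v|t]; [exact: islin_var|exact: islin_const].
apply: pres_ext (pres_subst Hsg (step (enum T))) => e.
by split => -[x Hx]; exists x; move: Hx; congr Q; apply/funext => t;
  rewrite mem_enum.
Qed.

Lemma pres_all_fun (T : finType) (V : Type) (Q : (V -> int) -> (T -> int) -> Prop) :
  pres (fun e : V + T -> int => Q (fun v => e (inl v)) (fun t => e (inr t))) ->
  pres (fun e => forall x, Q e x).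
Proof.
move=> H.
have := pres_not (@pres_ex_fun T V (fun e x => ~ Q e x) (pres_not H)).
apply: pres_ext => e; split; first by move/forallNP => H' x; apply: contrapT.
by move=> H' [x]; apply.
Qed.

(** * Polyhedral sets are the Presburger sets of integer vectors *)

Section Polyhedral.
Variable r : nat.
Implicit Types D : set 'rV[int]_r.

Fixpoint all_elementary (l : seq (set 'rV[int]_r)) : Prop :=
  if l is E :: l' then elementary_region E /\ all_elementary l' else True.

Fixpoint conj_of (l : seq (set 'rV[int]_r)) (z : 'rV[int]_r) : Prop :=
  if l is E :: l' then E z /\ conj_of l' z else True.

Fixpoint disj_of (L : seq (seq (set 'rV[int]_r))) (z : 'rV[int]_r) : Prop :=
  if L is l :: L' then conj_of l z \/ disj_of L' z else False.

Fixpoint all_elementary2 (L : seq (seq (set 'rV[int]_r))) : Prop :=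
  if L is l :: L' then all_elementary l /\ all_elementary2 L' else True.

Definition dnf D : Prop :=
  exists L, all_elementary2 L /\ forall z, D z <-> disj_of L z.

Lemma conj_ofP l z :
  conj_of l z <-> forall j, (j < size l)%N -> nth setT l j z.
Proof.
elim: l => [|E l IH] //=; rewrite IH; split; first by move=> [H1 H2] [|j] //; apply: H2.
by move=> H; split; [exact: (H 0%N)|move=> j; exact: (H j.+1)].
Qed.

Lemma disj_ofP L z :
  disj_of L z <-> exists2 i, (i < size L)%N & conj_of (nth [::] L i) z.
Proof.
elim: L => [|l L IH] /=; first by split => [//|[]].
rewrite IH; split; first by move=> [H|[i H1 H2]]; [exists 0%N|exists i.+1].
by move=> [[|i] H1 H2]; [left|right; exists i].
Qed.

Lemma all_elementaryP l j :
  all_elementary l -> (j < size l)%N -> elementary_region (nth setT l j).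
Proof. by elim: l j => [|E l IH] [|j] //= [H1 H2] //; apply: IH. Qed.

Lemma all_elementary2P L i :
  all_elementary2 L -> (i < size L)%N -> all_elementary (nth [::] L i).
Proof. by elim: L i => [|E l IH] [|j] //= [H1 H2] //; apply: IH. Qed.

Lemma dnf_polyhedral D : dnf D -> polyhedral D.
Proof.
move=> [L [HL HD]].
exists (size L), (fun i => size (nth [::] L i)),
  (fun i j => nth setT (nth [::] L i) j).
split; first by move=> i j; apply: all_elementaryP => //; apply: all_elementary2P.
apply/seteqP; split => z.
  move=> /HD/disj_ofP[i si /conj_ofP H]; exists (Ordinal si) => // j _.
  by apply: H => /=.
move=> [i _ H]; apply/HD/disj_ofP; exists i => //; apply/conj_ofP => j sj.
exact: (H (Ordinal sj)).
Qed.

Lemma dnfU D1 D2 : dnf D1 -> dnf D2 -> dnf (D1 `|` D2).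
Proof.
move=> [L1 [H1 E1]] [L2 [H2 E2]]; exists (L1 ++ L2); split.
  by elim: {E1} L1 H1 => //= l L1 IH [? ?]; split => //; apply: IH.
move=> z; have -> : disj_of (L1 ++ L2) z <-> disj_of L1 z \/ disj_of L2 z.
  by elim: {H1 E1} L1 => /= [|l L1 ->]; [split => [|[]//]; right|rewrite or_assoc].
by rewrite -E1 -E2.
Qed.

Lemma dnfI D1 D2 : dnf D1 -> dnf D2 -> dnf (D1 `&` D2).
Proof.
move=> [L1 [H1 E1]] [L2 [H2 E2]].
have conj_cat l1 l2 z : conj_of (l1 ++ l2) z <-> conj_of l1 z /\ conj_of l2 z.
  elim: l1 => /= [|E l1 ->]; first by split => [|[]].
  by rewrite and_assoc.
have elem_cat l1 l2 : all_elementary l1 -> all_elementary l2 -> all_elementary (l1 ++ l2).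
  by elim: l1 => //= E l1 IH [? ?] ?; split => //; apply: IH.
have distr l z (L : seq (seq (set 'rV[int]_r))) :
    disj_of [seq l ++ l2 | l2 <- L] z <-> conj_of l z /\ disj_of L z.
  elim: L => /= [|l2 L ->]; first by split => [|[]].
  rewrite conj_cat; tauto.
elim: L1 D1 H1 E1 => [|l1 L1 IH] D1 /=.
  by move=> _ E1; exists [::]; split => // z /=; rewrite E1; split => [[]|].
move=> [Hl HL] E1.
have [L [HL' EL]] := IH _ HL (fun z => iff_refl _).
have := @dnfU (conj_of l1 `&` D2) (disj_of L1 `&` D2) _ _.
case.
- exists [seq l1 ++ l2 | l2 <- L2]; split; last first.
    by move=> z; rewrite distr -E2.
  by elim: L2 H2 {E2} => //= l2 L2 IH2 [? ?]; split; [exact: elem_cat|exact: IH2].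
- by exists L.
move=> L3 [H3 E3]; exists L3; split => // z; rewrite -E3 /= /setI /setU /= E1; tauto.
Qed.

Lemma dnf_elem D : elementary_region D -> dnf D.
Proof. by move=> H; exists [:: [:: D]] => /=; split => // z; tauto. Qed.

Lemma dnf_set0 : dnf set0.
Proof. by exists [::]. Qed.

Lemma dnf_big (T : Type) (s : seq T) (P : T -> set 'rV[int]_r) :
  (forall t, dnf (P t)) -> dnf (\big[setU/set0]_(t <- s) P t).
Proof.
move=> H; elim: s => [|t s IH]; first by rewrite big_nil; exact: dnf_set0.
by rewrite big_cons; apply: dnfU.
Qed.

Definition lin_row (l : lin 'I_r) : 'rV[int]_r :=
  \row_j \sum_(p <- l.1 | p.2 == j) p.1.

Lemma leval_row (l : lin 'I_r) (z : 'rV[int]_r) :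
  leval (fun j => z ord0 j) l = l.2 + dotz (lin_row l) z.
Proof.
rewrite /leval /dotz; congr (_ + _).
under [RHS]eq_bigr do rewrite mxE big_distrl /=.
rewrite (exchange_big_dep xpredT) //=; apply: eq_bigr => p _.
by rewrite (big_pred1 p.2) // => j; rewrite eq_sym.
Qed.

Lemma dotzN (u z : 'rV[int]_r) : dotz (- u) z = - dotz u z.
Proof. by rewrite /dotz -sumrN; apply: eq_bigr => j _; rewrite mxE mulNr. Qed.

(** The complement is carried along because elementary regions have none: a negated inequality
    becomes an inequality for the opposite vector, and a negated divisibility a union over the
    nonzero residues. *)
Lemma dnf_qf (F : qf 'I_r) :
  dnf [set z : 'rV[int]_r | qsat (fun j => z ord0 j) F] /\
  dnf [set z : 'rV[int]_r | ~~ qsat (fun j => z ord0 j) F].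
Proof.
elim: F => [l|m l|F [IH1 IH2]|F1 [IH1 IH1'] F2 [IH2 IH2']] /=.
- split.
    apply: dnf_elem; have -> : [set z : 'rV[int]_r | 0 < leval (fun j => z ord0 j) l] =
      [set z : 'rV_r | - l.2 < dotz (lin_row l) z]; last exact: RegionGt.
    by apply/seteqP; split => z /=; rewrite leval_row; lia.
  apply: dnf_elem; have -> : [set z : 'rV[int]_r | ~~ (0 < leval (fun j => z ord0 j) l)] =
      [set z : 'rV_r | l.2 - 1 < dotz (- lin_row l) z]; last exact: RegionGt.
  by apply/seteqP; split => z /=; rewrite leval_row dotzN; lia.
- have Ed (z : 'rV_r) (a : int) :
     (dotz (lin_row l) z = a - l.2 %[mod m.+1])%Z <->
     (leval (fun j => z ord0 j) l = a %[mod m.+1])%Z.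
    rewrite leval_row; split => /eqP; rewrite eqz_mod_dvd => H; apply/eqP;
      rewrite eqz_mod_dvd; move: H; congr (_ %| _)%Z; lia.
  split.
    apply: dnf_elem; have -> : [set z : 'rV[int]_r | (m.+1 %| leval (fun j => z ord0 j) l)%Z] =
      [set z : 'rV_r | dotz (lin_row l) z = 0 - l.2 %[mod m.+1]]%Z;
        last exact: RegionMod.
    apply/seteqP; split => z /= H.
      by apply/Ed/eqP; rewrite eqz_mod_dvd subr0.
    by move/Ed/eqP: H; rewrite eqz_mod_dvd subr0.
  have -> : [set z : 'rV[int]_r | ~~ (m.+1 %| leval (fun j => z ord0 j) l)%Z] =
     \big[setU/set0]_(a <- iota 1 m)
       [set z : 'rV_r | dotz (lin_row l) z = a%:Z - l.2 %[mod m.+1]]%Z.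
    apply/seteqP; split => z /=; rewrite big_seq -bigcup_seq_cond /=.
      move=> H; exists `|(leval (fun j => z ord0 j) l %% m.+1)%Z|%N => /=.
        rewrite mem_iota.
        have := modz_ge0 (leval (fun j => z ord0 j) l) (isT : m.+1%:Z != 0).
        have := ltz_mod (leval (fun j => z ord0 j) l) (isT : m.+1%:Z != 0).
        by move/dvdz_mod0P: H; lia.
      apply/Ed; rewrite gez0_abs ?modz_mod // modz_ge0 //.
    move=> [a /= /andP[_ ]]; rewrite mem_iota => Ha /Ed H.
    apply/negP => /dvdz_mod0P; rewrite H modz_small; lia.
  by apply: dnf_big => a; apply: dnf_elem; exact: RegionMod.
- by split => //; move: IH1; congr dnf; apply/seteqP; split => z /=; rewrite negbK.
- split.
    move: (dnfI IH1 IH2); congr dnf; apply/seteqP; split => z /=.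
      by move=> [-> ->].
    by move=> /andP.
  move: (dnfU IH1' IH2'); congr dnf; apply/seteqP; split => z /=.
    by move=> [/negPf->|/negPf->]; rewrite ?andbF.
  by rewrite negb_and => /orP.
Qed.

Lemma pres_polyhedral D :
  pres (fun e : 'I_r -> int => D (\row_j e j)) -> polyhedral D.
Proof.
move=> [F HF]; apply: dnf_polyhedral; have [] := dnf_qf F.
move=> + _; congr dnf; apply/seteqP; split => z /=.
  by move/HF; congr D; apply/rowP => j; rewrite mxE.
by move=> Hz; apply/HF; move: Hz; congr D; apply/rowP => j; rewrite mxE.
Qed.

Lemma polyhedral_pres D :
  polyhedral D -> pres (fun e : 'I_r -> int => D (\row_j e j)).
Proof.
move=> [n [c [E [HE ->]]]].
have dotl (u : 'rV[int]_r) : islin (fun e : 'I_r -> int => dotz u (\row_j e j)).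
  apply: islin_sum => j; apply: islinZ.
  by have [l Hl] := @islin_var 'I_r j; exists l => e; rewrite mxE.
have K (A : set 'rV[int]_r) : elementary_region A ->
    pres (fun e : 'I_r -> int => A (\row_j e j)).
  case=> [u a|u a b|u a] /=.
  - by apply: pres_eq => //; exact: islin_const.
  (* The modulus [b] may be 0, in which case the congruence is an equality; quantifying over the
     quotient covers both cases. *)
  - apply: pres_ext (@pres_ex 'I_r (fun e q => dotz u (\row_j e j) = a + b%:Z * q) _).
      move=> e; split; last first.
        move/eqP; rewrite eqz_mod_dvd => /dvdzP[q Hq]; exists q.
        by rewrite mulrC -Hq; lia.
      by move=> [q ->]; apply/eqP; rewrite eqz_mod_dvd addrAC subrr add0r dvdz_mulr.
    apply: pres_eq.
      by apply: (islin_subst _ (dotl u)) => j; exact: islin_var.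
    by apply: islinD; [exact: islin_const|apply: islinZ; exact: islin_var].
  - by apply: pres_lt => //; exact: islin_const.
apply: pres_ext (pres_ex_fin (fun i => pres_all_fin (fun j => K _ (HE i j)))) => e.
by split => [[i Hi]|[i _ Hi]]; exists i => //= j; apply: Hi.
Qed.

End Polyhedral.

Ltac sumlia := repeat match goal with
  | |- context [bigop ?x ?r ?f] =>
    let s := fresh "s" in set s := (bigop x r f); clearbody s end; lia.

(** * Sets of natural vectors as disjoint unions of free affine pieces *)

Definition isaff (T : finType) (L : (T -> nat) -> nat) : Prop :=
  exists (A : T -> nat) (c : nat), forall x, L x = (c + \sum_t A t * x t)%N.

Section Affine.
Variable T : finType.
Implicit Types L : (T -> nat) -> nat.

Lemma isaff_const c : isaff (fun _ : T -> nat => c).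
Proof. by exists (fun=> 0%N), c => x; rewrite big1 ?addn0. Qed.

Lemma isaff_var t : isaff (fun x : T -> nat => x t).
Proof.
exists (fun t' => t' == t : nat), 0%N => x; rewrite (bigD1 t) //= eqxx mul1n.
by rewrite big1 ?addn0 // => t' /negPf->.
Qed.

Lemma isaffD L1 L2 : isaff L1 -> isaff L2 -> isaff (fun x => L1 x + L2 x)%N.
Proof.
move=> [A1 [c1 H1]] [A2 [c2 H2]].
exists (fun t => A1 t + A2 t)%N, (c1 + c2)%N => x; rewrite H1 H2 addnACA.
by rewrite -big_split; congr (_ + _)%N; apply: eq_bigr => t _; rewrite mulnDl.
Qed.

Lemma isaffZ n L : isaff L -> isaff (fun x => n * L x)%N.
Proof.
move=> [A [c H]]; exists (fun t => n * A t)%N, (n * c)%N => x.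
rewrite H mulnDr big_distrr /=; congr (_ + _)%N.
by apply: eq_bigr => t _; rewrite mulnA.
Qed.

Lemma isaff_sum (I : Type) (s : seq I) (L : (T -> nat) -> I -> nat) :
  (forall i, isaff (fun x => L x i)) -> isaff (fun x => \sum_(i <- s) L x i)%N.
Proof.
move=> H; elim: s => [|i s IH].
  have [A [c Hc]] := isaff_const 0; exists A, c => x; by rewrite big_nil -Hc.
have [A [c Hc]] := isaffD (H i) IH; exists A, c => x; by rewrite big_cons -Hc.
Qed.

End Affine.

Lemma isaff_comp (T T' : finType) (L : (T -> nat) -> nat)
    (g : (T' -> nat) -> T -> nat) :
  (forall t, isaff (fun x => g x t)) -> isaff L -> isaff (fun x => L (g x)).
Proof.
move=> Hg [A [c HL]].
have [B [d H]] := isaffD (isaff_const _ c)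
  (isaff_sum (index_enum T) (fun t => isaffZ (A t) (Hg t))).
by exists B, d => x; rewrite HL H.
Qed.

(** Disjointness and injectivity are recorded at each constructor, so that the elements of a level
    set can be counted by induction on the derivation. The dimension changes along [DecompM], whence
    the quantification over all finite types. *)
Inductive decomp : forall T : finType, set (T -> nat) -> Prop :=
| Decomp0 (T : finType) : @decomp T set0
| DecompU (T : finType) (P Q : set (T -> nat)) : decomp P -> decomp Q ->
    P `&` Q = set0 -> decomp (P `|` Q)
| DecompT (T : finType) : @decomp T setT
| DecompM (T' T : finType) (g : (T' -> nat) -> T -> nat) (P : set (T' -> nat)) :
    (forall t, isaff (fun x => g x t)) ->
    (forall x y, P x -> P y -> g x = g y -> x = y) ->
    decomp P -> decomp (g @` P).

Section Elliott.
Variable T : finType.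
Implicit Types (S : {set T}) (a : T -> int) (b : int).

Definition supp S : set (T -> nat) := [set x | forall t, t \notin S -> x t = 0%N].

(** Variables are eliminated by shrinking the support [S], with the type [T] kept fixed. *)
Definition linsol S a b : set (T -> nat) :=
  [set x | supp S x /\ \sum_t a t * (x t)%:Z = b].

Lemma decomp_supp S : decomp (supp S).
Proof.
pose T' := {t : T | t \in S}.
pose g (x : T' -> nat) (t : T) : nat := oapp x 0%N (insub t).
have -> : supp S = g @` setT.
  apply/seteqP; split => x.
    move=> Hx; exists (fun t => x (val t)) => //; apply/funext => t; rewrite /g.
    by case: insubP => [u _ <-|/Hx].
  by move=> [y _ <-] t tS; rewrite /g insubN.
apply: DecompM; last exact: DecompT.
  move=> t; rewrite /g; case: insubP => [u _ _|_]; first exact: isaff_var.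
  exact: isaff_const.
move=> x y _ _ E; apply/funext => u.
by have /(congr1 (@^~ (val u))) := E; rewrite /g valK.
Qed.

Definition upd (x : T -> nat) (i : T) (n : nat) : T -> nat :=
  fun t => if t == i then n else x t.

Lemma sum_upd a (x : T -> nat) i n :
  \sum_t a t * (upd x i n t)%:Z = \sum_t a t * (x t)%:Z + a i * (n%:Z - (x i)%:Z).
Proof.
rewrite (bigD1 i) //= [in RHS](bigD1 i) //= /upd eqxx.
rewrite (eq_bigr (fun t => a t * (x t)%:Z)) => [|t /negPf->//].
by move: (\sum_(_ | _) _) => s; lia.
Qed.

Lemma sum_updl a c (x : T -> nat) i :
  \sum_t (if t == i then c else a t) * (x t)%:Z =
  \sum_t a t * (x t)%:Z + (c - a i) * (x i)%:Z.
Proof.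
rewrite (bigD1 i) //= [in RHS](bigD1 i) //= eqxx.
rewrite (eq_bigr (fun t => a t * (x t)%:Z)) => [|t /negPf->//].
by move: (\sum_(_ | _) _) => s; lia.
Qed.

Lemma supp_upd S (x : T -> nat) i n : i \in S -> supp S (upd x i n) <-> supp S x.
Proof.
move=> iS; split => H t tS; move: (H t tS); rewrite /upd;
by case: eqP tS => // ->; rewrite iS.
Qed.

Lemma linsolN S a b : linsol S (fun t => - a t) (- b) = linsol S a b.
Proof.
apply/seteqP; split => x [H1 H2]; split => //.
  apply: oppr_inj; rewrite -H2 -sumrN; apply: eq_bigr => t _; by rewrite mulNr.
by rewrite -H2 -sumrN; apply: eq_bigr => t _; rewrite mulNr.
Qed.

Lemma linsol0 S a b : (forall t, t \in S -> a t = 0) -> decomp (linsol S a b).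
Proof.
move=> a0.
have E x : supp S x -> \sum_t a t * (x t)%:Z = 0.
  move=> Hx; apply: big1 => t _; have [/a0->|/Hx->] := boolP (t \in S).
    by rewrite mul0r.
  by rewrite mulr0.
have [->|b0] := eqVneq b 0.
  have -> : linsol S a 0 = supp S; last exact: decomp_supp.
  by apply/seteqP; split => x; [case|move=> Hx; split => //; exact: E].
have -> : linsol S a b = set0; last exact: Decomp0.
by apply/seteqP; split => x // -[/E E1 E2]; move: b0; rewrite -E2 E1 eqxx.
Qed.

(** For [a i > 0], the solutions with [x i = 0] live on a smaller support, and the others are shifts
    by one of solutions for [b - a i]. With nonnegative coefficients nothing is left once the
    right-hand side is negative. *)
Lemma linsol_mono S a b : (forall t, t \in S -> 0 <= a t) -> decomp (linsol S a b).
Proof.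
have [n] := ubnP #|S|; elim: n S b => // n IHn S b Sn.
have [m] := ubnP `|b|%N; elim: m b => // m IHm b bm a0.
have [/existsP[i /andP[iS ai]]|/existsPn N] :=
  boolP [exists i, (i \in S) && (0 < a i)]; last first.
  apply: linsol0 => t tS; move: (a0 t tS) (N t); rewrite tS /=; lia.
have [b0|b0] := ltrP b 0.
  have -> : linsol S a b = set0; last exact: Decomp0.
  apply/seteqP; split => x // -[Hx Eb].
  have : 0 <= b; last by lia.
  rewrite -Eb; apply: sumr_ge0 => t _; have [/a0 H|/Hx->] := boolP (t \in S).
    by rewrite mulr_ge0.
  by rewrite mulr0.
pose sh (x : T -> nat) := upd x i (x i).+1.
have Esh x : \sum_t a t * (sh x t)%:Z = \sum_t a t * (x t)%:Z + a i.
  rewrite sum_upd; sumlia.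
have D1 : decomp (sh @` linsol S a (b - a i)).
  have [bi|bi] := ltrP b (a i).
    have -> : linsol S a (b - a i) = set0; last by rewrite image_set0; exact: Decomp0.
    apply/seteqP; split => x // -[Hx Eb].
    have : 0 <= b - a i; last by lia.
    rewrite -Eb; apply: sumr_ge0 => t _; have [/a0 H|/Hx->] := boolP (t \in S).
      by rewrite mulr_ge0.
    by rewrite mulr0.
  apply: DecompM; last by apply: IHm => //; lia.
    move=> t; rewrite /sh /upd; case: eqP => _; last exact: isaff_var.
    have [A [c H]] := isaffD (isaff_const T 1) (isaff_var i).
    by exists A, c => x; rewrite -H.
  move=> x y _ _ E; apply/funext => t; move/(congr1 (@^~ t)): E.
  by rewrite /sh /upd; case: eqP => [->[]|].
have D0 : decomp (linsol (S :\ i) a b).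
  apply: IHn; first by move: Sn; rewrite (cardsD1 i S) iS; lia.
  by move=> t; rewrite inE => /andP[_ /a0].
have := DecompU D0 D1; have -> : linsol (S :\ i) a b `|` sh @` linsol S a (b - a i)
    = linsol S a b.
  apply/seteqP; split => x.
    move=> [[H1 H2]|[y [H1 H2] <-]].
      by split => // t tS; apply: H1; rewrite inE (negPf tS) andbF.
    split; last by rewrite Esh H2; lia.
    exact/supp_upd.
  move=> [H1 H2]; have [xi|xi] := posnP (x i); last first.
    right; exists (upd x i (x i).-1).
      split; first exact/supp_upd.
      have E : (x i).-1%:Z = (x i)%:Z - 1 by lia.
      by rewrite sum_upd H2 E; lia.
    apply/funext => t; rewrite /sh /upd; case: eqP => [->|//]; rewrite eqxx; lia.
  left; split => // t; rewrite !inE negb_and negbK => /orP[/eqP->//|/H1//].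
apply; apply/seteqP; split => x // -[[/(_ i)]].
by rewrite !inE eqxx => /(_ isT) xi _ [y _ E]; move: xi; rewrite -E /sh /upd eqxx.
Qed.

(* Elliott's splitting of a linear equation: for a i > 0 > a j, the solutions
   with x j <= x i and those with x i < x j are parametrized by the solutions of
   an equation where a j, resp. a i, is replaced by a i + a j. *)
Lemma linsol_split S a b i j : i \in S -> j \in S -> i != j ->
  decomp (linsol S (fun t => if t == j then a i + a j else a t) b) ->
  decomp (linsol S (fun t => if t == i then a i + a j else a t) (b - a j)) ->
  decomp (linsol S a b).
Proof.
move=> iS jS ij D1 D2.
pose f (x : T -> nat) := upd x i (x i + x j).
pose g (x : T -> nat) := upd x j (x j + x i + 1).
have Hf : forall t, isaff (fun x => f x t).
  move=> t; rewrite /f /upd; case: eqP => _; last exact: isaff_var.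
  by apply: isaffD; exact: isaff_var.
have Hg : forall t, isaff (fun x => g x t).
  move=> t; rewrite /g /upd; case: eqP => _; last exact: isaff_var.
  by apply: isaffD; [apply: isaffD; exact: isaff_var|exact: isaff_const].
have If x y : f x = f y -> x = y.
  move=> E; have Et t := congr1 (@^~ t) E; apply/funext => t.
  move: (Et t) (Et i) (Et j); rewrite /f /upd eqxx [j == i]eq_sym (negPf ij).
  by case: eqP => [->|//]; lia.
have Ig x y : g x = g y -> x = y.
  move=> E; have Et t := congr1 (@^~ t) E; apply/funext => t.
  move: (Et t) (Et i) (Et j); rewrite /g /upd eqxx (negPf ij).
  by case: eqP => [->|//]; lia.
have := DecompU (DecompM Hf (fun x y _ _ => @If x y) D1)
  (DecompM Hg (fun x y _ _ => @Ig x y) D2).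
set A := f @` _; set B := g @` _.
have -> : A `|` B = linsol S a b.
  apply/seteqP; split => x.
    move=> [[y [H1 H2] <-]|[y [H1 H2] <-]].
      split; first exact/supp_upd.
      by move: H2; rewrite sum_upd sum_updl; sumlia.
    split; first exact/supp_upd.
    by move: H2; rewrite sum_upd sum_updl; sumlia.
  move=> [H1 H2]; have [xij|xij] := leqP (x j) (x i).
    left; exists (upd x i (x i - x j)).
      split; first exact/supp_upd.
      rewrite sum_updl sum_upd /upd [j == i]eq_sym (negPf ij) -H2.
      have -> : (x i - x j)%N%:Z = (x i)%:Z - (x j)%:Z by lia.
      sumlia.
    apply/funext => t; rewrite /f /upd eqxx [j == i]eq_sym (negPf ij).
    by case: eqP => [->|//]; lia.
  right; exists (upd x j (x j - x i - 1)).
    split; first exact/supp_upd.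
    rewrite sum_updl sum_upd /upd (negPf ij) -H2.
    have -> : (x j - x i - 1)%N%:Z = (x j)%:Z - (x i)%:Z - 1 by lia.
    sumlia.
  apply/funext => t; rewrite /g /upd eqxx (negPf ij).
  by case: eqP => [->|//]; lia.
apply; apply/seteqP; split => // x [[y _ <-] [z _ E]].
move: (congr1 (@^~ i) E) (congr1 (@^~ j) E).
by rewrite /f /g /upd !eqxx [j == i]eq_sym (negPf ij); lia.
Qed.

(* Splitting at an entry i of maximal absolute value M either removes an entry
   of absolute value M or an entry of sign opposite to that of a i. *)
Lemma decomp_linsol S a b : decomp (linsol S a b).
Proof.
have [M] : exists M : nat, forall t, t \in S -> `|a t| <= M%:Z.
  exists (\sum_t `|a t|)%N => t _; rewrite (bigD1 t) //=; lia.
elim: M a b => [|M IHM] a b HM.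
  by apply: linsol0 => t /HM; lia.
have [c] := ubnP #|[set t in S | `|a t| == M.+1%:Z]|.
elim: c a b HM => // c IHc a b HM Hc.
have [/existsP[i /andP[iS /eqP ai]]|/existsPn N] :=
  boolP [exists i, (i \in S) && (`|a i| == M.+1%:Z)]; last first.
  apply: IHM => t tS; move: (HM t tS) (N t); rewrite tS /=; lia.
(* The sign is normalized to [a i = M+1]; for fixed [c] the inner induction is on the number of
   negative entries. *)
have pos (a' : T -> int) b' : (forall t, t \in S -> `|a' t| <= M.+1%:Z) ->
    (#|[set t in S | `|a' t|%R == M.+1%:Z]| < c.+1)%N -> a' i = M.+1%:Z ->
    decomp (linsol S a' b').
  have [n] := ubnP #|[set t in S | a' t < 0]|.
  elim: n a' b' => // n IHn {}a {}b Hn {}HM {}Hc {}ai.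
  have [/existsP[j /andP[jS aj]]|/existsPn N] :=
    boolP [exists j, (j \in S) && (a j < 0)]; last first.
    by apply: linsol_mono => t tS; move: (N t); rewrite tS /=; lia.
  have ij : i != j by apply/eqP => E; move: aj; rewrite -E ai.
  have Mj := HM _ jS.
  (* Since [a i = M+1] and [-(M+1) <= a j < 0], the new coefficient [a i + a j] lies between 0 and
     [M]: at [j] it removes a negative entry, at [i] an entry of absolute value [M+1]. *)
  apply: (linsol_split iS jS ij).
    apply: IHn.
    - apply: leq_trans (Hn : (_ <= n)%N); apply: proper_card; apply/properP; split.
        apply/fintype.subsetP => t; rewrite !inE => /andP[-> /=].
        by case: (t =P j) => [->|_]; rewrite ?ai; lia.
      by exists j; rewrite !inE jS //= eqxx ai; lia.
    - by move=> t tS; have := HM _ tS; case: (t =P j) => [->|_]; rewrite ?ai; lia.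
    - apply: leq_ltn_trans Hc; apply: subset_leq_card; apply/fintype.subsetP => t.
      by rewrite !inE => /andP[-> /=]; case: (t =P j) => [->|_]; rewrite ?ai; lia.
    - by rewrite (negPf ij).
  apply: IHc.
    by move=> t tS; have := HM _ tS; case: (t =P i) => [->|_]; rewrite ?ai; lia.
  apply: leq_trans (Hc : (_ <= c)%N); apply: proper_card; apply/properP; split.
    apply/fintype.subsetP => t; rewrite !inE => /andP[-> /=].
    by case: (t =P i) => [->|_]; rewrite ?ai; lia.
  by exists i; rewrite !inE iS /= ?eqxx ai; lia.
have [ai0|ai0] := lerP 0 (a i); first by apply: pos => //; lia.
rewrite -linsolN; apply: pos; last by lia.
  by move=> t tS; rewrite normrN HM.
apply: leq_ltn_trans Hc; apply: subset_leq_card; apply/fintype.subsetP => t.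
by rewrite !inE normrN.
Qed.

End Elliott.

Definition islinN (T : finType) (L : (T -> nat) -> int) : Prop :=
  exists (a : T -> int) b, forall x, L x = b + \sum_t a t * (x t)%:Z.

Lemma islinN_const (T : finType) b : islinN (fun _ : T -> nat => b).
Proof. by exists (fun=> 0), b => x; rewrite big1 ?addr0 // => t _; rewrite mul0r. Qed.

Lemma islinN_aff (T : finType) (L : (T -> nat) -> nat) :
  isaff L -> islinN (fun x => (L x)%:Z).
Proof.
move=> [A [c H]]; exists (fun t => (A t)%:Z), c%:Z => x.
rewrite H PoszD; congr (_ + _); rewrite (big_morph Posz PoszD (erefl 0%:Z)).
by apply: eq_bigr => t _; rewrite PoszM.
Qed.

Lemma islinND (T : finType) (L1 L2 : (T -> nat) -> int) :
  islinN L1 -> islinN L2 -> islinN (fun x => L1 x + L2 x).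
Proof.
move=> [a1 [b1 H1]] [a2 [b2 H2]]; exists (fun t => a1 t + a2 t), (b1 + b2) => x.
rewrite H1 H2 addrACA -big_split; congr (_ + _).
by apply: eq_bigr => t _; rewrite mulrDl.
Qed.

Lemma islinNZ (T : finType) c (L : (T -> nat) -> int) :
  islinN L -> islinN (fun x => c * L x).
Proof.
move=> [a [b H]]; exists (fun t => c * a t), (c * b) => x.
rewrite H mulrDr mulr_sumr; congr (_ + _).
by apply: eq_bigr => t _; rewrite mulrA.
Qed.

Lemma islinN_sum (T : finType) (I : Type) (s : seq I) (L : (T -> nat) -> I -> int) :
  (forall i, islinN (fun x => L x i)) -> islinN (fun x => \sum_(i <- s) L x i).
Proof.
move=> H; elim: s => [|i s IH].
  have [a [b Hb]] := islinN_const T 0; exists a, b => x; by rewrite big_nil -Hb.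
have [a [b Hb]] := islinND (H i) IH; exists a, b => x; by rewrite big_cons -Hb.
Qed.

Lemma islinN_comp (T T' : finType) (L : (T -> nat) -> int)
    (g : (T' -> nat) -> T -> nat) :
  (forall t, isaff (fun x => g x t)) -> islinN L -> islinN (fun x => L (g x)).
Proof.
move=> Hg [a [b HL]].
have [a' [b' H]] := islinND (islinN_const _ b)
  (islinN_sum (index_enum T) (fun t => islinNZ (a t) (islinN_aff (Hg t)))).
by exists a', b' => x; rewrite HL H.
Qed.

Lemma islin_islinN (V : Type) (T : finType) (L : (V -> int) -> int)
    (s : (T -> nat) -> V -> int) :
  islin L -> (forall v, islinN (fun x => s x v)) -> islinN (fun x => L (s x)).
Proof.
move=> [[l b] H] Hs.
have [a' [b' H']] := islinND (islinN_const _ b)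
  (islinN_sum l (fun p => islinNZ p.1 (Hs p.2))).
by exists a', b' => x; rewrite H /leval H'.
Qed.

(** A constraint is pulled back along each affine map in the derivation of [P] until it meets a free
    piece, where its own decomposition applies. *)
Lemma decomp_capM (C : forall T : finType, set (T -> nat) -> Prop) :
  (forall (T : finType) (Q : set (T -> nat)), C T Q -> decomp Q) ->
  (forall (T T' : finType) (g : (T' -> nat) -> T -> nat) Q,
    (forall t, isaff (fun x => g x t)) -> C T Q -> C T' (g @^-1` Q)) ->
  forall (T : finType) (P Q : set (T -> nat)), decomp P -> C T Q -> decomp (P `&` Q).
Proof.
move=> C0 Cg T P Q DP; elim: DP Q => {T P} [T|T P1 P2 _ IH1 _ IH2 H12|T|T' T g P Hg Ig _ IH] Q CQ.
- by rewrite set0I; exact: Decomp0.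
- rewrite setIUl; apply: DecompU; [exact: IH1|exact: IH2|].
  by rewrite setIACA H12 set0I.
- by rewrite setTI; exact: C0.
- have -> : g @` P `&` Q = g @` (P `&` g @^-1` Q).
    apply/seteqP; split => x; first by move=> [[y Py <-] Qy]; exists y.
    by move=> [y [Py Qy] <-]; split => //; exists y.
  apply: DecompM => //; last by apply: IH; exact: Cg.
  by move=> x y [Px _] [Py _]; exact: Ig.
Qed.

Lemma big_option (R : zmodType) (T : finType) (F : option T -> R) :
  \sum_t F t = F None + \sum_t F (Some t).
Proof.
rewrite (bigD1 None) //=; congr (_ + _).
rewrite (reindex_omap Some id) //= => [|[t|] //].
by apply: eq_bigl => t; rewrite eqxx.
Qed.

(** The witness [n] becomes the additional variable [None] of a linear equation. As [c] is nonzero,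
    [x] determines it, so that forgetting it is injective on the solutions. *)
Lemma decomp_slack (T : finType) (a : T -> int) (c b : int) :
  c != 0 ->
  decomp [set x : T -> nat | exists n : nat, \sum_t a t * (x t)%:Z = b + c * n%:Z].
Proof.
move=> c0; pose a' (o : option T) := if o is Some t then a t else - c.
pose g (x : option T -> nat) (t : T) := x (Some t).
have -> : [set x : T -> nat | exists n : nat, \sum_t a t * (x t)%:Z = b + c * n%:Z] =
    g @` linsol [set: option T]%SET a' b.
  apply/seteqP; split => x.
    move=> [n H]; exists (fun o => if o is Some t then x t else n) => //.
    split; first by move=> t; rewrite inE.
    by rewrite big_option /= H; lia.
  move=> [y [_ H] <-]; exists (y None); move: H; rewrite big_option /g /=; sumlia.
apply: DecompM; last exact: decomp_linsol.
  by move=> t; exact: isaff_var.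
move=> x y [_ H1] [_ H2] E.
have Es t : x (Some t) = y (Some t) by exact: (congr1 (@^~ t) E).
apply/funext => -[t|] //.
have : \sum_t a' (Some t) * (x (Some t))%:Z = \sum_t a' (Some t) * (y (Some t))%:Z.
  by apply: eq_bigr => t _; rewrite Es.
move: H1 H2; rewrite !big_option /= => H1 H2 H3.
have : c * (x None)%:Z = c * (y None)%:Z by move: H1 H2 H3; sumlia.
by move/(mulfI c0) => [].
Qed.

Lemma decomp_ge (T : finType) (L : (T -> nat) -> int) :
  islinN L -> decomp [set x | 0 <= L x].
Proof.
move=> [a [b H]].
have := @decomp_slack T a 1 (- b) isT; congr decomp.
apply/seteqP; split => x /=; rewrite H.
  by move=> [n ->]; lia.
by move=> Hx; exists `|(b + \sum_t a t * (x t)%:Z)%R|%N; move: Hx; sumlia.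
Qed.

Lemma decomp_dvd (T : finType) (m : nat) (L : (T -> nat) -> int) :
  islinN L -> decomp [set x | (m.+1%:Z %| L x)%Z].
Proof.
move=> [a [b H]].
pose L' (x : T -> nat) := (b %% m.+1)%Z + \sum_t (a t %% m.+1)%Z * (x t)%:Z.
have m0 : m.+1%:Z != 0 by [].
have modD (z : int) : (m.+1%:Z %| z - (z %% m.+1)%Z)%Z.
  by rewrite {1}(divz_eq z m.+1%:Z) addrK dvdz_mull.
(* Reducing the coefficients modulo [m+1] makes the form nonnegative, hence the quotient a natural
   number, as the slack variable requires. *)
have EL x : (m.+1%:Z %| L x)%Z = (m.+1%:Z %| L' x)%Z.
  have D : (m.+1%:Z %| L x - L' x)%Z.
    rewrite H /L' opprD addrACA rpredD //.
    rewrite -sumrB; apply: rpred_sum => t _.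
    by rewrite -mulrBl dvdz_mulr.
  by rewrite -[in LHS](subrK (L' x) (L x)) rpredDl.
have L'0 x : 0 <= L' x.
  by rewrite /L' addr_ge0 ?sumr_ge0 ?modz_ge0 // => t _; rewrite mulr_ge0 ?modz_ge0.
have := @decomp_slack T (fun t => (a t %% m.+1%:Z)%Z) m.+1%:Z
  (- (b %% m.+1%:Z)%Z) m0; congr decomp.
apply/seteqP; split => x; rewrite /= EL /L'.
  by move=> [n ->]; rewrite addNKr dvdz_mulr.
move=> /dvdzP[n E]; have := L'0 x; rewrite /L' E pmulr_lge0 // => n0.
by exists `|n|%N; move: E; rewrite gez0_abs //; sumlia.
Qed.

(** By induction on the formula, for it and for its negation at once and for every decomposable [P],
    so that a second conjunct can be imposed on the pieces given by the first. *)
Lemma decompI_pres (T V : finType) (P : set (T -> nat)) (s : (T -> nat) -> V -> int)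
    (Q : (V -> int) -> Prop) :
  (forall v, islinN (fun x => s x v)) -> pres Q -> decomp P ->
  decomp (P `&` [set x | Q (s x)]).
Proof.
move=> Hs [F HF] DP.
have -> : [set x | Q (s x)] = [set x | qsat (s x) F].
  by apply/seteqP; split => x /HF.
suff: (decomp (P `&` [set x | qsat (s x) F])) /\
       (decomp (P `&` [set x | ~~ qsat (s x) F])) by case.
have ge (P' : set (T -> nat)) L : decomp P' -> islinN L ->
    decomp (P' `&` [set x | 0 <= L x]).
  move=> DP' HL; apply: (@decomp_capM (fun T Q => exists2 L : (T -> nat) -> int,
     islinN L & Q = [set x | 0 <= L x])) => //; last by exists L.
    by move=> T' _ [L' H ->]; exact: decomp_ge.
  by move=> T1 T2 g _ Hg [L' HL' ->]; exists (fun x => L' (g x)) => //;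
    exact: islinN_comp.
have dvd (P' : set (T -> nat)) m L : decomp P' -> islinN L ->
    decomp (P' `&` [set x | (m.+1%:Z %| L x)%Z]).
  move=> DP' HL; apply: (@decomp_capM (fun T Q => exists2 L : (T -> nat) -> int,
     islinN L & Q = [set x | (m.+1%:Z %| L x)%Z])) => //; last by exists L.
    by move=> T' _ [L' H ->]; exact: decomp_dvd.
  by move=> T1 T2 g _ Hg [L' HL' ->]; exists (fun x => L' (g x)) => //;
    exact: islinN_comp.
elim: F P DP {HF} => [l|m l|F IH|F1 IH1 F2 IH2] P DP /=.
- have Hl : islinN (fun x => leval (s x) l).
    by apply: (@islin_islinN V T (fun e => leval e l)) => //; exists l.
  split.
    have := ge _ _ DP (islinND (islinN_const T (-1)) Hl); congr (decomp (P `&` _)).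
    by apply/seteqP; split => x /=; lia.
  have := ge _ _ DP (islinNZ (-1) Hl); congr (decomp (P `&` _)).
  by apply/seteqP; split => x /=; lia.
- have Hl : islinN (fun x => leval (s x) l).
    by apply: (@islin_islinN V T (fun e => leval e l)) => //; exists l.
  split; first exact: dvd.
  (* Non-divisibility is split according to the unique [r] between 1 and [m] that restores
     divisibility; [U n] collects the cases [r <= n]. *)
  pose U n := P `&` [set x | exists2 r : nat, (0 < r <= n)%N &
     (m.+1%:Z %| r%:Z + leval (s x) l)%Z].
  have -> : P `&` [set x | ~~ (m.+1%:Z %| leval (s x) l)%Z] = U m.
    congr (P `&` _); apply/seteqP; split => x /=.
      move=> H; have m0 : m.+1%:Z != 0 by [].
      exists `|m.+1%:Z - (leval (s x) l %% m.+1)%Z|%N.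
        have := modz_ge0 (leval (s x) l) m0.
        have := ltz_mod (leval (s x) l) m0.
        by move/dvdz_mod0P: H; lia.
      have := ltz_mod (leval (s x) l) m0; rewrite /= => lt.
      rewrite gez0_abs; last by lia.
      rewrite -addrA rpredD // addrC {1}(divz_eq (leval (s x) l) m.+1%:Z) addrK.
      by rewrite dvdz_mull.
    move=> [r Hr H]; apply/negP => H'; move: H; rewrite rpredDr //.
    by rewrite dvdzE /=; apply/negP/negP; rewrite gtnNdvd //; lia.
  have Um n : (n <= m)%N -> decomp (U n).
    elim: n => [|n IH] nm.
      have -> : U 0%N = set0; last exact: Decomp0.
      by apply/seteqP; split => x // -[_ [r]]; lia.
    have D : decomp (P `&` [set x | (m.+1%:Z %| n.+1%:Z + leval (s x) l)%Z]).
      by apply: dvd => //; apply: islinND => //; exact: islinN_const.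
    have := DecompU (IH (ltnW nm)) D.
    have -> : U n `|` (P `&` [set x | (m.+1%:Z %| n.+1%:Z + leval (s x) l)%Z]) = U n.+1.
      rewrite -setIUr; congr (P `&` _); apply/seteqP; split => x /=.
        by move=> [[r Hr H]|H]; [exists r => //; lia|exists n.+1 => //; lia].
      move=> [r Hr H]; have [rn|rn] := eqVneq r n.+1; first by right; rewrite -rn.
      by left; exists r => //; lia.
    apply; apply/seteqP; split => x // -[[_ [r Hr H1]] [_ H2]].
    have : (m.+1%:Z %| (n.+1%:Z + leval (s x) l) - (r%:Z + leval (s x) l))%Z.
      by rewrite rpredB.
    have -> : (n.+1%:Z + leval (s x) l) - (r%:Z + leval (s x) l) = (n.+1 - r)%N%:Z.
      by lia.
    by rewrite dvdzE /= gtnNdvd //; lia.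
  exact: Um.
- have [H1 H2] := IH _ DP; split => //.
  by move: H1; congr (decomp (P `&` _)); apply/seteqP; split => x /=; rewrite negbK.
- have [D1 D1'] := IH1 _ DP; have [D2 D2'] := IH2 _ D1.
  split.
    by move: D2; rewrite -setIA; congr (decomp (P `&` _)); apply/seteqP;
      split => x /=; [move=> [-> ->]|move/andP].
  (* To keep the union disjoint, the negated conjunction is read as: not [F1], or [F1] and not
     [F2]. *)
  have := DecompU D1' D2'; rewrite -!setIA -setIUr.
  have -> : [set x | ~~ qsat (s x) F1] `|`
      ([set x | qsat (s x) F1] `&` [set x | ~~ qsat (s x) F2]) =
      [set x | ~~ (qsat (s x) F1 && qsat (s x) F2)].
    apply/seteqP; split => x /=; rewrite negb_and.
      by move=> [->//|[_ ->]]; rewrite orbT.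
    by case: (qsat (s x) F1) => //= H; [right|left].
  by apply; apply/seteqP; split => x //= -[_ [/negP H [_ [H' _]]]].
Qed.

(** * Rationality of counting series *)

(** The coefficients of the product of the polynomial [q] with the power series of [a]. *)
Definition conv (q : {poly int}) (a : nat -> int) (n : nat) : int :=
  \sum_(i < n.+1) q`_i * a (n - i)%N.

Lemma conv_coef q a n N : (n < N)%N -> conv q a n = (q * \poly_(i < N) a i)`_n.
Proof.
move=> nN; rewrite coefM; apply: eq_bigr => i _.
by rewrite coef_poly (leq_ltn_trans (leq_subr _ _) nN).
Qed.

Lemma eq_conv q a b n : a =1 b -> conv q a n = conv q b n.
Proof. by move=> E; apply: eq_bigr => i _; rewrite E. Qed.

Lemma convA q1 q2 a n : conv (q2 * q1) a n = conv q2 (conv q1 a) n.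
Proof.
rewrite (@conv_coef _ _ _ n.+1) // -mulrA coefM; apply: eq_bigr => i _.
by rewrite (@conv_coef _ _ _ n.+1) // ltnS leq_subr.
Qed.

Lemma conv_poly q (p : {poly int}) n : conv q (fun n => p`_n) n = (q * p)`_n.
Proof. by rewrite coefM. Qed.

Lemma convD q a b n : conv q (fun n => a n + b n) n = conv q a n + conv q b n.
Proof. by rewrite -big_split; apply: eq_bigr => i _; rewrite mulrDr. Qed.

Lemma conv_subl q1 q2 a n : conv (q1 - q2) a n = conv q1 a n - conv q2 a n.
Proof. by rewrite -sumrB; apply: eq_bigr => i _; rewrite coefB mulrBl. Qed.

Lemma convXn w a n : conv 'X^w a n = if (w <= n)%N then a (n - w)%N else 0.
Proof.
case: leqP => wn.
  rewrite /conv (bigD1 (inord w)) //= inordK ?ltnS // coefXn eqxx mul1r.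
  rewrite big1 ?addr0 // => i Hi; rewrite coefXn; case: eqP => [E|]; last by rewrite mul0r.
  by move/eqP: Hi; case; apply/val_inj; rewrite /= inordK ?ltnS.
rewrite /conv big1 // => i _; rewrite coefXn ltn_eqF ?mul0r //.
exact: leq_trans (ltn_ord i) _.
Qed.

Lemma conv1 a n : conv 1 a n = a n.
Proof. by have := convXn 0 a n; rewrite expr0 leq0n subn0. Qed.

Lemma rational_seriesE (a : nat -> nat) :
  rational_series a <-> exists p q : {poly int}, q != 0 /\
    forall n, conv q (fun n => (a n)%:Z) n = p`_n.
Proof. by []. Qed.

Lemma eq_rational_series (a b : nat -> nat) : a =1 b ->
  rational_series a -> rational_series b.
Proof. by move=> /funext ->. Qed.

Lemma rational_seriesD (a b : nat -> nat) :
  rational_series a -> rational_series b -> rational_series (fun n => a n + b n)%N.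
Proof.
move=> /rational_seriesE[p [q [q0 H]]] /rational_seriesE[p' [q' [q'0 H']]].
apply/rational_seriesE; exists (q' * p + q * p'), (q' * q).
split; first by rewrite mulf_neq0.
move=> n; rewrite (eq_conv _ _ (fun n => PoszD (a n) (b n))) convD.
rewrite {2}mulrC !convA (eq_conv _ _ H) (eq_conv _ _ H') !conv_poly.
by rewrite coefD.
Qed.

Lemma rational_series0 : rational_series (fun=> 0%N).
Proof.
apply/rational_seriesE; exists 0, 1; rewrite oner_neq0; split => // n.
by rewrite conv1 coef0.
Qed.

Lemma rational_series_sum (I : Type) (s : seq I) (a : I -> nat -> nat) :
  (forall i, rational_series (a i)) ->
  rational_series (fun n => \sum_(i <- s) a i n)%N.
Proof.
move=> H; elim: s => [|i s IH].
  by apply: eq_rational_series rational_series0 => n; rewrite big_nil.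
apply: eq_rational_series (rational_seriesD (H i) IH) => n.
by rewrite big_cons.
Qed.

Lemma rational_series_shift (a b : nat -> nat) c :
  (forall n, b n = if (c <= n)%N then a (n - c)%N else 0%N) ->
  rational_series a -> rational_series b.
Proof.
move=> Hb /rational_seriesE[p [q [q0 H]]]; apply/rational_seriesE.
exists ('X^c * p), q; split => // n.
have E m : (b m)%:Z = conv 'X^c (fun n => (a n)%:Z) m.
  by rewrite convXn Hb; case: ifP.
rewrite (eq_conv _ _ E) -convA mulrC convA (eq_conv _ _ H).
by rewrite conv_poly.
Qed.

(** The hypothesis says that [b = a + z^w b] as power series, so [b = a / (1 - z^w)]. *)
Lemma rational_series_geom (a b : nat -> nat) w : (0 < w)%N ->
  (forall n, b n = a n + if (w <= n)%N then b (n - w)%N else 0)%N ->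
  rational_series a -> rational_series b.
Proof.
move=> w0 Hb /rational_seriesE[p [q [q0 H]]]; apply/rational_seriesE.
exists p, (q * (1 - 'X^w)); split.
  rewrite mulf_neq0 //; apply/eqP => /(congr1 (fun r : {poly int} => r`_0)).
  by rewrite coefB coef1 coefXn coef0 /= (ltn_eqF w0).
move=> n; rewrite convA -H; apply: eq_conv => m.
by rewrite conv_subl conv1 convXn Hb PoszD; case: ifP => _; rewrite addrK.
Qed.

Definition cnt (T : choiceType) (A : set T) : nat := #|` fset_set A|.

Lemma cntU (T : choiceType) (A B : set T) : finite_set A -> finite_set B ->
  A `&` B = set0 -> cnt (A `|` B) = (cnt A + cnt B)%N.
Proof.
move=> FA FB AB; rewrite /cnt fset_setU // cardfsU -fset_setI // AB fset_set0.
by rewrite cardfs0 subn0.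
Qed.

Lemma cnt_image (T U : choiceType) (f : T -> U) (A : set T) : finite_set A ->
  (forall x y, A x -> A y -> f x = f y -> x = y) -> cnt (f @` A) = cnt A.
Proof.
move=> FA If; apply/fcard_eq => //; first exact: finite_image.
by apply: inj_card_eq => x y; rewrite !inE; exact: If.
Qed.

Lemma cnt0 (T : choiceType) : cnt (set0 : set T) = 0%N.
Proof. by rewrite /cnt fset_set0 cardfs0. Qed.

Lemma cnt1 (T : choiceType) (x : T) : cnt [set x] = 1%N.
Proof. by rewrite /cnt fset_set1 cardfs1. Qed.

Section FreeCount.
Variables (T : finType) (A : T -> nat).

Let lvl (s : seq T) n : set (T -> nat) :=
  [set x | (forall t, t \notin s -> x t = 0%N) /\ (\sum_t A t * x t = n)%N].

(** The series is the product of the [1 / (1 - z^(A t))]. Coordinates are released one at a time: a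
    vector either vanishes at the new coordinate [t], or is a shift by one there of a vector of
    level [n - A t]. *)
Lemma rational_series_free :
  (forall n, finite_set [set x : T -> nat | \sum_t A t * x t = n]%N) ->
  rational_series (fun n => cnt [set x : T -> nat | \sum_t A t * x t = n]%N).
Proof.
move=> fin.
(* A coordinate of weight 0 would make level 0 infinite. *)
have A0 t : (0 < A t)%N.
  rewrite lt0n; apply/eqP => At0.
  pose h (n : nat) : T -> nat := fun t' => if t' == t then n else 0%N.
  have : finite_set (h @` setT).
    apply: sub_finite_set (fin 0%N) => _ [n _ <-] /=.
    by apply: big1 => t' _; rewrite /h; case: eqP => [->|_]; rewrite ?At0 ?muln0.
  have Ih : {in [set: nat] &, injective h}.
    by move=> n m _ _ /(congr1 (@^~ t)); rewrite /h eqxx.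
  by rewrite (eq_finite_set (inj_card_eq Ih)); exact: infinite_nat.
have finl s n : finite_set (lvl s n).
  by apply: sub_finite_set (fin n) => x [].
have H (s : seq T) : uniq s -> rational_series (fun n => cnt (lvl s n)).
  elim: s => [_|t s IH /= /andP[ts us]].
    apply/rational_seriesE; exists 1, 1; rewrite oner_neq0; split => // n.
    rewrite conv1 coef1.
    suff -> : cnt (lvl [::] n) = (n == 0%N) by case: (n == 0%N).
    have [->|n0] := eqVneq n 0%N.
      rewrite -[RHS](cnt1 (fun _ : T => 0%N)); congr cnt; apply/seteqP; split => x.
        by move=> [x0 _]; apply/funext => t; exact: x0.
      by move=> ->; split => //; apply: big1 => t _; rewrite muln0.
    rewrite -[RHS](cnt0 (T -> nat)); congr cnt; apply/seteqP; split => x //.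
    move=> [x0 E]; move: n0; rewrite -E big1 // => t _.
    by rewrite x0 ?muln0.
  apply: rational_series_geom (A0 t) _ (IH us) => n.
  pose sh (x : T -> nat) := upd x t (x t).+1.
  have Esh x : (\sum_t' A t' * sh x t' = \sum_t' A t' * x t' + A t)%N.
    rewrite (bigD1 t) //= [in RHS](bigD1 t) //= /sh /upd eqxx mulnS.
    rewrite (eq_bigr (fun t' => A t' * x t')%N) => [|t' /negPf->//].
    by rewrite [RHS]addnC addnA.
  have Ish x y : sh x = sh y -> x = y.
    move=> E; apply/funext => t'; move: (congr1 (@^~ t') E).
    by rewrite /sh /upd; case: eqP => [->[]|].
  pose B : set (T -> nat) := if (A t <= n)%N then sh @` lvl (t :: s) (n - A t) else set0.
  have -> : (if (A t <= n)%N then cnt (lvl (t :: s) (n - A t)) else 0%N) = cnt B.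
    rewrite /B; case: ifP => _; last by rewrite cnt0.
    by rewrite cnt_image // => x y _ _; exact: Ish.
  rewrite -cntU //; first last.
  - apply/seteqP; split => x // -[[x0 _]]; rewrite /B; case: ifP => // _ [y _ E].
    by move: (x0 t ts); rewrite -E /sh /upd eqxx.
  - by rewrite /B; case: ifP => // _; exact: finite_image.
  congr cnt; apply/seteqP; split => x.
    move=> [x0 E]; have [xt|xt] := posnP (x t).
      left; split => // t' t's; have [->//|t't] := eqVneq t' t.
      by apply: x0; rewrite inE negb_or t't.
    have xE : x = sh (upd x t (x t).-1).
      apply/funext => t'; rewrite /sh /upd eqxx; case: eqP => [->|//].
      by rewrite prednK.
    have En : (\sum_t' A t' * upd x t (x t).-1 t' + A t = n)%N by rewrite -Esh -xE.
    right; have An : (A t <= n)%N by rewrite -En leq_addl.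
    rewrite /B An; exists (upd x t (x t).-1); last by rewrite -xE.
    split; last by rewrite -En addnK.
    move=> t' Ht; have := x0 _ Ht; rewrite /upd; case: eqP => [E'|//].
    by move: Ht; rewrite inE E' eqxx.
  move=> [[x0 E]|].
    split => // t'; rewrite inE negb_or => /andP[_]; exact: x0.
  rewrite /B; case: leqP => // An [y [y0 E] <-]; split; last by rewrite Esh E subnK.
  move=> t' Ht; rewrite /sh /upd; case: eqP => [E'|_]; last exact: y0.
  by move: Ht; rewrite inE E' eqxx.
apply: eq_rational_series (H (enum T) (enum_uniq T)) => n.
congr cnt; apply/seteqP; split => x; first by case.
by move=> E; split => // t; rewrite mem_enum.
Qed.

End FreeCount.

Lemma rational_series_decomp (T : finType) (P : set (T -> nat)) (L : (T -> nat) -> nat) :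
  decomp P -> isaff L -> (forall n, finite_set (P `&` [set x | L x = n])) ->
  rational_series (fun n => cnt (P `&` [set x | L x = n])).
Proof.
move=> DP; elim: DP L => {T P} [T|T P1 P2 _ IH1 _ IH2 H12|T|T' T g P Hg Ig _ IH] L HL fin.
- by apply: eq_rational_series rational_series0 => n; rewrite set0I cnt0.
- have f1 n : finite_set (P1 `&` [set x | L x = n]).
    by apply: sub_finite_set (fin n) => x [? ?]; split => //; left.
  have f2 n : finite_set (P2 `&` [set x | L x = n]).
    by apply: sub_finite_set (fin n) => x [? ?]; split => //; right.
  apply: eq_rational_series (rational_seriesD (IH1 _ HL f1) (IH2 _ HL f2)) => n.
  by rewrite setIUl cntU // setIACA H12 set0I.
- have [A [c HA]] := HL.
  have E n : setT `&` [set x | L x = n + c]%N = [set x | \sum_t A t * x t = n]%N.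
    by apply/seteqP; split => x /=; rewrite HA; lia.
  apply: (@rational_series_shift
    (fun n => cnt [set x : T -> nat | \sum_t A t * x t = n]%N) _ c) => [n|].
    case: leqP => cn; first by rewrite -E subnK.
    rewrite -(cnt0 (T -> nat)); congr cnt; apply/seteqP; split => x //= -[_].
    by rewrite HA => E'; move: cn; rewrite -E' ltnNge leq_addr.
  by apply: rational_series_free => n; rewrite -E.
- have E n : g @` P `&` [set x | L x = n] = g @` (P `&` [set x | L (g x) = n]).
    apply/seteqP; split => x; first by move=> [[y Py <-] Qy]; exists y.
    by move=> [y [Py Qy] <-]; split => //; exists y.
  have f n : finite_set (P `&` [set x | L (g x) = n]).
    have Ii : {in P `&` [set x | L (g x) = n] &, injective g}.
      by move=> x y; rewrite !inE => -[Px _] [Py _]; exact: Ig.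
    by rewrite -(eq_finite_set (inj_card_eq Ii)) -E.
  apply: eq_rational_series (IH _ (isaff_comp Hg HL) f) => n.
  by rewrite E cnt_image // => x y [Px _] [Py _]; exact: Ig.
Qed.

(** * Semilinear sets and commutative images of regular languages *)

Section Semilinear.
Variable M : zmodType.
Implicit Types (X Y : set M) (ps : seq M) (l : seq (M * seq M)).

Fixpoint span ps : set M :=
  if ps is p :: ps' then [set v | exists n u, span ps' u /\ v = p *+ n + u]
  else [set 0].

Definition linset (c : M * seq M) : set M := [set v | exists2 u, span c.2 u & v = c.1 + u].

Definition semilinear X : Prop :=
  exists l, forall v, X v <-> exists2 c, c \in l & linset c v.

Definition msum X Y : set M := [set v | exists x y, [/\ X x, Y y & v = x + y]].

Inductive star X : set M :=
| star0 : star X 0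
| star_cons u v : X u -> star X v -> star X (u + v).

Lemma semilinear_ext X Y : (forall v, X v <-> Y v) -> semilinear X -> semilinear Y.
Proof. by move=> E [l H]; exists l => v; rewrite -E. Qed.

Lemma span0 ps : span ps 0.
Proof. by elim: ps => //= p ps H; exists 0%N, 0; rewrite mulr0n addr0. Qed.

Lemma spanD ps u v : span ps u -> span ps v -> span ps (u + v).
Proof.
elim: ps u v => [|p ps IH] u v /=; first by move=> -> ->; rewrite addr0.
move=> [n [u' [Hu ->]]] [m [v' [Hv ->]]]; exists (n + m)%N, (u' + v').
by split; [exact: IH|rewrite addrACA mulrnDr].
Qed.

Lemma span_cat ps qs v :
  span (ps ++ qs) v <-> exists x y, [/\ span ps x, span qs y & v = x + y].
Proof.
elim: ps v => [|p ps IH] v /=.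
  split; first by move=> H; exists 0, v; rewrite add0r.
  by move=> [x [y [-> Hy ->]]]; rewrite add0r.
split.
  move=> [n [u [/IH[x [y [Hx Hy ->]]] ->]]]; exists (p *+ n + x), y.
  by rewrite addrA; split => //; exists n, x.
move=> [x [y [[n [u [Hu ->]]] Hy ->]]]; exists n, (u + y); rewrite addrA.
by split => //; apply/IH; exists u, y.
Qed.

Lemma semilinear0 : semilinear set0.
Proof. by exists [::] => v; split => // -[]. Qed.

Lemma semilinear1 u : semilinear [set u].
Proof.
exists [:: (u, [::])] => v; split.
  by move=> ->; exists (u, [::]); rewrite ?mem_head //; exists 0; rewrite ?addr0.
by move=> [c]; rewrite inE => /eqP-> [_ /= -> ->]; rewrite addr0.
Qed.

Lemma semilinearU X Y : semilinear X -> semilinear Y -> semilinear (X `|` Y).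
Proof.
move=> [l1 H1] [l2 H2]; exists (l1 ++ l2) => v; split.
  by move=> [/H1|/H2] [c cl Hc]; exists c; rewrite // mem_cat cl ?orbT.
move=> [c]; rewrite mem_cat => /orP[cl|cl] Hc; [left; apply/H1|right; apply/H2];
by exists c.
Qed.

Lemma semilinear_sum X Y : semilinear X -> semilinear Y -> semilinear (msum X Y).
Proof.
move=> [l1 H1] [l2 H2].
exists [seq (c1.1 + c2.1, c1.2 ++ c2.2) | c1 <- l1, c2 <- l2] => v; split.
  move=> [_ [_ [/H1[c1 cl1 [u1 Hu1 ->]] /H2[c2 cl2 [u2 Hu2 ->]] ->]]].
  exists (c1.1 + c2.1, c1.2 ++ c2.2); first by apply/allpairsP; exists (c1, c2).
  by exists (u1 + u2); [apply/span_cat; exists u1, u2|rewrite addrACA].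
move=> [_ /allpairsP[[c1 c2] [/= cl1 cl2 ->]] [_ /span_cat[u1 [u2 [Hu1 Hu2 ->]]] ->]].
exists (c1.1 + u1), (c2.1 + u2); split; last by rewrite addrACA.
  by apply/H1; exists c1 => //; exists u1.
by apply/H2; exists c2 => //; exists u2.
Qed.

Lemma starD X u v : star X u -> star X v -> star X (u + v).
Proof.
elim=> [|{}u w Xu _ IH] Hv; first by rewrite add0r.
by rewrite -addrA; apply: star_cons => //; exact: IH.
Qed.

Lemma star1 X u : X u -> star X u.
Proof. by move=> Xu; rewrite -[u]addr0; apply: star_cons => //; exact: star0. Qed.

Lemma starMn X u n : X u -> star X (u *+ n).
Proof.
move=> Xu; elim: n => [|n IH]; first exact: star0.
by rewrite mulrS; exact: star_cons.
Qed.

Lemma star_sub X Y v : X `<=` Y -> star X v -> star Y v.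
Proof. by move=> XY; elim=> [|u w /XY Yu _ IH]; [exact: star0|exact: star_cons]. Qed.

(** A nonempty sum of elements of [c.1 + span c.2] contains [c.1] at least once, and the further
    copies of [c.1] act as one more period. *)
Lemma star_linset c : semilinear (star (linset c)).
Proof.
apply: semilinear_ext (semilinearU (semilinear1 0)
  (_ : semilinear (linset (c.1, c.1 :: c.2)))); last first.
  exists [:: (c.1, c.1 :: c.2)] => v; split; first by exists (c.1, c.1 :: c.2); rewrite ?mem_head.
  by move=> [d]; rewrite inE => /eqP->.
move=> v; split.
  move=> [->|[_ [n [u [Hu ->]]] ->]]; first exact: star0.
  rewrite /= addrCA; apply: starD; last by apply: star1; exists u.
  by apply: starMn; exists 0; rewrite ?addr0 //; exact: span0.
elim=> [|_ w [u Hu ->] _ [->|[_ [n [u' [Hu' ->]]] ->]]]; first by left.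
  by right; exists u; [exists 0%N, u; rewrite mulr0n add0r|rewrite addr0].
right; exists (c.1 *+ n.+1 + (u + u')).
  by exists n.+1, (u + u'); split => //; exact: spanD.
rewrite /= mulrS -!addrA; congr (_ + _); rewrite [LHS]addrCA; congr (_ + _); exact: addrCA.
Qed.

(** This is where commutativity enters: summands from [X] and [Y] can be sorted, so the star of a
    finite union of linear sets is a sum of stars of linear sets. *)
Lemma starU X Y v : star (X `|` Y) v <-> msum (star X) (star Y) v.
Proof.
split.
  elim=> [|u w [Xu|Yu] _ [x [y [Hx Hy ->]]]].
  - by exists 0, 0; split; [exact: star0|exact: star0|rewrite addr0].
  - by exists (u + x), y; split => //; [exact: star_cons|rewrite addrA].
  - by exists x, (u + y); split => //; [exact: star_cons|rewrite addrCA].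
move=> [x [y [Hx Hy ->]]]; apply: starD; apply: star_sub; [|exact: Hx| |exact: Hy].
  by left.
by right.
Qed.

Lemma semilinear_star X : semilinear X -> semilinear (star X).
Proof.
move=> [l]; elim: l X => [|c l IH] X H.
  apply: semilinear_ext (semilinear1 0) => v; split; first by move=> ->; exact: star0.
  by elim=> // u w /H[].
pose Y v := exists2 c, c \in l & linset c v.
have SY := IH Y (fun v => iff_refl _).
apply: semilinear_ext (semilinear_sum (star_linset c) SY) => v.
rewrite -starU; split; apply: star_sub => u.
  move=> [Hu|[d dl Hu]]; apply/H; [exists c|exists d] => //.
    by rewrite mem_head.
  by rewrite inE dl orbT.
by move=> /H[d]; rewrite inE => /predU1P[->|dl] Hu; [left|right; exists d].
Qed.

Section Kleene.
Variables (Q : finType) (E : Q -> Q -> set M).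
Hypothesis semilinearE : forall q q', semilinear (E q q').

(** The predicate [S] restricts the intermediate states only, not the end points, as in Kleene's
    algorithm. *)
Inductive walk (S : pred Q) : Q -> Q -> set M :=
| walk1 q q' v : E q q' v -> walk S q q' v
| walk_cons q r q' u v : E q r u -> S r -> walk S r q' v -> walk S q q' (u + v).

Lemma walk_cat (S : pred Q) q r q' u v :
  walk S q r u -> S r -> walk S r q' v -> walk S q q' (u + v).
Proof.
move=> W Sr; elim: W Sr => [{}q {}r {}u Eu|{}q s {}r x y Ex Ss _ IH] Sr Hv.
  exact: walk_cons Eu Sr Hv.
by rewrite -addrA; apply: walk_cons Ex Ss (IH Sr Hv).
Qed.

Lemma walk_sub (S S' : pred Q) q q' v :
  (forall r, S r -> S' r) -> walk S q q' v -> walk S' q q' v.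
Proof.
move=> SS'; elim=> [{}q {}q' u Eu|{}q r {}q' x y Ex /SS' Sr _]; first exact: walk1.
exact: walk_cons.
Qed.

(** A walk that meets [r] is cut at its visits of [r]: a part up to the first visit, loops at [r],
    and a part after the last visit. *)
Lemma walk_elim (s : seq Q) r q q' v :
  walk (mem (r :: s)) q q' v <->
  (walk (mem s) q q' `|` msum (walk (mem s) q r)
     (msum (star (walk (mem s) r r)) (walk (mem s) r q'))) v.
Proof.
have sub t : mem s t -> mem (r :: s) t by rewrite /= inE => ->; rewrite orbT.
split.
  elim=> [{}q {}q' u Eu|{}q t {}q' u w Eu St _ IH]; first by left; exact: walk1.
  have [ts|] := boolP (t \in s).
    case: IH => [Hw|[x [y [Hx Hy ->]]]]; first by left; exact: walk_cons Eu ts Hw.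
    by right; exists (u + x), y; split => //; [exact: walk_cons Eu ts Hx|rewrite addrA].
  move: St; rewrite /= inE => /predU1P[Et _|-> //]; rewrite {t}Et in Eu IH.
  case: IH => [Hw|[x [_ [Hx [y [z [Hy Hz ->]]] ->]]]].
    right; exists u, w; split => //; first exact: walk1.
    by exists 0, w; split => //; [exact: star0|rewrite add0r].
  right; exists u, (x + (y + z)); split => //; first exact: walk1.
  by exists (x + y), z; split => //; [exact: star_cons|rewrite addrA].
have rin : mem (r :: s) r by rewrite /= mem_head.
move=> [|[x [_ [Hx [y [z [Hy Hz ->]]] ->]]]]; first exact: (walk_sub sub).
apply: (walk_cat (walk_sub sub Hx) rin).
elim: Hy => [|a b Ha _ IH]; first by rewrite add0r; exact: (walk_sub sub Hz).
by rewrite -addrA; exact: (walk_cat (walk_sub sub Ha) rin IH).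
Qed.

Lemma semilinear_walk (s : seq Q) q q' : semilinear (walk (mem s) q q').
Proof.
elim: s q q' => [|r s IH] q q'.
  apply: semilinear_ext (semilinearE q q') => v; split; first exact: walk1.
  by case.
apply: semilinear_ext (fun v => iff_sym (walk_elim s r q q' v)) _.
apply: semilinearU => //; apply: semilinear_sum => //.
by apply: semilinear_sum => //; exact: semilinear_star.
Qed.

End Kleene.

(** The label depends on the state as well as on the letter, because the translation caused by a
    letter depends on the coset at which it is read. *)
Lemma semilinear_runs (A Q : finType) (delta : Q -> A -> Q) (lab : Q -> A -> M) q0 q1 :
  semilinear [set v | exists2 w : seq A, foldl delta q0 w = q1 &
    v = (foldl (fun p a => (delta p.1 a, p.2 + lab p.1 a)) (q0, 0) w).2].
Proof.
pose E q q' : set M := [set v | exists2 a, delta q a = q' & v = lab q a].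
have SE q q' : semilinear (E q q').
  exists [seq (lab q a, [::]) | a <- enum A & delta q a == q'] => v; split.
    move=> [a da ->]; exists (lab q a, [::]).
      by apply/mapP; exists a => //; rewrite mem_filter da eqxx mem_enum.
    by exists 0; rewrite ?addr0.
  move=> [d /mapP[a]]; rewrite mem_filter => /andP[/eqP da _] -> [_ /= -> ->].
  by exists a; rewrite ?addr0.
have shift w q v : foldl (fun p a => (delta p.1 a, p.2 + lab p.1 a)) (q, v) w =
   (foldl delta q w,
    v + (foldl (fun p a => (delta p.1 a, p.2 + lab p.1 a)) (q, 0) w).2).
  elim: w q v => [|a w IH] q v /=; first by rewrite addr0.
  by rewrite IH [in RHS]IH /= add0r addrA.
apply: semilinear_ext (semilinearU (_ : semilinear [set v | q0 = q1 /\ v = 0])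
  (semilinear_walk SE (enum Q) q0 q1)); last first.
  have [->|ne] := eqVneq q0 q1.
    by apply: semilinear_ext (semilinear1 0) => v; split => [->|[]].
  by apply: semilinear_ext semilinear0 => v; split => // -[E']; move/eqP: ne.
move=> v; split.
  move=> [[-> ->]|]; first by exists [::].
  elim=> {v} [q q' v [a da ->]|q r q' u v [a da ->] _ _ [w dw ->]].
    by exists [:: a]; rewrite //= add0r.
  move: dw; rewrite -da => dw; exists (a :: w) => //=; by rewrite [in RHS]shift /= add0r.
move=> [w]; elim: w q0 v => [|a w IH] q v /=; first by move=> -> ->; left.
move=> dw ->; right; rewrite shift /= add0r.
have [[Er ->]|W] := IH _ _ dw erefl.
  by rewrite addr0; apply: walk1; exists a.
by apply: walk_cons W => /=; [exists a|rewrite mem_enum].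
Qed.

End Semilinear.

Lemma pres_semilinear (J : finType) (X : set (J -> int)) : semilinear X -> pres X.
Proof.
move=> [l H].
have Hspan (ps : seq (J -> int)) : pres (span ps).
  elim: ps => [|p ps IH] /=.
    apply: pres_ext (pres_all_fin (fun j => pres_eq (@islin_var J j) (@islin_const J 0))).
    by move=> e; split => [E|->//]; apply/funext.
  apply: pres_ext (@pres_ex J (fun e n => 0 <= n /\ span ps (fun j => e j - n * p j)) _).
    move=> e; split.
      move=> [n [n0 Hs]]; exists `|n|%N, (fun j => e j - n * p j); split => //.
      apply/funext => j; rewrite addrfctE natmulfctE -mulr_natl natz gez0_abs //.
      by rewrite addrC subrK.
    move=> [n [u [Hu ->]]]; exists n%:Z; split => //.
    move: Hu; congr (span ps _); apply/funext => j.
    by rewrite addrfctE natmulfctE -mulr_natl natz addrAC subrr add0r.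
  apply: pres_and; first by apply: pres_le; [exact: islin_const|exact: islin_var].
  apply: pres_subst IH => j; apply: islinB; first exact: islin_var.
  by apply: islinZr; exact: islin_var.
apply: pres_ext (pres_ex_seq (s := l) (P := fun e c => span c.2 (fun j => e j - c.1 j)) _).
  move=> e; rewrite H; split => -[c cl].
    move=> Hs; exists c => //; exists (fun j => e j - c.1 j) => //.
    by apply/funext => j; rewrite addrfctE addrC subrK.
  move=> [u Hu ->]; exists c => //; move: Hu; congr (span _ _); apply/funext => j.
  by rewrite addrfctE addrAC subrr add0r.
move=> c _; apply: pres_subst (Hspan c.2) => j.
by apply: islinB; [exact: islin_var|exact: islin_const].
Qed.

(** * Coordinates on a virtually abelian group *)

(* f need not be injective: its kernel is a subgroup of Z^I, hence Presburger,
   and no structure theorem for finitely generated abelian groups is needed. *)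
Record coords (M : groupType) (I J : finType) (f : (I -> int) -> M) (c : J -> M) :
    Prop := {
  coords_hom : forall u v : I -> int, f (u + v) = (f u * f v)%g;
  coords_surj : forall g, exists v j, g = (f v * c j)%g;
  coords_inj : forall u v i j, (f u * c i = f v * c j)%g -> i = j;
  coords_conj : forall g v, exists u, (g * f v * g^-1 = f u)%g
}.

Section HomZ.
Variables (M : groupType) (I : finType).
Implicit Types h : (I -> int) -> M.

Definition zhom h := forall u v : I -> int, h (u + v) = (h u * h v)%g.

Lemma zhom0 h : zhom h -> h 0 = 1%g.
Proof. by move=> H; apply: (mulgI (h 0)); rewrite -H addr0 mulg1. Qed.

Lemma zhomN h v : zhom h -> h (- v) = (h v)^-1%g.
Proof.
by move=> H; apply: (mulgI (h v)); rewrite -H subrr zhom0 // mulgV.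
Qed.

Lemma zhomB h u v : zhom h -> h (u - v) = (h u * (h v)^-1)%g.
Proof. by move=> H; rewrite H zhomN. Qed.

Lemma zhomC h u v : zhom h -> (h u * h v = h v * h u)%g.
Proof. by move=> H; rewrite -!H addrC. Qed.

Lemma zhomMn h v n : zhom h -> h (v *+ n) = (h v ^+ n)%g.
Proof.
by move=> H; elim: n => [|n IH]; rewrite ?mulr0n ?zhom0 // mulrS expgS H IH.
Qed.

Definition unitv (i : I) : I -> int := fun k => (k == i)%:Z.

Lemma eq_zhom h h' : zhom h -> zhom h' ->
  (forall i, h (unitv i) = h' (unitv i)) -> h = h'.
Proof.
move=> H H' E.
have Ez i (z : int) : h (unitv i *~ z) = h' (unitv i *~ z).
  case: z => n; rewrite ?NegzE ?mulrNz -?pmulrn ?zhomN // !zhomMn //.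
    by rewrite E.
  by rewrite E.
have S (s : seq I) v : (forall i, i \notin s -> v i = 0) -> h v = h' v.
  elim: s v => [|i s IH] v v0.
    suff -> : v = 0 by rewrite !zhom0.
    by apply/funext => i; exact: v0.
  pose u : I -> int := fun k => if k == i then 0 else v k.
  have -> : v = unitv i *~ v i + u.
    apply/funext => k; rewrite addrfctE.
    have -> : (unitv i *~ v i) k = v i * (k == i)%:Z.
      case: (v i) => n; rewrite ?NegzE ?mulrNz ?opprfctE -?pmulrn natmulfctE /unitv;
      by rewrite -mulr_natl natz ?mulNr.
    by rewrite /u; case: eqP => [->|]; rewrite ?mulr1 ?addr0 ?mulr0 ?add0r.
  rewrite H H' Ez (IH u) // => k ks; rewrite /u; case: eqP => // ki.
  by apply: v0; rewrite inE negb_or ks andbT; exact/eqP.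
by apply/funext => v; apply: (S (enum I)) => i; rewrite mem_enum.
Qed.

End HomZ.

Definition lincomb (I : finType) (A : I -> I -> int) (v : I -> int) : I -> int :=
  fun i => \sum_k v k * A k i.

Section CoordsTheory.
Variables (M : groupType) (I J : finType) (f : (I -> int) -> M) (c : J -> M).
Hypothesis cd : coords f c.
Let fH : zhom f := coords_hom cd.
Implicit Types (g : M) (R : set M).

(** Conjugation lifts to a linear map even if [f] has a kernel: lifts of the images of the unit
    vectors are chosen, and two homomorphisms that agree on unit vectors are equal. *)
Lemma coords_conj_lin g : exists A : I -> I -> int,
  forall v, (g * f v * g^-1 = f (lincomb A v))%g.
Proof.
have [A HA] := choice (fun i => coords_conj cd g (unitv i)).
exists A; suff E : (fun v => g * f v * g^-1)%g = (fun v => f (lincomb A v)).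
  by move=> v; move/(congr1 (@^~ v)): E.
apply: eq_zhom => [u v|u v|i].
- by rewrite fH -!mulgA; congr (_ * (_ * _))%g; rewrite mulKg.
- rewrite -fH; congr f; apply/funext => i; rewrite [in RHS]addrfctE /lincomb -big_split.
  by apply: eq_bigr => k _; rewrite addrfctE mulrDl.
- rewrite HA; congr f; apply/funext => k; rewrite /lincomb (bigD1 i) //= /unitv eqxx.
  by rewrite mul1r big1 ?addr0 // => t /negPf->; rewrite mul0r.
Qed.

Definition zsubgroup (H : set (I -> int)) : Prop :=
  H 0 /\ forall u v, H u -> H v -> H (u - v).

(** Echelon form: among the vectors of [H] with positive coordinate [i], one with least value [m]
    there is chosen as [v1]. By Euclidean division each vector of [H] is a multiple of [v1] plus a
    vector of [H] vanishing at [i], and the latter form a subgroup with fewer coordinates. *)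
Lemma pres_zsubgroup (H : set (I -> int)) : zsubgroup H -> pres H.
Proof.
suff S (s : seq I) (H' : set (I -> int)) :
    (forall v i, H' v -> i \notin s -> v i = 0) -> zsubgroup H' -> pres H'.
  by apply: (S (enum I)) => v i _; rewrite mem_enum.
elim: s H' => [|i s IH] {}H Hs [H0 HB].
  apply: pres_ext (pres_all_fin (fun k => pres_eq (@islin_var I k) (@islin_const I 0))).
  move=> e; split; last by move=> He k; exact: (Hs e).
  by move=> E; have -> : e = 0 by apply/funext.
have HN v : H v -> H (- v) by move=> Hv; rewrite -sub0r; exact: HB.
have HD u v : H u -> H v -> H (u + v).
  by move=> Hu Hv; rewrite -[v]opprK; apply: HB => //; exact: HN.
have [[v0 [Hv0 v0i]]|N] := pselect (exists v, H v /\ v i != 0); last first.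
  apply: IH => // v k Hv ks; have [->|ki] := eqVneq k i.
    by apply/eqP; apply: contrapT => vi; apply: N; exists v; split => //; exact/negP.
  by apply: (Hs v) => //; rewrite inE negb_or ki.
have ex : exists n, `[< exists2 v, H v & v i = n.+1%:Z >].
  exists `|v0 i|.-1%N; apply/asboolP.
  have [p|p] := ltrP 0 (v0 i); first by exists v0 => //; lia.
  by exists (- v0); [exact: HN|rewrite opprfctE; lia].
pose m := (ex_minn ex).+1.
have [v1 Hv1 v1i] : exists2 v, H v & v i = m%:Z.
  by rewrite /m; case: ex_minnP => n /asboolP.
have min v : H v -> 0 < v i -> m%:Z <= v i.
  move=> Hv vi; rewrite /m; case: ex_minnP => n _ /(_ `|v i|.-1%N) K.
  suff : (n <= `|v i|.-1)%N by lia.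
  by apply: K; apply/asboolP; exists v => //; lia.
have HZ (q : int) v : H v -> H (v *~ q).
  have Hn n : H v -> H (v *+ n).
    by move=> Hv; elim: n => [|n IHn]; rewrite ?mulr0n // mulrS; exact: HD.
  case: q => n Hv; rewrite ?NegzE ?mulrNz -pmulrn; first exact: Hn.
  by apply: HN; exact: Hn.
have mulE (q : int) k : (v1 *~ q) k = q * v1 k.
  by case: q => n; rewrite ?NegzE ?mulrNz ?opprfctE -?pmulrn natmulfctE -mulr_natl
    natz ?mulNr.
pose H' : set (I -> int) := [set v | H v /\ v i = 0].
have PH' : pres H'.
  apply: IH.
    move=> v k [Hv vi] ks; have [->//|ki] := eqVneq k i.
    by apply: (Hs v) => //; rewrite inE negb_or ki.
  split=> [//|u v [Hu ui] [Hv vi]]; split; first exact: HB.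
  by rewrite addrfctE opprfctE ui vi subr0.
have m0 : m%:Z != 0 by [].
apply: pres_ext (@pres_ex I (fun e q => H' (fun k => e k - q * v1 k)) _).
  move=> e; split.
    move=> [q [K _]].
    have -> : e = (fun k => e k - q * v1 k) + v1 *~ q.
      by apply/funext => k; rewrite addrfctE mulE subrK.
    by apply: HD => //; exact: HZ.
  move=> He; exists (e i %/ m%:Z)%Z.
  have K : H (fun k => e k - (e i %/ m)%Z * v1 k).
    have := HB _ _ He (HZ (e i %/ m)%Z _ Hv1); congr H; apply/funext => k.
    by rewrite addrfctE opprfctE mulE.
  split => //; have := min _ K; rewrite v1i.
  have := divz_eq (e i) m%:Z; have := modz_ge0 (e i) m0; have := ltz_mod (e i) m0.
  move: (_ %/ _)%Z (_ %% _)%Z => q r; lia.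
apply: pres_subst PH' => k; apply: islinB; first exact: islin_var.
by apply: islinZr; exact: islin_var.
Qed.

(** The predicate concerns every coordinate vector of an element, and so is invariant under
    translation by the kernel of [f]. *)
Definition defset R : Prop := forall j, pres (fun v => R (f v * c j)%g).

(** On each coset, [R] is either empty or, in coordinates, a translate by [v0] of the subgroup of
    the vectors [v] with [f v] in [R]. *)
Lemma defset_subgroup R : is_subgroup R -> defset R.
Proof.
move=> RG j.
have R1 : R 1%g by case: RG => /set_mem.
have RF a b : R a -> R b -> R (a / b)%g.
  by case: RG => _ RF Ra Rb; apply/set_mem/RF; exact/mem_set.
have [[v0 Hv0]|N] := pselect (exists v, R (f v * c j)%g); last first.
  apply: pres_ext (pres_const I False) => v; split => // Hv.
  by apply: N; exists v.
have K : zsubgroup [set v | R (f v)].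
  by split=> [|u v Hu Hv] /=; rewrite ?zhom0 ?zhomB //; exact: RF.
have L k : islin (fun v : I -> int => v k - v0 k).
  by apply: islinB; [exact: islin_var|exact: islin_const].
apply: pres_ext (pres_subst L (pres_zsubgroup K)) => v /=.
have E : (fun k => v k - v0 k) = v - v0 by apply/funext.
rewrite E; split=> H.
  have -> : (f v * c j = f (v - v0) * (f v0 * c j))%g.
    by rewrite mulgA -fH subrK.
  have := RF _ _ H (RF _ _ R1 Hv0).
  by rewrite div1g invgK.
by have := RF _ _ H Hv0; rewrite invgM mulgA mulgK -zhomB.
Qed.

Lemma defset1 : defset [set 1%g].
Proof.
apply: defset_subgroup; split; first by rewrite inE.
by move=> x y; rewrite !inE => -> ->; rewrite mulgV.
Qed.

Lemma coords_eq u v j : (f u * c j = f v * c j)%g <-> f (u - v) = 1%g.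
Proof.
rewrite zhomB //; split; first by move/mulIg ->; rewrite mulgV.
by move/divg1_eq ->.
Qed.

Lemma pres_kernel (T : Type) (L : (T -> int) -> I -> int) :
  (forall i, islin (fun e => L e i)) -> pres (fun e => f (L e) = 1%g).
Proof.
(* No [c j] need be 1, so [L e] is shifted by coordinates [v] of 1:
   [f (L e + v) * c j = f (L e)]. *)
move=> HL; have [v [j E]] := coords_surj cd 1%g.
apply: pres_ext (pres_subst (s := fun e i => L e i + v i) _ (defset1 j)) => [e|i].
  rewrite /= -[fun i => _]/(L e + v) fH -mulgA -E mulg1; split=> //.
by apply: islinD => //; exact: islin_const.
Qed.

Definition cenv (V : Type) (jj : V -> J) (e : V * I -> int) : V -> M :=
  fun v => (f (fun i => e (v, i)) * c (jj v))%g.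

(** The cosets [jj] of the variables are fixed in advance, so that only integer vectors remain as
    unknowns. *)
Definition gpres (V : Type) (P : (V -> M) -> Prop) : Prop :=
  forall jj : V -> J, pres (fun e => P (cenv jj e)).

(** Once the cosets of the variables are fixed, a term stays in one coset and has affine
    coordinates. Moving [f] to the left past [c j1] costs a linear map,
    [c j1 * f v = f (A v) * c j1], and the product [c j1 * c j2] adds a constant vector; inverses
    behave likewise. *)
Lemma gterm_coords (V : Type) (t : gterm V) (jj : V -> J) :
  exists (j : J) (L : (V * I -> int) -> I -> int),
    (forall i, islin (fun e => L e i)) /\
    forall e, gterm_eval (cenv jj e) t = (f (L e) * c j)%g.
Proof.
elim: t => [v||t1 [j1 [L1 [H1 E1]]] t2 [j2 [L2 [H2 E2]]]|t [j [L [H E]]]].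
- by exists (jj v), (fun e i => e (v, i)); split => // i; exact: islin_var.
- have [v [j E]] := coords_surj cd 1%g; exists j, (fun _ => v); split => // i.
  exact: islin_const.
- have [A HA] := coords_conj_lin (c j1).
  have [w [j E]] := coords_surj cd (c j1 * c j2)%g.
  exists j, (fun e => L1 e + lincomb A (L2 e) + w); split => [i|e].
    apply: islinD; last exact: islin_const.
    apply: islinD => //; apply: islin_sum => k; exact: islinZr.
  rewrite /= E1 E2 !fH -HA -[(_ * f w * c j)%g]mulgA -E !mulgA.
  by rewrite mulgVK.
- have [A HA] := coords_conj_lin (c j)^-1%g.
  have [w [j' E']] := coords_surj cd (c j)^-1%g.
  exists j', (fun e => lincomb A (fun k => - L e k) + w); split => [i|e].
    apply: islinD; last exact: islin_const.
    by apply: islin_sum => k; apply: islinZr; exact: islin_opp.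
  have -> : (fun k => - L e k) = - L e by [].
  by rewrite /= E fH -HA -[(_ * f w * c j')%g]mulgA -E' invgM zhomN // invgK mulgK.
Qed.

Lemma gpres_ext (V : Type) (P Q : (V -> M) -> Prop) :
  (forall e, P e <-> Q e) -> gpres P -> gpres Q.
Proof. by move=> E HP jj; apply: pres_ext (HP jj) => e. Qed.

Lemma gpres_term (V : Type) R (t : gterm V) :
  defset R -> gpres (fun e => R (gterm_eval e t)).
Proof.
move=> HR jj; have [j [L [HL E]]] := gterm_coords t jj.
by apply: pres_ext (pres_subst HL (HR j)) => e; rewrite E.
Qed.

Lemma gpres_eq (V : Type) (t1 t2 : gterm V) :
  gpres (fun e => gterm_eval e t1 = gterm_eval e t2).
Proof.
apply: gpres_ext (gpres_term (TMul t1 (TInv t2)) defset1) => e /=.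
by split => [/divg1_eq->|->] //; rewrite mulgV.
Qed.

Lemma gpres_not (V : Type) (P : (V -> M) -> Prop) :
  gpres P -> gpres (fun e => ~ P e).
Proof. by move=> HP jj; apply: pres_not (HP jj). Qed.

Lemma gpres_and (V : Type) (P Q : (V -> M) -> Prop) :
  gpres P -> gpres Q -> gpres (fun e => P e /\ Q e).
Proof. by move=> HP HQ jj; apply: pres_and (HP jj) (HQ jj). Qed.

Lemma gpres_subst (V W : Type) (P : (W -> M) -> Prop) (s : W -> V + M) :
  gpres P -> gpres (fun e => P (fun w => match s w with inl v => e v | inr g => g end)).
Proof.
move=> HP jj.
have /choice[r Hr] : forall g, exists p : (I -> int) * J, g = (f p.1 * c p.2)%g.
  by move=> g; have [v [j E]] := coords_surj cd g; exists (v, j).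
pose jj' w := match s w with inl v => jj v | inr g => (r g).2 end.
pose sg (e : V * I -> int) (p : W * I) : int :=
  match s p.1 with inl v => e (v, p.2) | inr g => (r g).1 p.2 end.
have Hsg p : islin (fun e => sg e p).
  by rewrite /sg; case: (s p.1) => [v|g]; [exact: islin_var|exact: islin_const].
apply: pres_ext (pres_subst Hsg (HP jj')) => e.
suff -> : cenv jj' (sg e) =
  (fun w => match s w with inl v => cenv jj e v | inr g => g end) by [].
apply/funext => w; rewrite /cenv /jj' /sg /=; case: (s w) => // g.
Qed.

(** A quantifier over the group is a finite disjunction over cosets followed by quantifiers over the
    integer coordinates. *)
Lemma gpres_ex (V : Type) (P : (V -> M) -> M -> Prop) :
  gpres (fun e : option V -> M => P (fun v => e (Some v)) (e None)) ->
  gpres (fun e => exists g, P e g).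
Proof.
move=> HP jj.
apply: pres_ext (pres_ex_fin (P := fun e j =>
  exists x : I -> int, P (cenv jj e) (f x * c j)%g) _).
  move=> e; split; first by move=> [j [x H]]; exists (f x * c j)%g.
  by move=> [g]; have [v [j ->]] := coords_surj cd g; exists j, v.
move=> j.
apply: (@pres_ex_fun I _ (fun e x => P (cenv jj e) (f x * c j)%g)).
pose sg (e : V * I + I -> int) (p : option V * I) : int :=
  if p.1 is Some v then e (inl (v, p.2)) else e (inr p.2).
have Hsg p : islin (fun e => sg e p).
  by rewrite /sg; case: p => -[v|] i; exact: islin_var.
exact: pres_ext (pres_subst Hsg (HP (oapp jj j))).
Qed.

Lemma gpres_all (V : Type) (P : (V -> M) -> M -> Prop) :
  gpres (fun e : option V -> M => P (fun v => e (Some v)) (e None)) ->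
  gpres (fun e => forall g, P e g).
Proof.
move=> HP; have := gpres_not (@gpres_ex V (fun e g => ~ P e g) (gpres_not HP)).
apply: gpres_ext => e; split; first by move/forallNP => H' x; apply: contrapT.
by move=> H' [x]; apply.
Qed.

Lemma holds_ext (V : Type) (e e' : V -> M) F : e = e' -> holds e F <-> holds e' F.
Proof. by move=> ->. Qed.

Lemma gpres_holds (V : Type) (F : gformula V) : gpres (fun e : V -> M => holds e F).
Proof.
have or V' (P Q : (V' -> M) -> Prop) : gpres P -> gpres Q -> gpres (fun e => P e \/ Q e).
  by move=> HP HQ jj; apply: pres_or (HP jj) (HQ jj).
have imp V' (P Q : (V' -> M) -> Prop) : gpres P -> gpres Q -> gpres (fun e => P e -> Q e).
  by move=> HP HQ jj; apply: pres_imp (HP jj) (HQ jj).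
have E V' (e : option V' -> M) :
    (fun v => oapp (fun v => e (Some v)) (e None) v) = e.
  by apply/funext => -[].
elim: F => {V} [V t1 t2|V|V F IH|V F1 H1 F2 H2|V F1 H1 F2 H2|V F1 H1 F2 H2|V F IH|V F IH] /=.
- exact: gpres_eq.
- by move=> jj; exact: pres_const.
- exact: gpres_not.
- exact: gpres_and.
- exact: or.
- exact: imp.
- by apply: gpres_all; apply: gpres_ext IH => e; rewrite E.
- by apply: gpres_ex; apply: gpres_ext IH => e; rewrite E.
Qed.

End CoordsTheory.

(** * Coordinates on powers; definable and algebraic sets *)

Section PowerCoords.
Variables (M : groupType) (I J : finType) (f : (I -> int) -> M) (c : J -> M).
Hypothesis cd : coords f c.
Variable q : nat.

Definition powf (v : 'I_q * I -> int) : {ffun 'I_q -> M} :=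
  [ffun i => f (fun k => v (i, k))].
Definition powc (jj : {ffun 'I_q -> J}) : {ffun 'I_q -> M} := [ffun i => c (jj i)].

Lemma coords_pow : coords powf powc.
Proof.
split.
- move=> u v; apply/ffunP => i; rewrite !ffunE; exact: (coords_hom cd).
- move=> g.
  have : forall i, exists p : (I -> int) * J, g i = (f p.1 * c p.2)%g.
    by move=> i; have [v [j E]] := coords_surj cd (g i); exists (v, j).
  move=> /choice[p Hp]; exists (fun k => (p k.1).1 k.2), [ffun i => (p i).2].
  by apply/ffunP => i; rewrite !ffunE Hp.
- move=> u v jj jj' /ffunP E; apply/ffunP => i; have := E i; rewrite !ffunE.
  exact: (coords_inj cd).
- move=> g v.
  have [u Hu] := choice (fun i => coords_conj cd (g i) (fun k => v (i, k))).
  by exists (fun k => u k.1 k.2); apply/ffunP => i; rewrite !ffunE Hu.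
Qed.

Lemma defset_pow (R : set {ffun 'I_q -> M}) :
  gpres f c (fun e : 'I_q -> M => R (finfun e)) -> defset powf powc R.
Proof.
move=> H jj; apply: pres_ext (H jj) => e.
by suff -> : [ffun x => cenv f c jj e x] = (powf e * powc jj)%g by [];
  apply/ffunP => i; rewrite !ffunE.
Qed.

Lemma defset_definable (V : set {ffun 'I_q -> M}) :
  definable_set V -> defset powf powc V.
Proof.
move=> [n [F [m ->]]]; apply: defset_pow.
have := gpres_subst cd (fun v : 'I_q + 'I_n =>
  match v with inl i => inl i | inr j => inr (m j) end) (gpres_holds cd F).
apply: gpres_ext => e /=; apply: holds_ext.
by apply/funext => -[i|j] //; rewrite ffunE.
Qed.

Lemma defset_algebraic (V : set {ffun 'I_q -> M}) :
  algebraic_set V -> defset powf powc V.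
Proof.
move=> [n [lhs [rhs ->]]]; apply: defset_pow => jj.
apply: pres_all_fin => j.
have := gpres_subst cd (fun v : M + 'I_q =>
  match v with inl g => inr g | inr i => inl i end) (gpres_eq cd (lhs j) (rhs j)).
move/(_ jj); apply: pres_ext => e /=.
set e1 := fun w : M + 'I_q => _; set e2 := fun v : M + 'I_q => _.
by have -> : e1 = e2 by apply/funext => -[g|i] //; rewrite /e1 /e2 ffunE.
Qed.

End PowerCoords.

(** * Existence of coordinates *)

Lemma is_subgroupP (G : groupType) (H : set G) : is_subgroup H <->
  [/\ H 1%g, forall x y, H x -> H y -> H (x * y)%g & forall x, H x -> H x^-1%g].
Proof.
split=> [[/set_mem H1 HF]|[H1 HM HV]].
  have HF' x y : H x -> H y -> H (x / y)%g.
    by move=> Hx Hy; apply/set_mem/HF; exact/mem_set.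
  have HV x : H x -> H x^-1%g by move=> Hx; rewrite -div1g; exact: HF'.
  by split=> // x y Hx Hy; rewrite -[y]invgK; apply: HF' => //; exact: HV.
split; first exact/mem_set.
by move=> x y /set_mem Hx /set_mem Hy; apply/mem_set; apply: (HM) => //; exact: HV.
Qed.

Lemma lcosetP (G : groupType) (H : set G) x y : is_subgroup H ->
  lcoset H x = lcoset H y <-> H (x^-1 * y)%g.
Proof.
move=> /is_subgroupP[H1 HM HV]; split.
  move=> E; have : lcoset H y y by exists 1%g => //; rewrite mulg1.
  by rewrite -E => -[h Hh <-]; rewrite mulKg.
move=> Hxy; apply/seteqP; split => _ [h Hh <-].
  exists ((x^-1 * y)^-1 * h)%g; first by apply: (HM) => //; exact: HV.
  by rewrite invgM invgK -mulgA mulVKg.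
by exists (x^-1 * y * h)%g; [exact: HM|rewrite -mulgA mulVKg].
Qed.

Lemma coords_of_normal (G : groupType) (N : set G) (d : nat) (I : finType)
    (f : (I -> int) -> G) :
  is_normal N -> has_index N d -> zhom f -> range f = N ->
  exists c : 'I_d -> G, coords f c.
Proof.
move=> [Nsub NJ] /card_set_bijP[phi [phiF phiI phiS]] fH fN.
have /is_subgroupP[N1 NM NV] := Nsub.
have : forall i : 'I_d, exists g, phi (lcoset N g) = i.
  by move=> i; have [_ [g _ <-] E] := phiS i (ltn_ord i); exists g.
move=> /choice[c Hc]; exists c.
(* Indices refer to left cosets, whereas coordinates put [N] on the left; normality passes from
   [c j * n] to [n' * c j]. *)
have conjN g x : N x -> N (g * x * g^-1)%g.
  by move=> Nx; have := NJ x g^-1%g Nx; rewrite conjgE invgK mulgA.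
have fP x : N x -> exists v, x = f v by rewrite -fN => -[v _ <-]; exists v.
have Nf v : N (f v) by rewrite -fN; exists v.
split => //.
- move=> g; have lt : (phi (lcoset N g) < d)%N by apply: phiF; exists g.
  have : lcoset N (c (Ordinal lt)) = lcoset N g.
    by apply: phiI; rewrite ?inE; [exists (c (Ordinal lt))|exists g|rewrite Hc].
  move=> /lcosetP -/(_ Nsub) Ng.
  have [v Ev] := fP _ (conjN (c (Ordinal lt)) _ Ng).
  by exists v, (Ordinal lt); rewrite -Ev mulgVK mulVKg.
- move=> u v i j E; apply/val_inj; rewrite /= -Hc -(Hc j); congr phi.
  apply/lcosetP => //.
  have -> : (c i = (f u)^-1 * f v * c j)%g by rewrite -mulgA -E mulKg.
  rewrite invgM -mulgA; have := NJ ((f u)^-1 * f v)^-1%g (c j).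
  by rewrite conjgE; apply; apply: (NV); apply: (NM) => //; exact: (NV).
- by move=> g v; exact: (fP _ (conjN _ _ (Nf v))).
Qed.

Section ZPow.
Variable G : groupType.
Implicit Type g : G.

Definition zpow g (z : int) : G :=
  match z with Posz n => (g ^+ n)%g | Negz n => (g ^- n.+1)%g end.

Lemma zpowS g z : zpow g (z + 1) = (zpow g z * g)%g.
Proof.
case: z => n; first by rewrite -PoszD addn1 /= expgSr.
case: n => [|n]; first by rewrite /= expg1 mulVg.
have -> : Negz n.+1 + 1 = Negz n by lia.
by rewrite /= [in RHS]expgS invgM mulgVK.
Qed.

Lemma zpowD g z z' : zpow g (z + z') = (zpow g z * zpow g z')%g.
Proof.
elim/int_ind: z' => [|n IH|n IH].
- by rewrite addr0 mulg1.
- have -> : n.+1%:Z = n%:Z + 1 by lia.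
  by rewrite addrA !zpowS IH mulgA.
- have E : - n%:Z = - n.+1%:Z + 1 by lia.
  apply: (mulIg g); rewrite -zpowS -addrA -mulgA -zpowS -E; exact: IH.
Qed.

Lemma zpow_commute g h z z' : commute g h -> commute (zpow g z) (zpow h z').
Proof.
have K x y k : commute x y -> commute x (zpow y k).
  by move=> C; case: k => n /=; [|apply: commuteV]; exact: commuteX.
by move=> C; apply/K/commute_sym/K/commute_sym.
Qed.

Lemma zhom_of_family (I : finType) (a : I -> G) : (forall i i', commute (a i) (a i')) ->
  exists f : (I -> int) -> G, zhom f /\ (forall i, f (unitv i) = a i) /\
    forall N : set G, is_subgroup N -> (forall i, N (a i)) -> forall v, N (f v).
Proof.
move=> C; exists (fun v => \prod_i zpow (a i) (v i))%g; split=> [u v|].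
  rewrite -prodgM_commute => [|i i' _ _]; last exact: zpow_commute.
  by apply: eq_bigr => i _; rewrite -zpowD.
split=> [i|N /is_subgroupP[N1 NM NV] Na v].
  have H s : uniq s -> (\prod_(j <- s) zpow (a j) (unitv i j))%g =
      if i \in s then a i else 1%g.
    elim: s => [|j s IH] /=; first by rewrite big_nil.
    move=> /andP[js us]; rewrite big_cons IH // inE /unitv eq_sym.
    have [->|ij] := eqVneq i j; first by rewrite (negPf js) /= mulg1 expg1.
    by rewrite /= mul1g.
  by rewrite H ?index_enum_uniq // mem_index_enum.
apply: (big_ind N) => // i _.
have NX n : N (a i ^+ n)%g.
  by elim: n => [|n IH]; rewrite ?expg0 // expgS; exact: NM.
by case: (v i) => n /=; [exact: NX|exact/NV/NX].
Qed.

End ZPow.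

(** A form of finite index without exact count: a key may be finer than the partition into cosets,
    which makes it easy to produce for the normal core. *)
Definition fin_key (G : groupType) (N : set G) : Prop :=
  exists (K : finType) (key : G -> K), forall x y, key x = key y -> N (x^-1 * y)%g.

Lemma finite_index_key (G : groupType) (N : set G) :
  is_subgroup N -> finite_index N <-> fin_key N.
Proof.
move=> Ns; split.
  move=> [d /card_set_bijP[phi [phiF phiI phiS]]].
  have lt g : (phi (lcoset N g) < d)%N by apply: phiF; exists g.
  exists 'I_d, (fun g => Ordinal (lt g)) => x y [E]; apply/lcosetP => //.
  by apply: phiI; rewrite ?inE //.
move=> [K [key H]]; rewrite /finite_index.
apply: sub_finite_set (finite_image (fun k : K => lcoset N (xget 1%g [set g | key g = k]))
  (finite_finset (X := [set: K]))).
move=> _ [g _ <-]; exists (key g) => //; apply/lcosetP => //; apply: H.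
by have := xgetI 1%g (erefl (key g) : [set h | key h = key g] g).
Qed.

(** The core is the kernel of the action on the finitely many left cosets of [A]; the new key of [x]
    records, for every [k], the old key of [x * rep k]. *)
Lemma normal_core (G : groupType) (A : set G) : is_subgroup A -> fin_key A ->
  exists N : set G, [/\ is_normal N, N `<=` A & fin_key N].
Proof.
move=> As; have /is_subgroupP[A1 AM AV] := As.
move=> [K [key Hkey]]; exists [set x | forall g, A (x ^ g)%g]; split.
- split.
    apply/is_subgroupP; split=> [g|x y Hx Hy g|x Hx g]; first by rewrite conj1g.
      by rewrite conjMg; exact: AM.
    by rewrite conjVg; exact: AV.
  by move=> x g Hx h; rewrite -conjgM.
- by move=> x /(_ 1%g); rewrite conjg1.
pose rep (k : K) := xget 1%g [set g | key g = k].
have repK g : key (rep (key g)) = key g.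
  exact: (xgetI 1%g (erefl (key g) : [set h | key h = key g] g)).
exists {ffun K -> K}, (fun g => [ffun k => key (g * rep k)%g]) => x y /ffunP E g.
have := E (key g); rewrite !ffunE => /Hkey H.
have Hg := Hkey _ _ (repK g).
have -> : ((x^-1 * y) ^ g = ((rep (key g))^-1 * g)^-1 *
    ((x * rep (key g))^-1 * (y * rep (key g))) * ((rep (key g))^-1 * g))%g.
  by rewrite conjgE !invgM invgK !mulgA !mulgK.
by apply: (AM) => //; apply: (AM) => //; exact: AV.
Qed.

(* Schreier: the elements n(t, s) of N with t s = n(t, s) t' for t, t' in a
   transversal containing a representative of N and s a generator generate N. *)
Lemma schreier (G : groupType) (N : set G) : finitely_generated G -> is_normal N ->
  (forall x y, N x -> N y -> commute x y) -> fin_key N ->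
  exists (I J : finType) (f : (I -> int) -> G) (c : J -> G), coords f c.
Proof.
move=> [A genA] Nn NC kN; have [Ns NJ] := Nn.
have /is_subgroupP[N1 NM NV] := Ns.
have [d dN] : exists d, has_index N d by exact/(finite_index_key Ns).
have /card_set_bijP[phi [phiF phiI phiS]] := dN.
have : forall i : 'I_d, exists g, phi (lcoset N g) = i.
  by move=> i; have [_ [g _ <-] E] := phiS i (ltn_ord i); exists g.
move=> /choice[c Hc].
have conjN g x : N x -> N (g * x * g^-1)%g.
  by move=> Nx; have := NJ x g^-1%g Nx; rewrite conjgE invgK mulgA.
have surj g : exists p : G * 'I_d, N p.1 /\ g = (p.1 * c p.2)%g.
  have lt : (phi (lcoset N g) < d)%N by apply: phiF; exists g.
  have : lcoset N (c (Ordinal lt)) = lcoset N g.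
    by apply: phiI; rewrite ?inE; [exists (c (Ordinal lt))|exists g|rewrite Hc].
  move=> /lcosetP -/(_ Ns) /(conjN (c (Ordinal lt))) Ng.
  exists ((c (Ordinal lt)) * ((c (Ordinal lt))^-1 * g) * (c (Ordinal lt))^-1, Ordinal lt)%g.
  by split; rewrite //= mulgVK mulVKg.
have inj x y i j : N x -> N y -> (x * c i = y * c j)%g -> i = j.
  move=> Nx Ny E; apply/val_inj; rewrite /= -Hc -(Hc j); congr phi.
  apply/lcosetP => //.
  have -> : (c i = x^-1 * y * c j)%g by rewrite -mulgA -E mulKg.
  rewrite invgM -mulgA; have := NJ (x^-1 * y)^-1%g (c j).
  by rewrite conjgE; apply; apply: (NV); apply: (NM) => //; exact: (NV).
have [r Hr] := choice surj.
(* The boolean tells a generator from its inverse. The index [None] stands for the [N]-part of 1,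
   which is needed because the representative of [N] itself may differ from 1. *)
pose I : finType := option ('I_d * (A * bool))%type.
pose gen (s : A * bool) : G := if s.2 then fsval s.1 else (fsval s.1)^-1%g.
pose a (i : I) : G := (r (if i is Some (j, s) then c j * gen s else 1)).1%g.
have Na i : N (a i) by have [] := Hr (if i is Some (j, s) then c j * gen s else 1)%g.
have [f [fH [fa fN]]] := zhom_of_family (fun i i' => NC _ _ (Na i) (Na i')).
have {}fN := fN _ Ns Na.
pose W g := exists v j, g = (f v * c j)%g.
have W1 : W 1%g.
  exists (unitv None), (r 1%g).2; rewrite fa /a; exact: (Hr 1%g).2.
have WS g s : W g -> W (g * gen s)%g.
  move=> [v [j ->]]; exists (v + unitv (Some (j, s))), (r (c j * gen s)%g).2.
  by rewrite fH fa -!mulgA; congr (_ * _)%g; exact: (Hr (c j * gen s)%g).2.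
(* [W] is only known to be stable under right multiplication by generators and their inverses. Its
   two-sided stability under [g] and the inverse of [g] defines a subgroup, to which the generation
   hypothesis applies. *)
pose K : set G := [set g | forall w, W w -> W (w * g)%g /\ W (w * g^-1)%g].
have KT : K = setT.
  apply/seteqP; split => // g _; have : [set: G] g by [].
  rewrite -genA => /(_ K); apply; split.
    apply/is_subgroupP; split.
    - by move=> w Ww; rewrite invg1 mulg1.
    - move=> x y Kx Ky w Ww; rewrite invgM !mulgA; split.
        by apply: (Ky _ _).1; exact: (Kx _ _).1.
      by apply: (Kx _ _).2; exact: (Ky _ _).2.
    - by move=> x Kx w Ww; rewrite invgK; have [] := Kx _ Ww.
  move=> s sA w Ww; have := WS _ ([` sA]%fset, true) Ww.
  by have := WS _ ([` sA]%fset, false) Ww.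
have WT g : W g.
  have Kg : K g by rewrite KT.
  by have [] := Kg _ W1; rewrite mul1g.
have fNE : range f = N.
  apply/seteqP; split => [_ [v _ <-] //|n Nn'].
  have [v [j E]] := WT n.
  have E1 := (Hr 1%g).2.
  have Nr := (Hr 1%g).1.
  have Ej : j = (r 1%g).2.
    apply: (inj (f v) (n * (r 1%g).1)%g) => //; first exact: NM.
    by rewrite -E -mulgA -E1 mulg1.
  (* An element of [N] has the same representative as 1, and this representative is the inverse of
     the [N]-part of 1. *)
  have Ec : c j = f (- unitv None).
    rewrite zhomN // fa /a Ej; apply: (mulgI (r 1%g).1).
    by rewrite -E1 mulgV.
  by exists (v - unitv None) => //; rewrite fH -Ec -E.
have [c' cd] := coords_of_normal Nn dN fH fNE.
by exists I, 'I_d, f, c'.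
Qed.

Lemma coords_exist (G : groupType) : finitely_generated G -> virtually_abelian G ->
  exists (I J : finType) (f : (I -> int) -> G) (c : J -> G), coords f c.
Proof.
move=> fgG [A [As Ac /(finite_index_key As) Ak]].
have [N [Nn NA Nk]] := normal_core As Ak.
by apply: schreier fgG Nn _ Nk => x y /NA Ax /NA Ay; exact: Ac.
Qed.

Lemma coords_free_abelian (G : groupType) (N : set G) (k d : nat) :
  is_normal N -> free_abelian_rank k N -> has_index N d ->
  exists (f : ('I_k -> int) -> G) (c : 'I_d -> G), coords f c /\ range f = N.
Proof.
move=> Nn [f0 [f0H _ f0N]] dN.
pose f (v : 'I_k -> int) : G := f0 (\row_i v i).
have fH : zhom f.
  by move=> u v; rewrite /f -f0H; congr f0; apply/rowP => i; rewrite !mxE.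
have fN : range f = N.
  rewrite -f0N; apply/seteqP; split => [_ [v _ <-]|_ [v _ <-]].
    by exists (\row_i v i).
  by exists (v ord0) => //; congr f0; apply/rowP => i; rewrite mxE.
by have [c cd] := coords_of_normal Nn dN fH fN; exists f, c.
Qed.

(** * Rational sets are the sets that are Presburger in coordinates *)

Fixpoint lexlt (T : Type) (s : seq T) (x y : T -> int) : Prop :=
  if s is t :: s' then x t < y t \/ x t = y t /\ lexlt s' x y else False.

Lemma lexlt_total (T : eqType) (s : seq T) (x y : T -> int) :
  [\/ {in s, x =1 y}, lexlt s x y | lexlt s y x].
Proof.
elim: s => [|t s IH] /=; first by constructor 1.
have [lt|lt|E] := ltrgtP (x t) (y t); first by constructor 2; left.
  by constructor 3; left.
case: IH => H; [constructor 1|constructor 2; right|constructor 3; right] => //.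
by move=> t'; rewrite inE => /predU1P[->//|/H].
Qed.

Lemma lexlt_min (T : Type) (s : seq T) (A : set (T -> nat)) : A !=set0 ->
  exists2 x, A x & forall y, A y -> ~ lexlt s (fun t => (y t)%:Z) (fun t => (x t)%:Z).
Proof.
elim: s A => [|t s IH] A [x0 Ax0]; first by exists x0 => // y _ [].
have ex : exists n, `[< exists2 x, A x & x t = n >] by exists (x0 t); apply/asboolP; exists x0.
case: (ex_minnP ex) => n /asboolP[x1 Ax1 x1n] min.
have [|x [Ax xn] Hx] := IH [set x | A x /\ x t = n]; first by exists x1.
exists x => // y Ay /= [|[E lt]].
  move=> lt; have Ey : `[< exists2 x, A x & x t = y t >] by apply/asboolP; exists y.
  by have := min _ Ey; rewrite -xn; lia.
by apply: (Hx y) => //; split => //; case: E => ->.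
Qed.

Lemma pres_lexlt (T V : Type) (s : seq T) (x y : (V -> int) -> T -> int) :
  (forall t, islin (fun e => x e t)) -> (forall t, islin (fun e => y e t)) ->
  pres (fun e => lexlt s (x e) (y e)).
Proof.
move=> Hx Hy; elim: s => [|t s IH] /=; first exact: pres_const.
apply: pres_or; first exact: pres_lt.
by apply: pres_and => //; exact: pres_eq.
Qed.

Lemma nat_minP (A : set nat) : A !=set0 ->
  A (nat_min A) /\ forall m, A m -> (nat_min A <= m)%N.
Proof.
move=> [n0 An0]; rewrite /nat_min.
have ex : exists n, `[< A n >] by exists n0; apply/asboolP.
apply: (@xgetPex _ 0%N [set n | A n /\ forall m, A m -> (n <= m)%N]).
case: (ex_minnP ex) => n /asboolP An min; exists n; split => // m Am.
by apply: min; apply/asboolP.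
Qed.

Lemma nat_minE (A : set nat) n : A !=set0 ->
  nat_min A = n <-> A n /\ forall m, (m < n)%N -> ~ A m.
Proof.
move=> /nat_minP[H1 H2]; split.
  by move=> <-; split => // m lt /H2; rewrite leqNgt lt.
move=> [An H]; apply/eqP; rewrite eqn_leq H2 //= leqNgt; apply/negP => lt.
exact: H lt _.
Qed.

Lemma map_fsval_insub (K : choiceType) (A : {fset K}) (u : seq K) :
  {subset u <= A} -> [seq fsval a | a <- pmap insub u : seq A] = u.
Proof.
elim: u => //= x u IH Hu; have xA : x \in A by apply: Hu; exact: mem_head.
by rewrite insubT /= IH // => y yu; apply: Hu; rewrite inE yu orbT.
Qed.

Section RegularPres.
Variables (M : groupType) (I J : finType) (f : (I -> int) -> M) (c : J -> M).
Hypothesis cd : coords f c.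
Let fH : zhom f := coords_hom cd.

Lemma coords_pick : exists r : M -> (I -> int) * J,
  forall g, g = (f (r g).1 * c (r g).2)%g.
Proof.
have /choice[r Hr] : forall g, exists p : (I -> int) * J, g = (f p.1 * c p.2)%g.
  by move=> g; have [v [j E]] := coords_surj cd g; exists (v, j).
by exists r.
Qed.

(** The automaton is enriched by the current coset: reading [a] at coset [j] moves to the coset of
    [c j * val a] and adds the [f]-part of that product to the vector. The coordinate [None]
    accumulates the weight of the word. *)
Lemma pres_regular (A : finType) (val : A -> M) (wt : A -> int) (L : set (seq A)) j :
  regular L -> pres (fun e : option I -> int => exists w, [/\ L w,
    word_val [seq val a | a <- w] = (f (fun i => e (Some i)) * c j)%g &
    \sum_(a <- w) wt a = e None]).
Proof.
move=> [Q [q0 [delta [F HF]]]]; have [r Hr] := coords_pick.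
pose st j a := r (c j * val a)%g.
pose delta' (p : Q * J) a : Q * J := (delta p.1 a, (st p.2 a).2).
pose lab (p : Q * J) a (o : option I) : int :=
  if o is Some i then (st p.2 a).1 i else wt a.
pose p0 := (q0, (r 1%g).2).
pose run w := foldl (fun p a => (delta' p.1 a, p.2 + lab p.1 a)) (p0, 0) w.
have runP w : [/\ foldl delta' p0 w = (run w).1, foldl delta q0 w = (run w).1.1,
    word_val [seq val a | a <- w] =
      (f (fun i => (r 1%g).1 i + (run w).2 (Some i)) * c (run w).1.2)%g &
    \sum_(a <- w) wt a = (run w).2 None].
  elim/last_ind: w => [|w a [IH1 IH2 IH3 IH4]].
    split => //; rewrite /word_val /= big_nil // [LHS](Hr 1%g).
    by congr (f _ * _)%g; apply/funext => i; rewrite addr0.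
  rewrite /run !foldl_rcons -/(run w) map_rcons /word_val !big_rcons /= IH1 IH2 IH4.
  rewrite -/(word_val _) IH3; split => //.
  rewrite -mulgA [(c _ * val a)%g]Hr mulgA -fH; congr (f _ * _)%g.
  by apply/funext => i; rewrite !addrfctE addrA.
have SP q := pres_semilinear (semilinear_runs delta' lab p0 (q, j)).
(* The accumulated vector [x], shifted by the coordinates of 1 from which the run starts, has to
   match [e] only up to the kernel of [f]. *)
pose B (e : option I -> int) (q : Q) (x : I -> int) :=
  [set v | exists2 w : seq A, foldl delta' p0 w = (q, j) &
     v = (run w).2] (fun o => if o is Some i then x i else e None) /\ q \in F /\
   f (fun i => (r 1%g).1 i + x i - e (Some i)) = 1%g.
suff K : pres (fun e : option I -> int => exists q x, B e q x).
  apply: pres_ext K.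
  move=> e; split.
    move=> [q [x [[w dw Ew] [qF Ef]]]]; exists w.
    have [H1 H2 H3 H4] := runP w; rewrite H3 H4 -Ew; split => //.
      by apply/HF; rewrite H2 -H1 dw.
    rewrite -H1 dw /=; apply/(coords_eq cd); rewrite -[RHS]Ef; congr f.
  move=> [w [Lw Ew Es]]; have [H1 H2 H3 H4] := runP w.
  exists (run w).1.1, (fun i => (run w).2 (Some i)).
  have Ej : (run w).1.2 = j by apply: (coords_inj cd) (etrans (esym H3) Ew).
  split; last split.
  - exists w; first by rewrite H1 -Ej; case: (run w).1.
    by apply/funext => -[i|] //; rewrite -Es H4.
  - by rewrite -H2; apply/HF.
  - move: H3; rewrite Ew Ej => /esym/(coords_eq cd) E1.
    by rewrite -[RHS]E1.
apply: pres_ex_fin => q; apply: (@pres_ex_fun I _ (fun e x => B e q x)).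
apply: pres_and; last apply: pres_and.
- apply: pres_subst (SP q) => -[i|]; exact: islin_var.
- exact: pres_const.
- apply: (pres_kernel cd) => i; apply: islinB; last exact: islin_var.
  by apply: islinD; [exact: islin_const|exact: islin_var].
Qed.

Lemma defset_rational (R : set M) : rational_set R -> defset f c R.
Proof.
move=> [A _ [L rL ->]] j.
have Hs o : islin (fun v : I -> int => if o is Some i then v i else 0).
  by case: o => [i|]; [exact: islin_var|exact: islin_const].
have := pres_subst Hs (pres_regular (fun a : A => fsval a) (fun=> 0) j rL).
apply: pres_ext => v; split.
  by move=> [w [Lw E _]]; exists w.
by move=> [w Lw E]; exists w; rewrite big1_eq.
Qed.

(** The multiplicative counterpart of a semilinear set: finite unions of finitely generated
    submonoids, each multiplied on the right by a fixed element. *)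
Definition mlinear (l : seq (seq M * M)) : set M :=
  [set g | exists2 p, p \in l & exists u, {subset u <= p.1} /\ g = (word_val u * p.2)%g].

Definition slin (X : set M) : Prop := exists l, X = mlinear l.

Lemma mlinear_cat l l' : mlinear (l ++ l') = mlinear l `|` mlinear l'.
Proof.
apply/seteqP; split => g.
  by move=> [p]; rewrite mem_cat => /orP[pl|pl] Hp; [left|right]; exists p.
by move=> [[p pl Hp]|[p pl Hp]]; exists p; rewrite // mem_cat pl ?orbT.
Qed.

Lemma slinU X Y : slin X -> slin Y -> slin (X `|` Y).
Proof. by move=> [l ->] [l' ->]; exists (l ++ l'); rewrite mlinear_cat. Qed.

Lemma slin_bigcup (T : finType) (X : T -> set M) :
  (forall t, slin (X t)) -> slin (\bigcup_t X t).
Proof.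
move=> /choice[l Hl]; exists (flatten [seq l t | t <- enum T]).
apply/seteqP; split => g.
  move=> [t _]; rewrite Hl => -[p pl Hp]; exists p => //.
  by apply/flatten_mapP; exists t; rewrite ?mem_enum.
move=> [p /flatten_mapP[t _ pl] Hp]; exists t => //; rewrite Hl; by exists p.
Qed.

Lemma slin0 : slin set0.
Proof. by exists [::]; apply/seteqP; split => // g []. Qed.

(** On a free piece the coordinates are [b + \sum_t x t * v t], so the elements are the products of
    letters [f (v t)], followed by [f b * g]. The order of the letters does not matter, since values
    of [f] commute. *)
Lemma slin_decomp (T : finType) (P : set (T -> nat)) (s : (T -> nat) -> I -> int) g :
  (forall i, islinN (fun x => s x i)) -> decomp P ->
  slin [set (f (s x) * g)%g | x in P].
Proof.
move=> + DP; elim: DP s => {T P} [T|T P1 P2 _ IH1 _ IH2 H12|T|T' T h P Hh Ih _ IH] s Hs.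
- by rewrite image_set0; exact: slin0.
- by rewrite image_setU; apply: slinU; [exact: IH1|exact: IH2].
- have [a /choice[b Hab]] := choice Hs.
  pose v t : I -> int := fun i => a i t.
  have sE x : s x = \sum_t v t *+ x t + b.
    apply/funext => i; rewrite Hab addrfctE addrC; congr (_ + _).
    rewrite fct_sumE; apply: eq_bigr => t _.
    by rewrite natmulfctE -mulr_natr natz.
  exists [:: ([seq f (v t) | t <- enum T], f b * g)%g].
  apply/seteqP; split => h.
    move=> [x _ <-]; exists ([seq f (v t) | t <- enum T], f b * g)%g; first exact: mem_head.
    rewrite sE fH /= -mulgA.
    suff [u [Hu <-]] : exists u, {subset u <= [seq f (v t) | t <- enum T]} /\
        word_val u = f (\sum_t v t *+ x t) by exists u.
    apply: (big_ind (fun z : I -> int => exists u, {subset u <= [seq f (v t) | t <- enum T]} /\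
        word_val u = f z)).
    + by exists [::]; rewrite /word_val big_nil zhom0.
    + move=> y z [u [Hu Eu]] [u' [Hu' Eu']]; exists (u ++ u').
      rewrite fH -Eu -Eu' /word_val big_cat; split => // k.
      by rewrite mem_cat => /orP[/Hu|/Hu'].
    + move=> t _; exists (nseq (x t) (f (v t))); split.
        move=> k /nseqP[-> _]; apply/mapP; exists t; rewrite ?mem_enum //.
      by rewrite zhomMn // /word_val big_nseq iter_mulg_1.
  move=> [p]; rewrite inE => /eqP-> /= [u [Hu ->]].
  suff [x ->] : exists x : T -> nat, word_val u = f (\sum_t v t *+ x t).
    by exists x => //; rewrite sE fH mulgA.
  elim: u Hu => [|k u IH] Hu.
    exists (fun=> 0%N); rewrite /word_val big_nil big1 ?zhom0 // => t _.
  have [x Ex] : exists x : T -> nat, word_val u = f (\sum_t v t *+ x t).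
    by apply: IH => k' ku; apply: Hu; rewrite inE ku orbT.
  have /mapP[t _ Ek] := Hu k (mem_head _ _).
  exists (fun t' => (t' == t) + x t')%N.
  rewrite /word_val big_cons -/(word_val u) Ex Ek -fH; congr f.
  rewrite [RHS](eq_bigr (fun t' => v t' *+ (t' == t) + v t' *+ x t')) => [|t' _]; last first.
    by rewrite /= mulrnDr.
  rewrite [RHS]big_split /= [X in _ = X + _](bigD1 t) //= eqxx mulr1n; congr (_ + _).
  by rewrite big1 ?addr0 // => t' /negPf->.
- have -> : [set (f (s x) * g)%g | x in h @` P] = [set (f (s (h x)) * g)%g | x in P].
    apply/seteqP; split => [_ [_ [x Px <-] <-]|_ [x Px <-]]; first by exists x.
    by exists (h x) => //; exists x.
  by apply: IH => i; exact: (@islinN_comp _ _ (fun x => s x i)) => //.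
Qed.

Definition pmdiff (x : I + I -> int) : I -> int := fun i => x (inl i) - x (inr i).

Lemma pmdiff_surj (v : I -> int) :
  exists x : I + I -> nat, v = pmdiff (fun t => (x t)%:Z).
Proof.
exists (fun t => match t with
  | inl i => if 0 <= v i then `|v i|%N else 0%N
  | inr i => if 0 <= v i then 0%N else `|v i|%N end).
by apply/funext => i; rewrite /pmdiff; case: lerP; lia.
Qed.

Lemma slin_defset R : defset f c R -> slin R.
Proof.
move=> HR.
pose D : (I + I -> nat) -> I -> int := fun x => pmdiff (fun t => (x t)%:Z).
have HD i : islinN (fun x => D x i).
  apply: islinND; first exact: islinN_aff (isaff_var _).
  have [a [b H]] := islinNZ (-1) (islinN_aff (isaff_var (inr i : I + I))).
  by exists a, b => x; rewrite -H mulN1r.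
pose Rj j := [set (f (D x) * c j)%g | x in setT `&` [set x | R (f (D x) * c j)%g]].
have Sj j : slin (Rj j).
  by apply: slin_decomp => //; apply: (decompI_pres HD (HR j)); exact: DecompT.
have -> : R = \bigcup_j Rj j.
  apply/seteqP; split => g.
    move=> Rg; have [v [j E]] := coords_surj cd g; have [x Ex] := pmdiff_surj v.
    have EDx : (f (D x) * c j)%g = g by rewrite /D -Ex -E.
    by exists j => //; exists x => //; split => //=; rewrite EDx.
  by move=> [j _ [x [_ Rx] <-]].
exact: slin_bigcup.
Qed.

Lemma regularU (A : finType) (L L' : set (seq A)) :
  regular L -> regular L' -> regular (L `|` L').
Proof.
move=> [Q [q0 [d [F H]]]] [Q' [q0' [d' [F' H']]]].
exists (Q * Q')%type, (q0, q0'), (fun p a => (d p.1 a, d' p.2 a)).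
exists [set p | (p.1 \in F) || (p.2 \in F')]%SET => w.
have -> : foldl (fun p a => (d p.1 a, d' p.2 a)) (q0, q0') w =
    (foldl d q0 w, foldl d' q0' w).
  by elim: w q0 q0' {H H'} => //= a w IH q q'; rewrite IH.
by rewrite inE /= /setU /= H H'; split => [/orP|/orP].
Qed.

Lemma regular0 (A : finType) : regular (set0 : set (seq A)).
Proof. by exists unit, tt, (fun _ _ => tt), finset.set0 => w; rewrite inE. Qed.

Lemma regularT (A : finType) : regular (setT : set (seq A)).
Proof.
exists unit, tt, (fun _ _ => tt), [set: unit]%SET => w; rewrite inE; split => //.
Qed.

(** The two booleans of a state say that all letters read satisfy [P], and that the last letter is
    [t] with all earlier ones in [P]. *)
Lemma regular_star_letter (A : finType) (P : pred A) (t : A) :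
  regular [set w | exists2 u, all P u & w = rcons u t].
Proof.
pose d (p : bool * bool) a := (p.1 && P a, p.1 && (a == t)).
exists (bool * bool)%type, (true, false), d, [set p | p.2]%SET => w; rewrite inE.
have E u : (foldl d (true, false) u).1 = all P u.
  by elim/last_ind: u => //= u a; rewrite foldl_rcons all_rcons andbC /= => ->.
case/lastP: w => [|u a]; first by split => // -[[|? ?]].
rewrite foldl_rcons /= E; split.
  by move=> [u' Pu /rcons_inj[-> ->]]; rewrite Pu eqxx.
by move=> /andP[Pu /eqP->]; exists u.
Qed.

(** A rational set comes with an alphabet generating the whole group as a monoid; the hypothesis on
    [setT] supplies it. *)
Lemma rational_slin (R : set M) : slin R -> slin setT -> rational_set R.
Proof.
move=> [l ->] [l0 H0].
pose letters (l : seq (seq M * M)) := flatten [seq p.2 :: p.1 | p <- l].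
have lettersP (l1 : seq (seq M * M)) p : p \in l1 ->
    p.2 \in letters l1 /\ {subset p.1 <= letters l1}.
  by move=> pl; split=> [|u up]; apply/flatten_mapP; exists p; rewrite ?mem_head // inE up orbT.
pose A : {fset M} := [fset x in letters l0 ++ letters l]%fset.
have inA x : (x \in A) = (x \in letters l0) || (x \in letters l).
  by rewrite !inE.
exists A.
  move=> g; have : [set: M] g by []; rewrite H0 => -[p pl [u [Hu ->]]].
  have [p2 p1] := lettersP _ _ pl.
  exists (rcons u p.2) => [x|].
    by rewrite mem_rcons inE inA => /predU1P[->|/Hu/p1->//]; rewrite p2.
  by rewrite /word_val big_rcons.
have : {subset letters l <= A} by move=> x xl; rewrite inA xl orbT.
(* Only the inclusion of the letters in [A] is kept, so that the alphabet stays fixed during the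
   induction on [l]. *)
clearbody A; elim: l {inA} => [|p l IH] lA.
  exists set0; first exact: regular0.
  by apply/seteqP; split => g [].
have [L rL E] : exists2 L : set (seq A), regular L & mlinear l = [set word_val [seq fsval a | a <- w] | w in L].
  apply: IH => x /flatten_mapP[q ql xq]; apply: lA; apply/flatten_mapP; exists q => //.
  by rewrite inE ql orbT.
have tA : p.2 \in A.
  by apply: lA; apply/flatten_mapP; exists p; rewrite ?mem_head.
have pA x : x \in p.1 -> x \in A.
  by move=> xp; apply: lA; apply/flatten_mapP; exists p; rewrite ?mem_head // inE xp orbT.
exists (L `|` [set w | exists2 u, all (fun a : A => fsval a \in p.1) u &
    w = rcons u [` tA]%fset]).
  by apply: regularU => //; exact: regular_star_letter.
rewrite image_setU -E -[p :: l]/([:: p] ++ l) mlinear_cat setUC; congr (_ `|` _).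
apply/seteqP; split => g.
  move=> [q]; rewrite inE => /eqP-> [u [Hu ->]].
  pose u' : seq A := pmap insub u.
  have Eu : [seq fsval a | a <- u'] = u by apply: map_fsval_insub => x /Hu/pA.
  exists (rcons u' [` tA]%fset).
    by exists u' => //; apply/allP => a au; apply: Hu; rewrite -Eu; apply/mapP; exists a.
  by rewrite map_rcons Eu /word_val big_rcons.
move=> [_ [u /allP Pu ->] <-]; exists p; first exact: mem_head.
exists [seq fsval a | a <- u]; split.
  by move=> x /mapP[a au ->]; exact: Pu.
by rewrite map_rcons /word_val big_rcons.
Qed.

Theorem rational_defset (R : set M) : defset f c R -> rational_set R.
Proof.
move=> HR; apply: rational_slin; apply: slin_defset => // j.
exact: pres_const.
Qed.

End RegularPres.

(** * Weights of elements and rationality of growth *)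

Lemma cnt_partition (T : choiceType) (J : finType) (key : T -> J) (A : set T) :
  finite_set A -> cnt A = (\sum_j cnt (A `&` [set x | key x = j]))%N.
Proof.
move=> FA.
have H (s : seq J) : uniq s ->
    cnt (A `&` [set x | key x \in s]) = (\sum_(j <- s) cnt (A `&` [set x | key x = j]))%N.
  elim: s => [_|j s IH /= /andP[js us]].
    rewrite big_nil -(cnt0 T); congr cnt; by apply/seteqP; split => x // -[].
  rewrite big_cons -IH // -cntU; first last.
  - apply/seteqP; split => x // -[[_ /= E] [_ /=]]; rewrite E.
    by rewrite (negPf js).
  - by apply: finite_setIl.
  - by apply: finite_setIl.
  congr cnt; rewrite -setIUr; congr (_ `&` _); apply/seteqP; split => x /=.
    by rewrite inE => /predU1P; case; [left|right].
  by move=> [->|xs]; rewrite inE ?eqxx ?xs ?orbT.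
rewrite -(H _ (index_enum_uniq J)); congr cnt; apply/seteqP; split => x; last by case.
by split => //=; rewrite mem_index_enum.
Qed.

Section Weights.
Variables (M : groupType) (Sigma : {fset M}) (wt : M -> nat).
Hypothesis wg : weighted_generating Sigma wt.

Definition has_word (g : M) (n : nat) : Prop :=
  exists w : seq M, [/\ {subset w <= Sigma}, word_val w = g & word_weight wt w = n].

Lemma elt_weightE g n :
  elt_weight Sigma wt g = n <-> has_word g n /\ forall m, (m < n)%N -> ~ has_word g m.
Proof.
have -> : elt_weight Sigma wt g = nat_min [set n | has_word g n].
  congr nat_min; apply/seteqP; split => k.
    by move=> [w [Hw <-] <-]; exists w.
  by move=> [w [Hw Ew Ek]]; exists w.
apply: nat_minE; have [w Hw Ew] := wg.1 g.
by exists (word_weight wt w), w.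
Qed.

(** Weights of letters are positive, so a word of weight [n] has length at most [n]. *)
Lemma finite_sphere n : finite_set [set g | elt_weight Sigma wt g = n].
Proof.
have F : finite_set [set word_val [seq fsval a | a <- bseqval w] |
    w in [set: {bseq n of Sigma}]].
  exact: finite_image.
apply: sub_finite_set F => g /elt_weightE[[w [Hw Ew En]] _].
have size_w : (size w <= n)%N.
  rewrite -En /word_weight -sum1_size big_seq [leqRHS]big_seq.
  by apply: leq_sum => s /Hw /wg.2.
have size_u : (size (pmap insub w : seq Sigma) <= n)%N.
  by rewrite -(size_map val) map_fsval_insub.
by exists (Bseq size_u) => //=; rewrite map_fsval_insub.
Qed.

Variables (I J : finType) (f : (I -> int) -> M) (c : J -> M).
Hypothesis cd : coords f c.

(** The pairs (element, weight of a word for it) form a Presburger set by [pres_regular] for the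
    language of all words; being the least such weight adds one integer quantifier. *)
Lemma pres_elt_weight j : pres (fun e : option I -> int =>
  (elt_weight Sigma wt (f (fun i => e (Some i)) * c j)%g)%:Z = e None).
Proof.
have K := pres_regular cd (fun a : Sigma => fsval a) (fun a => (wt (fsval a))%:Z) j
  (regularT Sigma).
have wordP g n : has_word g n <-> exists w : seq Sigma, [/\ setT w,
    word_val [seq fsval a | a <- w] = g & \sum_(a <- w) (wt (fsval a))%:Z = n%:Z].
  split.
    move=> [w [Hw Ew En]]; exists (pmap insub w); split => //.
      by rewrite map_fsval_insub.
    rewrite -(big_map (fun a : Sigma => fsval a) xpredT (fun a => (wt a)%:Z)) map_fsval_insub // -En.
    by rewrite /word_weight (big_morph Posz PoszD (erefl 0%:Z)).
  move=> [w [_ Ew En]]; exists [seq fsval a | a <- w]; split => //.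
    by move=> _ /mapP[a _ ->]; exact: fsvalP.
  apply/eqP; rewrite -eqz_nat -En /word_weight big_map.
  by rewrite (big_morph Posz PoszD (erefl 0%:Z)).
pose W (e : option I -> int) := exists w : seq Sigma, [/\ setT w,
    word_val [seq fsval a | a <- w] = (f (fun i => e (Some i)) * c j)%g &
    \sum_(a <- w) (wt (fsval a))%:Z = e None].
have W0 e : W e -> 0 <= e None by move=> [w [_ _ <-]]; exact: sumr_ge0.
suff : pres (fun e : option I -> int => W e /\
    forall m : int, m < e None -> ~ W (fun o => if o is Some i then e (Some i) else m)).
  apply: pres_ext => e; split.
    move=> [We Hm]; have e0 := W0 _ We.
    rewrite -(gez0_abs e0); congr Posz; apply/elt_weightE; split.
      by apply/wordP; rewrite gez0_abs.
    move=> m lt /wordP Hw; apply: (Hm m%:Z) => //; lia.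
  move=> En; have /elt_weightE[H1 H2] := erefl (elt_weight Sigma wt
    (f (fun i => e (Some i)) * c j)%g).
  split; first by move/wordP: H1; rewrite En.
  move=> m lt Wm; have m0 := W0 _ Wm; apply: (H2 `|m|%N); first by lia.
  by apply/wordP; rewrite gez0_abs.
apply: pres_and => //.
apply: (@pres_all _ (fun (e : option I -> int) m => m < e None ->
  ~ W (fun o => if o is Some i then e (Some i) else m))).
apply: pres_imp; first by apply: pres_lt; exact: islin_var.
have Hs o : islin (fun e : option (option I) -> int =>
    if o is Some i then e (Some (Some i)) else e None).
  by case: o => [i|]; exact: islin_var.
exact: pres_not (pres_subst Hs K).
Qed.

(** Cosets are counted separately. An element is encoded by natural numbers: positive and negative
    parts of its coordinates, and its weight as coordinate [None], so that spheres become level sets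
    of an affine map. *)
Theorem growth_defset (R : set M) : defset f c R ->
  rational_series (growth_coef Sigma wt R).
Proof.
move=> HR; have [r Hr] := coords_pick cd.
pose A n : set M := [set g | R g /\ elt_weight Sigma wt g = n].
have FA n : finite_set (A n).
  by apply: sub_finite_set (finite_sphere n) => g [].
pose D (e : option (I + I) -> int) : I -> int := pmdiff (fun t => e (Some t)).
have DE v n : exists x : option (I + I) -> nat,
    v = D (fun o => (x o)%:Z) /\ x None = n.
  have [x ->] := pmdiff_surj v.
  by exists (fun o => if o is Some t then x t else n).
have DL i : islin (fun e => D e i) by apply: islinB; exact: islin_var.
pose h j (x : option (I + I) -> nat) := (f (D (fun o => (x o)%:Z)) * c j)%g.
(* f and the differences of natural vectors are not injective: best keeps the
   lexicographically least coordinates of each element. *)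
pose best (e : option (I + I) -> int) := forall y : option (I + I) -> int,
  (forall o, 0 <= y o) -> f (fun i => D y i - D e i) = 1%g -> y None = e None ->
  ~ lexlt (enum (option (I + I) : finType)) y e.
pose Q j (e : option (I + I) -> int) :=
  (R (f (D e) * c j)%g /\ (elt_weight Sigma wt (f (D e) * c j)%g)%:Z = e None) /\ best e.
have PQ j : pres (Q j).
  apply: pres_and; first apply: pres_and.
  - exact: pres_subst DL (HR j).
  - have Hs o : islin (fun e : option (I + I) -> int =>
        if o is Some i then D e i else e None).
      by case: o => [i|] //; exact: islin_var.
    exact: pres_subst Hs (pres_elt_weight j).
  - apply: pres_all_fun; apply: pres_imp.
      by apply: pres_all_fin => o; apply: pres_le; [exact: islin_const|exact: islin_var].
    apply: pres_imp.
      apply: (pres_kernel cd) => i.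
      by apply: islinB; apply: islinB; exact: islin_var.
    apply: pres_imp; first by apply: pres_eq; exact: islin_var.
    by apply: pres_not; apply: pres_lexlt => t; exact: islin_var.
pose P j := setT `&` [set x : option (I + I) -> nat | Q j (fun o => (x o)%:Z)].
have DP j : decomp (P j).
  apply: decompI_pres (PQ j) (DecompT _) => v.
  exact: islinN_aff (isaff_var _).
have hinj j x y : P j x -> P j y -> x None = y None -> h j x = h j y -> x = y.
  move=> [_ [_ bx]] [_ [_ by_]] n E; apply/funext => o.
  have K u v : h j u = h j v ->
      f (fun i => D (fun o => (u o)%:Z) i - D (fun o => (v o)%:Z) i) = 1%g.
    by move/(coords_eq cd).
  have := @lexlt_total _ (enum (option (I + I) : finType)) (fun o => (x o)%:Z) (fun o => (y o)%:Z).
  case=> [H|H|H].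
  - by have [] := H o (mem_enum _ _).
  - by case: (by_ (fun o => (x o)%:Z)) => //; [exact: K|rewrite n].
  - by case: (bx (fun o => (y o)%:Z)) => //; [exact: K|rewrite n].
have hP n j : A n `&` [set g | (r g).2 = j] = h j @` (P j `&` [set x | x None = n]).
  apply/seteqP; split => g.
    move=> [[Rg wg'] rg].
    have [x0 [Ex0 x0n]] := DE (r g).1 n.
    have [x [Exg xn] xmin] := @lexlt_min _ (enum (option (I + I) : finType))
      [set x | h j x = g /\ x None = n] (ex_intro _ x0 (conj
        (etrans (congr2 (fun u k => f u * c k)%g (esym Ex0) (esym rg)) (esym (Hr g))) x0n)).
    exists x => //; split => //; split => //; split.
      by rewrite -/(h j x) Exg; split => //; rewrite wg' xn.
    (* [best] quantifies over nonnegative integers, [lexlt_min] over natural numbers; absolute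
       values translate between the two. *)
    move=> y y0 Ey yn; have := xmin (fun o => `|y o|%N).
    have -> : (fun o => `|y o|%N%:Z) = y by apply/funext => o; rewrite gez0_abs.
    apply; split; last by apply/eqP; rewrite -eqz_nat gez0_abs // yn /= xn.
    rewrite -Exg /h; apply/(coords_eq cd).
    rewrite -[RHS]Ey; congr f; apply/funext => i; rewrite addrfctE opprfctE.
    by congr (D _ i - _); apply/funext => o; rewrite gez0_abs.
  move=> [x [[_ [[Rx wx] _]] xn] <-]; split.
    by split => //; apply/eqP; rewrite -eqz_nat wx /= xn.
  by apply: (coords_inj cd) (esym (Hr (h j x))).
have FP n j : finite_set (P j `&` [set x | x None = n]).
  have Ii : {in P j `&` [set x | x None = n] &, injective (h j)}.
    by move=> x y; rewrite !inE => -[Px xn] [Py yn]; apply: hinj => //; rewrite xn yn.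
  by rewrite -(eq_finite_set (inj_card_eq Ii)) -hP; exact: finite_setIl.
have S : rational_series (fun n => \sum_j cnt (P j `&` [set x | x None = n]))%N.
  apply: rational_series_sum => j.
  by apply: (rational_series_decomp (DP j) (isaff_var _)) => n; exact: FP.
apply: eq_rational_series S => n.
rewrite /growth_coef -/(cnt (A n)) (cnt_partition (fun g => (r g).2) (FA n)).
apply: eq_bigr => j _; rewrite hP cnt_image // => x y [Px xn] [Py yn].
by apply: hinj => //; rewrite xn yn.
Qed.

End Weights.

(** * Patterned words and polyhedral geodesic systems *)

Lemma word_val_cat (G : groupType) (u v : seq G) :
  word_val (u ++ v) = (word_val u * word_val v)%g.
Proof. exact: big_cat. Qed.

Lemma word_val_rcons (G : groupType) (u : seq G) s :
  word_val (rcons u s) = (word_val u * s)%g.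
Proof. exact: big_rcons. Qed.

Lemma word_val_cons (G : groupType) (u : seq G) s :
  word_val (s :: u) = (s * word_val u)%g.
Proof. exact: big_cons. Qed.

Lemma word_val_nil (G : groupType) : word_val [::] = 1%g :> G.
Proof. exact: big_nil. Qed.

Lemma word_weight_cat (G : groupType) (wt : G -> nat) (u v : seq G) :
  word_weight wt (u ++ v) = (word_weight wt u + word_weight wt v)%N.
Proof. exact: big_cat. Qed.

Section Patterned.
Variables (G : groupType) (N : set G) (k d : nat).
Variables (f : ('I_k -> int) -> G) (c : 'I_d -> G).
Hypotheses (cd : coords f c) (fN : range f = N).
Variables (Sigma : {fset G}) (wt : G -> nat).
Hypothesis wg : weighted_generating Sigma wt.
Variables (r : nat) (x : r.-tuple G).
Hypothesis exX : enumerates_X N d Sigma x.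

Let fH : zhom f := coords_hom cd.
Notation sw := (short_weight d Sigma wt).

Lemma memN v : N (f v).
Proof. by rewrite -fN; exists v. Qed.

Lemma NP g : N g -> exists v, f v = g.
Proof. by rewrite -fN => -[v _ <-]; exists v. Qed.

Lemma N_subgroup : is_subgroup N.
Proof.
apply/is_subgroupP; split.
- by rewrite -(zhom0 fH); exact: memN.
- by move=> a b /NP[u <-] /NP[v <-]; rewrite -fH; exact: memN.
- by move=> a /NP[u <-]; rewrite -zhomN //; exact: memN.
Qed.

Lemma N_comm a b : N a -> N b -> (a * b = b * a)%g.
Proof. by move=> /NP[u <-] /NP[v <-]; exact: zhomC. Qed.

Lemma N_conj g a : N a -> N (g * a * g^-1)%g.
Proof. by move=> /NP[u <-]; have [v ->] := coords_conj cd g u; exact: memN. Qed.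

Lemma N_conjV g a : N a -> N (g^-1 * a * g)%g.
Proof. by move=> /(@N_conj g^-1%g); rewrite invgK. Qed.

Lemma coset_index : exists kap : G -> 'I_d,
  (forall a n b, N n -> kap (a * n * b)%g = kap (a * b)%g) /\
  (forall a b, kap (a * b)%g = kap a <-> N b).
Proof.
have [rp Hr] := coords_pick cd; exists (fun g => (rp g).2).
have K g v j : g = (f v * c j)%g -> (rp g).2 = j.
  by move=> E; apply: (coords_inj cd) (etrans (esym (Hr g)) E).
have K1 n b : N n -> (rp (n * b)%g).2 = (rp b).2.
  move=> /NP[u <-]; apply: K (u + (rp b).1) _ _.
  by rewrite fH -mulgA -Hr.
split=> [a n b Nn|a b].
  have -> : (a * n * b = (a * n * a^-1) * (a * b))%g by rewrite mulgA mulgVK.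
  by apply: K1; exact: N_conj.
split=> [E|Nb].
  have Ea := Hr a; have Eab := Hr (a * b)%g; rewrite E in Eab.
  have -> : (b = a^-1 * ((a * b) * a^-1) * a)%g.
    by rewrite -!mulgA mulVg mulg1 mulKg.
  apply: N_conjV; rewrite Eab {3}Ea invgM mulgA mulgK -zhomB //; exact: memN.
have -> : (a * b = a * b * a^-1 * a)%g by rewrite mulgVK.
by apply: K1; exact: N_conj.
Qed.

Lemma short_weight_le u : short_words d Sigma u ->
  short_products d Sigma (word_val u) /\ (sw (word_val u) <= word_weight wt u)%N.
Proof.
move=> Hu; split; first by exists u.
set A := [set word_weight wt w | w in [set w | short_words d Sigma w /\ word_val w = word_val u]].
have Au : A (word_weight wt u) by exists u.
by have [_] := nat_minP (ex_intro _ _ Au : A !=set0); exact.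
Qed.

Lemma short_weightP s : short_products d Sigma s ->
  exists u, [/\ short_words d Sigma u, word_val u = s & word_weight wt u = sw s].
Proof.
move=> [u0 Hu0 E0].
set A := [set word_weight wt w | w in [set w | short_words d Sigma w /\ word_val w = s]].
have Au : A (word_weight wt u0) by exists u0.
have [[u [Hu Eu] Ew] _] := nat_minP (ex_intro _ _ Au : A !=set0).
by exists u.
Qed.

Lemma short_expand v : short_product_word d Sigma v ->
  exists u, [/\ {subset u <= Sigma}, word_val u = word_val v &
    word_weight wt u = word_weight sw v].
Proof.
elim: v => [|s v IH] Hv.
  by exists [::]; split => //; rewrite /word_weight !big_nil.
have [u [Hu Eu Wu]] : exists u, [/\ {subset u <= Sigma}, word_val u = word_val v &
    word_weight wt u = word_weight sw v].
  by apply: IH => t tv; apply: Hv; rewrite inE tv orbT.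
have [u' [[Hu' _] Eu' Wu']] := short_weightP (Hv s (mem_head _ _)).
exists (u' ++ u); split.
- by move=> t; rewrite mem_cat => /orP[/Hu'|/Hu].
- by rewrite word_val_cat Eu Eu' word_val_cons.
- by rewrite word_weight_cat Wu Wu' [in RHS]/word_weight big_cons.
Qed.

Lemma d_gt0 : (0 < d)%N.
Proof. by have [_ [j _]] := coords_surj cd 1%g; exact: leq_ltn_trans (ltn_ord j). Qed.

Lemma Sigma_short_word v : {subset v <= Sigma} ->
  short_product_word d Sigma v /\ (word_weight sw v <= word_weight wt v)%N.
Proof.
move=> Hv.
have H s : s \in v -> short_words d Sigma [:: s].
  by move=> sv; split => /=; [move=> t; rewrite inE => /eqP->; exact: Hv|rewrite d_gt0].
have V1 s : word_val [:: s] = s :> G by rewrite word_val_cons word_val_nil mulg1.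
split; first by move=> s /H /short_weight_le[]; rewrite V1.
rewrite /word_weight !big_seq; apply: leq_sum => s /H /short_weight_le[_].
by rewrite V1 /word_weight big_seq1.
Qed.

Lemma elt_weight_le v g : short_product_word d Sigma v -> word_val v = g ->
  (elt_weight Sigma wt g <= word_weight sw v)%N.
Proof.
move=> /short_expand[u [Hu Eu Wu]] Ev.
have /elt_weightE := erefl (elt_weight Sigma wt g) => /(_ wg)[_ H].
rewrite leqNgt; apply/negP => /H; apply; exists u; split => //; congruence.
Qed.

Lemma elt_weight_word g : exists v, [/\ short_product_word d Sigma v, word_val v = g &
  (word_weight sw v <= elt_weight Sigma wt g)%N].
Proof.
have /elt_weightE := erefl (elt_weight Sigma wt g) => /(_ wg)[[v [Hv Ev <-]] _].
by have [H1 H2] := Sigma_short_word Hv; exists v.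
Qed.

Lemma X_vectors : exists V : nat -> 'I_k -> int, forall t, f (V t) = nth 1%g x t.
Proof.
suff /choice[V HV] : forall t, exists v, f v = nth 1%g x t by exists V.
move=> t; apply: NP.
have [tr|tr] := ltnP t r; last by rewrite nth_default ?size_tuple //; have /is_subgroupP[] := N_subgroup.
have /seteqP[H _] := exX.2; have [] := H (nth 1%g x t) _ => //=.
by rewrite mem_nth ?size_tuple.
Qed.

Lemma X_index g : short_products d Sigma g -> N g -> exists2 t, (t < r)%N & nth 1%g x t = g.
Proof.
move=> Sg Ng; have /seteqP[_ H] := exX.2.
have gx : g \in x by apply: H.
by exists (index g x); [rewrite -[X in (_ < X)%N](size_tuple x) index_mem|rewrite nth_index].
Qed.

Definition Xword (b : nat -> nat) : seq G :=
  flatten [seq nseq (b t) (nth 1%g x t) | t <- iota 0 r].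

Lemma Xword_val V b : (forall t, f (V t) = nth 1%g x t) ->
  word_val (Xword b) = f (\sum_(t <- iota 0 r) V t *+ b t).
Proof.
move=> HV; rewrite /Xword; elim: (iota 0 r) => [|t s IH] /=.
  by rewrite big_nil word_val_nil zhom0.
rewrite big_cons fH word_val_cat IH zhomMn // HV.
by rewrite /word_val big_nseq iter_mulg_1.
Qed.

Lemma Xword_weight b : word_weight sw (Xword b) = (\sum_(t <- iota 0 r) b t * sw (nth 1%g x t))%N.
Proof.
rewrite /Xword; elim: (iota 0 r) => [|t s IH] /=.
  by rewrite big_nil /word_weight big_nil.
by rewrite big_cons word_weight_cat IH {1}/word_weight big_nseq iter_addn_0 mulnC.
Qed.

Lemma Xword_N b : N (word_val (Xword b)).
Proof. by have [V HV] := X_vectors; rewrite (Xword_val _ HV); exact: memN. Qed.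

Lemma Xword_incr b t : (t < r)%N ->
  let b' t' := (b t' + (t' == t))%N in
  word_val (Xword b') = (word_val (Xword b) * nth 1%g x t)%g /\
  word_weight sw (Xword b') = (word_weight sw (Xword b) + sw (nth 1%g x t))%N.
Proof.
move=> tr b'; have [V HV] := X_vectors; split.
  rewrite !(Xword_val _ HV) -HV -fH; congr f.
  under eq_bigr do rewrite mulrnDr.
  rewrite big_split /=; congr (_ + _).
  rewrite (bigD1_seq t) ?iota_uniq ?mem_iota //= eqxx mulr1n big1 ?addr0 //.
  by move=> t' /negPf->.
rewrite !Xword_weight; under eq_bigr do rewrite mulnDl.
rewrite big_split /=; congr (_ + _)%N.
rewrite (bigD1_seq t) ?iota_uniq ?mem_iota //= eqxx mul1n big1 ?addn0 //.
by move=> t' /negPf->.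
Qed.

Lemma Xword0 : Xword (fun=> 0%N) = [::].
Proof. by rewrite /Xword; elim: (iota 0 r). Qed.

(** Each entry is a word over [Sigma], which will become one letter of the pattern, followed by the
    exponents of the X-block after it. *)
Definition runs := seq (seq G * (nat -> nat)).

Definition rval (l : runs) : G := (\prod_(p <- l) (word_val p.1 * word_val (Xword p.2)))%g.

Definition rweight (l : runs) : nat :=
  (\sum_(p <- l) (word_weight wt p.1 + word_weight sw (Xword p.2)))%N.

Section Normalize.
Variable kap : G -> 'I_d.
Hypotheses (kapN : forall a n b, N n -> kap (a * n * b)%g = kap (a * b)%g)
           (kapP : forall a b, kap (a * b)%g = kap a <-> N b).

(** Starting from [a], the cosets are recorded after each run together with its block; the block
    lies in [N] and leaves the coset unchanged. *)
Fixpoint visited (a : G) (l : runs) : seq 'I_d :=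
  if l is p :: l' then
    let b := (a * (word_val p.1 * word_val (Xword p.2)))%g in kap b :: visited b l'
  else [::].

Lemma visited_rcons a l p :
  visited a (rcons l p) = rcons (visited a l) (kap (a * rval (rcons l p))%g).
Proof.
elim: l a => [|q l IH] a /=.
  by rewrite /rval big_seq1.
by rewrite IH /rval !big_rcons /= !big_cons !big_rcons /= !mulgA.
Qed.

Lemma visited_kap a a' l : (forall b, kap (a * b)%g = kap (a' * b)%g) ->
  visited a l = visited a' l.
Proof.
elim: l a a' => //= p l IH a a' H; rewrite H; congr (_ :: _).
by apply: IH => b; rewrite -!mulgA H.
Qed.

(* A letter of X read at a visit h of the coset q can be moved to the block of
   the first visit of q: the elements of G read in between lie in N. *)
Lemma visited_insert a l q t : q \in visited a l -> (t < r)%N ->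
  exists l' : runs, [/\ [seq p.1 | p <- l'] = [seq p.1 | p <- l],
    visited a l' = visited a l,
    rweight l' = (rweight l + sw (nth 1%g x t))%N &
    forall h, kap (a * rval l * h)%g = q ->
      (rval l' * h = rval l * h * nth 1%g x t)%g].
Proof.
move=> + tr; have Nt : N (nth 1%g x t).
  by have [V HV] := X_vectors; rewrite -HV; exact: memN.
elim: l a => // p l IH a /=; rewrite inE.
set b := (a * _)%g; have [Eq|ne] /= := eqVneq q (kap b).
  move=> _; have [E1 E2] := Xword_incr p.2 tr.
  set b' := (fun t' => _) in E1 E2.
  exists ((p.1, b') :: l); split => //=.
  - rewrite E1 -/b; have -> : (a * (word_val p.1 * (word_val (Xword p.2) * nth 1 x t)) =
        b * nth 1 x t)%g by rewrite /b !mulgA.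
    have K := kapN b 1%g Nt; rewrite !mulg1 in K; rewrite K; congr (_ :: _).
    by apply: visited_kap => g; rewrite kapN.
  - by rewrite /rweight !big_cons /= E2 addnA addnAC.
  move=> h; rewrite /rval !big_cons /= E1 -/(rval l) => Eh.
  have Nh : N (rval l * h)%g.
    by apply/(kapP b); rewrite -Eq -Eh /b !mulgA.
  have C : (nth 1 x t * (rval l * h) = rval l * (h * nth 1 x t))%g.
    by rewrite (N_comm Nt Nh) -mulgA.
  by rewrite -!mulgA C.
move=> /IH[l' [H1 H2 H3 H4]]; exists (p :: l'); split => /=.
- by rewrite H1.
- by rewrite -/b H2.
- by rewrite /rweight !big_cons -/(rweight l) -/(rweight l') H3 addnA.
- move=> h; rewrite /rval !big_cons -/(rval l) -/(rval l') => Eh.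
  rewrite -[LHS]mulgA H4; first by rewrite !mulgA.
  by rewrite -Eh /b !mulgA.
Qed.

Definition positions (a : G) (tail : seq G) : seq 'I_d :=
  [seq kap (a * word_val (take n tail))%g | n <- iota 0 (size tail).+1].

(** The state of a reader of the word. The closed runs [l] end at pairwise distinct cosets, the
    first one being empty so that the coset of 1 counts as visited; [tail] is the run in progress,
    which passes through visited cosets only, each at most once. *)
Record normal_form (l : runs) (tail : seq G) : Prop := {
  nf_head : exists b l1, l = ([::], b) :: l1;
  nf_visited : uniq (visited 1%g l);
  nf_runs : forall p, p \in [seq p.1 | p <- l] -> {subset p <= Sigma} /\ (size p <= d)%N;
  nf_tail : {subset tail <= Sigma};
  nf_positions : uniq (positions (rval l) tail);
  nf_sub : {subset positions (rval l) tail <= visited 1%g l}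
}.

(** The [size tail + 1] prefixes of the tail reach distinct cosets among [d]. *)
Lemma normal_form_size l tail : normal_form l tail -> (size tail < d)%N.
Proof.
move=> H; have := uniq_leq_size (nf_positions H) (fun q _ => mem_enum 'I_d q).
by rewrite size_map size_iota size_enum_ord.
Qed.

Lemma positions_rcons a tail s :
  positions a (rcons tail s) = rcons (positions a tail) (kap (a * word_val (rcons tail s))%g).
Proof.
rewrite /positions size_rcons -[(size tail).+2]addn1 iotaD map_cat add0n.
rewrite [map _ (iota _ 1)]/= cats1; congr (rcons _ _); last first.
  by rewrite take_oversize ?size_rcons.
apply/eq_in_map => n; rewrite mem_iota => /andP[_ H].
by rewrite -cats1 takel_cat.
Qed.

(** One letter is appended at a time. If it reaches a new coset, the tail is closed into a run; if
    it reaches a visited coset not met by the tail, the tail grows; otherwise it closes a loop in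
    the tail, which becomes a letter of X in an earlier block. *)
Lemma normal_form_exists v : {subset v <= Sigma} -> exists l tail,
  [/\ normal_form l tail, (rval l * word_val tail)%g = word_val v &
      (rweight l + word_weight wt tail <= word_weight wt v)%N].
Proof.
elim/last_ind: v => [|v s IH] Hv.
  exists [:: ([::], fun=> 0%N)], [::]; split.
  - split => //=; first by exists (fun=> 0%N), [::].
    + by move=> p; rewrite inE => /eqP->.
    + move=> q; rewrite inE /= => /eqP->.
      by rewrite inE /rval big_seq1 /= Xword0 !word_val_nil !mulg1.
  - by rewrite /rval big_seq1 /= Xword0 !word_val_nil !mulg1.
  - by rewrite /rweight big_seq1 /= Xword0 /word_weight !big_nil.
have [l [tail [nf Ev Wv]]] : exists l tail,
    [/\ normal_form l tail, (rval l * word_val tail)%g = word_val v &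
      (rweight l + word_weight wt tail <= word_weight wt v)%N].
  by apply: IH => t tv; apply: Hv; rewrite mem_rcons inE tv orbT.
have sS : s \in Sigma by apply: Hv; rewrite mem_rcons mem_head.
have WW u : word_weight wt (rcons u s) = (word_weight wt u + wt s)%N.
  by rewrite /word_weight big_rcons.
have td := normal_form_size nf.
have [hd vis run tl pos sub] := nf.
have tlS : {subset rcons tail s <= Sigma}.
  by move=> t; rewrite mem_rcons inE => /predU1P[->//|/tl].
set q := kap (rval l * word_val (rcons tail s))%g.
have [qv|qv] := boolP (q \in visited 1%g l); last first.
  exists (rcons l (rcons tail s, fun=> 0%N)), [::].
  have Er : rval (rcons l (rcons tail s, fun=> 0%N)) =
      (rval l * word_val (rcons tail s))%g.
    by rewrite /rval big_rcons /= Xword0 word_val_nil mulg1.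
  split; first split => //.
  - by have [b [l1 ->]] := hd; exists b, (rcons l1 (rcons tail s, fun=> 0%N)).
  - by rewrite visited_rcons rcons_uniq mul1g Er qv vis.
  - move=> p; rewrite map_rcons mem_rcons inE => /predU1P[->|/run//]; split => //.
    by rewrite size_rcons.
  - move=> p; rewrite /positions /= inE => /eqP->.
    by rewrite visited_rcons mem_rcons word_val_nil mulg1 mul1g mem_head.
  - by rewrite Er word_val_nil mulg1 !word_val_rcons mulgA Ev.
  - rewrite /rweight big_rcons /= -/(rweight l) !WW Xword0.
    rewrite /word_weight !big_nil -/(word_weight wt tail) -/(word_weight wt v); lia.
have [|qp] := boolP (q \in positions (rval l) tail); last first.
  exists l, (rcons tail s); split; first split => //.
  - by rewrite positions_rcons rcons_uniq qp pos.
  - by move=> p; rewrite positions_rcons mem_rcons inE => /predU1P[->//|/sub].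
  - by rewrite !word_val_rcons mulgA Ev.
  - by rewrite !WW addnA leq_add2r.
move=> /mapP[n]; rewrite mem_iota add0n ltnS => /andP[_ nt] Eq.
(* The loop [t2] starts and ends at the coset [q], so its value lies in [N]; its length is at most
   [d] because the tail is shorter than [d]. *)
set t1 := take n tail in Eq; pose t2 := rcons (drop n tail) s.
have Et : rcons tail s = t1 ++ t2 by rewrite /t1 /t2 -rcons_cat cat_take_drop.
have Nt2 : N (word_val t2).
  by apply/(kapP (rval l * word_val t1)); rewrite -mulgA -word_val_cat -Et.
have St2 : short_words d Sigma t2.
  split; first by move=> y yt; apply: tlS; rewrite Et mem_cat yt orbT.
  by rewrite size_rcons size_drop /=; lia.
have [Pt2 wt2] := short_weight_le St2.
have [t tr Ext] := X_index Pt2 Nt2.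
have [l' [H1 H2 H3 H4]] := visited_insert qv tr.
have E4 := H4 (word_val t1); rewrite mul1g in E4; have {}E4 := E4 (esym Eq).
(* The insertion changes the value of [l] by a right factor in [N], hence keeps the cosets met by
   what remains of the tail. *)
have kl b : kap (rval l' * b)%g = kap (rval l * b)%g.
  have -> : (rval l' = rval l * (word_val t1 * word_val t2 * (word_val t1)^-1))%g.
    by apply: (mulIg (word_val t1)); rewrite E4 Ext !mulgA mulgVK.
  by rewrite kapN //; exact: N_conj.
have posE : positions (rval l') t1 = take n.+1 (positions (rval l) tail).
  rewrite /positions -map_take take_iota size_takel //.
  have -> : minn n.+1 (size tail).+1 = n.+1 by lia.
  apply/eq_in_map => m; rewrite mem_iota add0n ltnS => /andP[_ mn].
  by rewrite kl /t1 take_takel.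
exists l', t1; split; first split.
- have [b [l1 El]] := hd; rewrite El in H1.
  by case: l' H1 {H2 H3 H4 E4 kl posE} => [//|[u b'] l''] /= [-> _]; exists b', l''.
- by rewrite H2.
- by move=> p; rewrite H1; exact: run.
- by move=> y yt; apply: tl; exact: mem_take yt.
- by rewrite posE take_uniq.
- by move=> y; rewrite posE H2 => /mem_take /sub.
- by rewrite E4 Ext -mulgA -word_val_cat -Et !word_val_rcons mulgA Ev.
- rewrite H3 Ext.
  have : word_weight wt (t1 ++ t2) = (word_weight wt tail + wt s)%N by rewrite -Et WW.
  rewrite word_weight_cat WW; lia.
Qed.

(** A run with value in [N] would end at the coset where it began. This makes the letters of the
    pattern lie in Y. *)
Lemma visited_notin a l : uniq (kap a :: visited a l) ->
  forall p, p \in [seq p.1 | p <- l] -> ~ N (word_val p).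
Proof.
elim: l a => // p l IH a /=; rewrite inE negb_or => /andP[/andP[ne _] u] q.
rewrite inE => /predU1P[->|ql]; last exact: (IH _ u).
move=> Np; move/eqP: ne; apply; apply/esym/kapP.
by have /is_subgroupP[_ M _] := N_subgroup; apply: M => //; exact: Xword_N.
Qed.

End Normalize.

End Patterned.

(** * Patterned words: existence, uniqueness of exponents, values and weights *)

Section Geodesic.
Variables (G : groupType) (N : set G) (k d : nat).
Variables (f : ('I_k -> int) -> G) (c : 'I_d -> G).
Hypotheses (cd : coords f c) (fN : range f = N).
Variables (Sigma : {fset G}) (wt : G -> nat).
Hypothesis wg : weighted_generating Sigma wt.
Variables (r : nat) (x : r.-tuple G).
Hypothesis exX : enumerates_X N d Sigma x.

Let fH : zhom f := coords_hom cd.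
Notation sw := (short_weight d Sigma wt).

Lemma eq_Xword (b b' : nat -> nat) : (forall t, (t < r)%N -> b t = b' t) ->
  Xword x b = Xword x b'.
Proof.
move=> H; congr flatten; apply/eq_in_map => t; rewrite mem_iota add0n => /andP[_ tr].
by rewrite H.
Qed.

Lemma patterned_exists v : {subset v <= Sigma} ->
  exists (pi : seq G) (i : (pattern_dim r pi).-tuple nat), [/\ patterns N d Sigma pi,
    word_val (pattern_word x i) = word_val v &
    (word_weight sw (pattern_word x i) <= word_weight wt v)%N].
Proof.
move=> Hv; have [kap [kN kP]] := coset_index cd fN.
have [l [tail [nf Ev Wv]]] := normal_form_exists cd fN wt exX kN kP Hv.
have td := normal_form_size nf; have [[b0 [l1 El]] vis run tl pos _] := nf.
have /is_subgroupP[N1 NM _] := N_subgroup cd fN.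
have XN b : N (word_val (Xword x b)) by exact: (Xword_N cd fN exX).
have sl : (size l <= d)%N.
  have <- : size (visited x kap 1%g l) = size l.
    by elim: (l) (1%g : G) => //= p l' IH a; rewrite IH.
  have := uniq_leq_size vis (fun q _ => mem_enum 'I_d q).
  by rewrite size_enum_ord.
have l1N p : p \in [seq q.1 | q <- l1] -> ~ N (word_val p).
  apply: (visited_notin cd fN exX kP (a := word_val (Xword x b0))).
  by move: vis; rewrite El /= word_val_nil !mul1g.
(* The empty first run contributes no letter, and a nonempty tail becomes a last run with empty
   block: the bound [d] on the number of runs is also the bound on the pattern. *)
pose L := l1 ++ (if tail is [::] then [::] else [:: (tail, fun=> 0%N)]).
have LN p : p \in [seq q.1 | q <- L] ->
    [/\ ~ N (word_val p), {subset p <= Sigma} & (size p <= d)%N].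
  rewrite /L map_cat mem_cat => /orP[pl|].
    have [p1 p2] : {subset p <= Sigma} /\ (size p <= d)%N.
      by apply: run; rewrite El inE pl orbT.
    by split => //; exact: l1N.
  case Et: tail => [//|s tail'] /=; rewrite inE => /eqP->; rewrite -Et.
  split => //; last exact: ltnW.
  (* A nonempty tail with value in [N] would repeat its initial coset at its end. *)
  move=> Nt; move: pos; rewrite /positions => /(uniqP (kap 1%g)) /(_ 0%N (size tail)).
  rewrite !inE size_map size_iota => /(_ isT (leqnn _)).
  rewrite !(nth_map 0%N) ?size_iota // !nth_iota // take0 take_size word_val_nil mulg1.
  have -> : kap (rval x l * word_val tail)%g = kap (rval x l) by apply/kP.
  by move/(_ erefl); rewrite Et.
pose pi := [seq word_val q.1 | q <- L].
pose blocks := b0 :: [seq q.2 | q <- L].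
(* The blocks are laid out in one sequence, the exponent of letter [t] in block [j] at place
   [j * r + t]. *)
pose e n := nth (fun=> 0%N) blocks (n %/ r)%N (n %% r)%N.
have eE j t : (t < r)%N -> e (j * r + t)%N = nth (fun=> 0%N) blocks j t.
  move=> tr; have r0 : (0 < r)%N by exact: leq_ltn_trans tr.
  by rewrite /e divnMDl // divn_small // addn0 modnMDl modn_small.
have si : size (mkseq e (pattern_dim r pi)) == pattern_dim r pi by rewrite size_mkseq.
pose i : (pattern_dim r pi).-tuple nat := Tuple si.
have XE j : (j <= size pi)%N -> X_block x i j = Xword x (nth (fun=> 0%N) blocks j).
  move=> jp; apply: eq_Xword => t tr; rewrite nth_mkseq ?eE //.
  by rewrite /pattern_dim; apply: leq_trans (_ : j * r + r <= _)%N;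
    rewrite ?ltn_add2l // leq_add2r leq_mul2r jp orbT.
have PE : pattern_word x i = Xword x b0 ++ flatten [seq word_val q.1 :: Xword x q.2 | q <- L].
  rewrite /pattern_word XE //; congr (_ ++ flatten _).
  rewrite -[in RHS](mkseq_nth ([::], fun=> 0%N) L) /mkseq -map_comp size_map.
  apply/eq_in_map => j; rewrite mem_iota add0n => /andP[_ jL] /=.
  by rewrite XE ?size_map // (nth_map ([::], fun=> 0%N)) //= (nth_map ([::], fun=> 0%N)).
have sN q : q \in L -> short_words d Sigma q.1.
  move=> qL; have [qN qS qd] := LN q.1 (map_f _ qL); split => //; rewrite qd andbT.
  by case: (q.1) qN => // -[]; rewrite word_val_nil.
exists pi, i; split.
- split.
    rewrite size_map /L size_cat; move: sl; rewrite El /=.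
    by case: (tail) => [|? ?] /=; lia.
  move=> y /mapP[q qL ->]; split; last by have [] := LN q.1 (map_f _ qL).
  by exists q.1 => //; exact: sN.
- rewrite PE -Ev word_val_cat El /rval big_cons /= word_val_nil mul1g -!mulgA; congr (_ * _)%g.
  have -> : word_val (flatten [seq word_val q.1 :: Xword x q.2 | q <- L]) = rval x L.
    elim: (L) => [|q l' IH] /=; first by rewrite /rval big_nil word_val_nil.
    by rewrite word_val_cons word_val_cat IH /rval big_cons !mulgA.
  rewrite /rval /L big_cat /=; congr (_ * _)%g.
  case: (tail) => [|s tail']; first by rewrite big_nil word_val_nil.
  by rewrite big_seq1 /= Xword0 word_val_nil mulg1.
- rewrite PE word_weight_cat; apply: leq_trans Wv.
  have W0 w : word_weight w [::] = 0%N :> nat by rewrite /word_weight big_nil.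
  rewrite El /rweight big_cons /= W0 add0n -addnA leq_add2l.
  apply: (@leq_trans (\sum_(q <- L) (word_weight wt q.1 + word_weight sw (Xword x q.2)))%N).
    elim: (L) sN => [|q l' IH] sN; first by rewrite big_nil /= W0.
    rewrite big_cons /= -cat1s !word_weight_cat addnA leq_add //.
      rewrite leq_add2r /word_weight big_seq1.
      by have [] := short_weight_le wt (sN q (mem_head _ _)).
    by apply: IH => q' q'l; apply: sN; rewrite inE q'l orbT.
  rewrite /L big_cat leq_add2l /=; case: (tail) => [|s tail']; first by rewrite big_nil W0.
  by rewrite big_seq1 /= Xword0 W0 addn0.
Qed.

Lemma Xword_letters b s : s \in Xword x b -> s \in x.
Proof.
move=> /flatten_mapP[t]; rewrite mem_iota add0n => /andP[_ tr] /nseqP[-> _].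
by rewrite mem_nth ?size_tuple.
Qed.

Lemma Xword_inj b b' : Xword x b = Xword x b' -> forall t, (t < r)%N -> b t = b' t.
Proof.
have K a t : (t < r)%N -> count_mem (nth 1%g x t) (Xword x a) = a t.
  move=> tr; rewrite /Xword count_flatten -map_comp sumnE big_map.
  rewrite (bigD1_seq t) ?iota_uniq ?mem_iota //= count_nseq /= eqxx mul1n.
  rewrite big_seq_cond big1 ?addn0 // => t'; rewrite mem_iota add0n => /andP[/andP[_ t'r] ne].
  by rewrite count_nseq /= nth_uniq ?size_tuple ?(negPf ne) ?mul0n //; case: exX.
by move=> E t tr; rewrite -(K b t tr) E K.
Qed.

Lemma cat_split (A A' B B' : seq G) y y' :
  {subset A <= x} -> {subset A' <= x} -> y \notin x -> y' \notin x ->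
  A ++ y :: B = A' ++ y' :: B' -> A = A' /\ B = B'.
Proof.
move=> + + yx y'x; elim: A A' => [|a A IH] [|a' A'] HA HA' /=.
- by move=> [].
- by move=> [E _]; move: yx; rewrite E HA' ?mem_head.
- by move=> [E _]; move: y'x; rewrite -E HA ?mem_head.
- move=> [-> E]; have [] := IH A' _ _ E.
  + by move=> s sA; apply: HA; rewrite inE sA orbT.
  + by move=> s sA; apply: HA'; rewrite inE sA orbT.
  by move=> -> ->.
Qed.

(** The letters of [pi] are not in [x], so they mark where the blocks end; within a block, an
    exponent is the number of occurrences of its letter, [x] being duplicate-free. *)
Lemma pattern_word_inj pi (i i' : (pattern_dim r pi).-tuple nat) :
  patterns N d Sigma pi -> pattern_word x i = pattern_word x i' -> i = i'.
Proof.
move=> [_ Hpi] E.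
have piX y : y \in pi -> y \notin x.
  move=> /Hpi[Sy Ny]; apply/negP => yx; apply: Ny.
  by have /seteqP[H _] := exX.2; have [] := H y yx.
have K (s : seq nat) (A A' : seq G) (B B' : nat -> nat -> nat) :
    {subset s <= iota 0 (size pi)} -> {subset A <= x} -> {subset A' <= x} ->
    A ++ flatten [seq nth 1%g pi j :: Xword x (B j) | j <- s] =
    A' ++ flatten [seq nth 1%g pi j :: Xword x (B' j) | j <- s] ->
    A = A' /\ forall j, j \in s -> Xword x (B j) = Xword x (B' j).
  elim: s A A' => [|j s IH] A A' Hs HA HA' /=; first by rewrite !cats0.
  have jpi : nth 1%g pi j \notin x.
    by apply: piX; apply: mem_nth; have := Hs j (mem_head _ _); rewrite mem_iota.
  move=> /(cat_split HA HA' jpi jpi)[-> E'].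
  have [] := IH _ _ _ _ _ E'.
  - by move=> j' js; apply: Hs; rewrite inE js orbT.
  - exact: Xword_letters.
  - exact: Xword_letters.
  by move=> Ej H; split => // j'; rewrite inE => /predU1P[->|/H].
have [E0 Es] := K (iota 0 (size pi)) (X_block x i 0) (X_block x i' 0)
  (fun j t => nth 0 i (j.+1 * r + t))%N (fun j t => nth 0 i' (j.+1 * r + t))%N
  (fun _ => id) (@Xword_letters _) (@Xword_letters _) E.
apply: val_inj; apply: (@eq_from_nth _ 0%N); rewrite !size_tuple // => n nm0.
have nm : (n < (size pi).+1 * r)%N by rewrite mulSnr.
have r0 : (0 < r)%N by case: (r) nm; rewrite ?muln0.
rewrite (divn_eq n r); have := ltn_pmod n r0; move: (n %% r)%N => t tr.
have : (n %/ r <= size pi)%N by rewrite -ltnS ltn_divLR.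
case: (n %/ r)%N => [_|j jp]; first exact: (Xword_inj E0).
by apply: (Xword_inj (Es j _)) => //; rewrite mem_iota.
Qed.

Lemma finite_patterns : finite_set (patterns N d Sigma).
Proof.
have FS : finite_set (short_products d Sigma).
  have F : finite_set [set word_val [seq fsval a | a <- bseqval w] |
      w in [set: {bseq d of Sigma}]] by exact: finite_image.
  apply: sub_finite_set F => _ [w [Hw /andP[_ wd]] <-].
  have su : (size (pmap insub w : seq Sigma) <= d)%N.
    by rewrite -(size_map val) map_fsval_insub.
  by exists (Bseq su) => //=; rewrite map_fsval_insub.
pose A := fset_set (short_products d Sigma).
have F : finite_set [set [seq fsval a | a <- bseqval w] | w in [set: {bseq d of A}]].
  exact: finite_image.
apply: sub_finite_set F => pi [pd Hpi].
have piA : {subset pi <= A}.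
  by move=> y /Hpi[Sy _]; rewrite in_fset_set // inE.
have su : (size (pmap insub pi : seq A) <= d)%N.
  by rewrite -(size_map val) map_fsval_insub.
by exists (Bseq su) => //=; rewrite map_fsval_insub.
Qed.

Let pats : {fset seq G} := fset_set (patterns N d Sigma).

Lemma patsP pi : reflect (patterns N d Sigma pi) (pi \in pats).
Proof.
by rewrite in_fset_set; [apply: (iffP idP); rewrite inE|exact: finite_patterns].
Qed.

Section Values.
Variable V : nat -> 'I_k -> int.
Hypothesis HV : forall t, f (V t) = nth 1%g x t.
Implicit Types (e : nat -> int) (pi : seq G).

Definition block_coord j e : 'I_k -> int :=
  fun q => \sum_(t <- iota 0 r) V t q * e (j * r + t)%N.

Definition pattern_value pi e : G :=
  (f (block_coord 0 e) * \prod_(j <- iota 0 (size pi))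
     (nth 1%g pi j * f (block_coord j.+1 e)))%g.

Definition block_weight j e : int :=
  \sum_(t <- iota 0 r) e (j * r + t)%N * (sw (nth 1%g x t))%:Z.

Definition pattern_weight pi e : int :=
  block_weight 0 e + \sum_(j <- iota 0 (size pi))
    ((sw (nth 1%g pi j))%:Z + block_weight j.+1 e).

Lemma X_block_val (i : seq nat) j :
  word_val (X_block x i j) = f (block_coord j (fun n => (nth 0%N i n)%:Z)).
Proof.
rewrite -/(Xword x (fun t => nth 0 i (j * r + t))%N) (Xword_val cd _ HV); congr f.
apply/funext => q; rewrite fct_sumE; apply: eq_bigr => t _.
by rewrite natmulfctE -mulr_natr natz.
Qed.

Lemma pattern_wordE pi (i : (pattern_dim r pi).-tuple nat) :
  word_val (pattern_word x i) = pattern_value pi (fun n => (nth 0%N i n)%:Z).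
Proof.
rewrite /pattern_word word_val_cat X_block_val; congr (_ * _)%g.
elim: (iota 0 (size pi)) => [|j s IH] /=; first by rewrite big_nil word_val_nil.
by rewrite big_cons word_val_cons word_val_cat IH X_block_val mulgA.
Qed.

Lemma X_block_weight (i : seq nat) j : (word_weight sw (X_block x i j))%:Z =
  block_weight j (fun n => (nth 0%N i n)%:Z).
Proof.
rewrite -/(Xword x (fun t => nth 0 i (j * r + t))%N) Xword_weight.
rewrite (big_morph Posz PoszD (erefl 0%:Z)); apply: eq_bigr => t _.
by rewrite PoszM.
Qed.

Lemma pattern_weightE pi (i : (pattern_dim r pi).-tuple nat) :
  (word_weight sw (pattern_word x i))%:Z = pattern_weight pi (fun n => (nth 0%N i n)%:Z).
Proof.
rewrite /pattern_word word_weight_cat PoszD X_block_weight; congr (_ + _).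
elim: (iota 0 (size pi)) => [|j s IH] /=; first by rewrite big_nil /word_weight big_nil.
rewrite big_cons -IH -cat1s !word_weight_cat !PoszD X_block_weight addrA.
by rewrite {1}/word_weight big_seq1.
Qed.

Lemma islin_block_coord j q : islin (fun e => block_coord j e q).
Proof. by apply: islin_sum => t; apply: islinZ; exact: islin_var. Qed.

Lemma islin_pattern_weight pi : islin (pattern_weight pi).
Proof.
have B j : islin (block_weight j).
  by apply: islin_sum => t; apply: islinZr; exact: islin_var.
apply: islinD; first exact: B.
apply: islin_sum => j; apply: islinD; last exact: B.
exact: islin_const.
Qed.

(** The value of a pattern stays in one coset while its exponents vary, and its coordinates are
    affine in them. *)
Definition crep (F : (nat -> int) -> G) : Prop := exists j (L : (nat -> int) -> 'I_k -> int),
  (forall q, islin (fun e => L e q)) /\ forall e, F e = (f (L e) * c j)%g.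

Lemma crep_const g : crep (fun=> g).
Proof.
have [v [j E]] := coords_surj cd g; exists j, (fun=> v); split => // q.
exact: islin_const.
Qed.

Lemma crepM F1 F2 : crep F1 -> crep F2 -> crep (fun e => F1 e * F2 e)%g.
Proof.
move=> [j1 [L1 [H1 E1]]] [j2 [L2 [H2 E2]]].
pose t : gterm bool := TMul (TVar false) (TVar true).
have [j [L [HL E]]] := gterm_coords cd t (fun b => if b then j2 else j1).
pose s e (p : bool * 'I_k) := if p.1 then L2 e p.2 else L1 e p.2.
exists j, (fun e => L (s e)); split => [q|e].
  have Hs p : islin (fun e => s e p) by case: p => -[] i; [exact: H2|exact: H1].
  exact: islin_subst Hs (HL q).
by rewrite -E /= /cenv /s /= E1 E2.
Qed.

Lemma crep_pattern_value pi : crep (pattern_value pi).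
Proof.
have B j : crep (fun e => f (block_coord j e)).
  have [v [j' E]] := coords_surj cd 1%g.
  exists j', (fun e q => block_coord j e q + v q); split=> [q|e].
    by apply: islinD; [exact: islin_block_coord|exact: islin_const].
  by rewrite -[fun q => _]/(block_coord j e + v) fH -mulgA -E mulg1.
rewrite /pattern_value; apply: crepM; first exact: B.
elim: (iota 0 (size pi)) => [|j s [j' [L [HL E]]]].
  by have [j [L [HL E]]] := crep_const 1%g; exists j, L; split => // e; rewrite big_nil.
have [j1 [L1 [HL1 E1]]] := crepM (crepM (crep_const (nth 1%g pi j)) (B j.+1))
  (ex_intro _ j' (ex_intro _ L (conj HL (fun e => erefl)))).
by exists j1, L1; split => // e; rewrite big_cons E -E1.
Qed.

End Values.
End Geodesic.

(** Extension by 0 agrees with the default value of [nth] in [pattern_word]; it lets values and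
    weights be functions on [nat], uniformly in the pattern. *)
Definition zext m (e : 'I_m -> int) (n : nat) : int := oapp e 0 (insub n).

Lemma zext_tuple m (i : m.-tuple nat) :
  zext (fun o => (tnth i o)%:Z) = fun n => (nth 0%N i n)%:Z.
Proof.
apply/funext => n; rewrite /zext; case: insubP => [o _ <-|].
  by rewrite /= (tnth_nth 0%N).
by rewrite -leqNgt => H; rewrite nth_default ?size_tuple.
Qed.

Lemma islin_zext (W : Type) m (L : (nat -> int) -> int) (s : (W -> int) -> 'I_m -> int) :
  (forall o, islin (fun e => s e o)) -> islin L -> islin (fun e => L (zext (s e))).
Proof.
move=> Hs; apply: (@islin_subst W nat _ (fun e => zext (s e))) => n; rewrite /zext.
case: insubP => [o _ _|_]; first exact: Hs.
exact: islin_const.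
Qed.

(** * Selection of one word in each class, for any partition that is Presburger in coordinates *)

Section GeodesicSystem.
Variables (G : groupType) (N : set G) (k d : nat).
Variables (f : ('I_k -> int) -> G) (c : 'I_d -> G).
Hypotheses (cd : coords f c) (fN : range f = N).
Variables (Sigma : {fset G}) (wt : G -> nat).
Hypothesis wg : weighted_generating Sigma wt.
Variables (r : nat) (x : r.-tuple G).
Hypothesis exX : enumerates_X N d Sigma x.
Variable cl : G -> set G.
Hypotheses (clxx : forall g, cl g g) (cl_eq : forall g h, cl g h -> cl g = cl h).
Hypothesis pres_cl : gpres f c (fun e : bool -> G => cl (e false) (e true)).

Notation sw := (short_weight d Sigma wt).
Let pats : {fset seq G} := fset_set (patterns N d Sigma).
Let patsP pi : reflect (patterns N d Sigma pi) (pi \in pats) := patsP N d Sigma pi.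

Section System.
Implicit Types pi : seq G.
Variable V : nat -> 'I_k -> int.
Hypothesis HV : forall t, f (V t) = nth 1%g x t.
Notation pval := (pattern_value f r V).
Notation pweight := (pattern_weight d Sigma wt x).
Notation vec pi := ('I_(pattern_dim r pi) -> int).

(* The key orders patterned words by weight, ties being broken by the pattern. *)
Definition pkey pi (e : nat -> int) : int :=
  pweight pi e * #|` pats|%:Z + (index pi pats)%:Z.

Definition best_in (pi pi' : seq G) (e : vec pi) (e' : vec pi') : Prop :=
  (forall o, 0 <= e' o) -> cl (pval pi (zext e)) (pval pi' (zext e')) ->
  pkey pi (zext e) <= pkey pi' (zext e').

Definition best_exponents (pi : seq G) (e e' : vec pi) : Prop :=
  (forall o, 0 <= e' o) -> cl (pval pi (zext e)) (pval pi (zext e')) ->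
  pkey pi (zext e) = pkey pi (zext e') ->
  ~ lexlt (enum 'I_(pattern_dim r pi)) e' e.

(** Words of a class are compared by weight, then by pattern, then by exponents lexicographically.
    There are finitely many patterns, so the comparison with all words of the class is a Presburger
    condition. *)
Definition geodesic (pi : seq G) (e : vec pi) : Prop :=
  [/\ forall o, 0 <= e o, forall pi', pi' \in pats -> forall e' : vec pi', best_in e e' &
    forall e', best_exponents e e'].

Lemma islin_pkey pi : islin (pkey pi).
Proof.
apply: islinD; last exact: islin_const.
by apply: islinZr; exact: islin_pattern_weight.
Qed.

Lemma pres_cl_values (pi pi' : seq G) : pres (fun e : 'I_(pattern_dim r pi) + 'I_(pattern_dim r pi') -> int =>
  cl (pval pi (zext (fun o => e (inl o)))) (pval pi' (zext (fun o => e (inr o))))).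
Proof.
have [j [L [HL E]]] := crep_pattern_value cd r V pi.
have [j' [L' [HL' E']]] := crep_pattern_value cd r V pi'.
pose s (e : 'I_(pattern_dim r pi) + 'I_(pattern_dim r pi') -> int) (p : bool * 'I_k) :=
  if p.1 then L' (zext (fun o => e (inr o))) p.2 else L (zext (fun o => e (inl o))) p.2.
have Hs p : islin (fun e => s e p).
  case: p => -[] q; rewrite /s /=.
    by apply: (islin_zext _ (HL' q)) => o; exact: islin_var.
  by apply: (islin_zext _ (HL q)) => o; exact: islin_var.
apply: pres_ext (pres_subst Hs (pres_cl (fun b => if b then j' else j))) => e.
by rewrite E E'.
Qed.

Lemma pres_nonneg (T : finType) (W : Type) (g : T -> W) :
  pres (fun e : W -> int => forall o, 0 <= e (g o)).
Proof. by apply: pres_all_fin => o; apply: pres_le; [exact: islin_const|exact: islin_var]. Qed.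

Lemma pres_geodesic pi : pres (@geodesic pi).
Proof.
have P1 := pres_nonneg (@id 'I_(pattern_dim r pi)).
have islin_l (pi' : seq G) : islin (fun e : 'I_(pattern_dim r pi) + 'I_(pattern_dim r pi') -> int =>
    pkey pi (zext (fun o => e (inl o)))).
  by apply: (islin_zext _ (islin_pkey pi)) => o; exact: islin_var.
have islin_r (pi' : seq G) : islin (fun e : 'I_(pattern_dim r pi) + 'I_(pattern_dim r pi') -> int =>
    pkey pi' (zext (fun o => e (inr o)))).
  by apply: (islin_zext _ (islin_pkey pi')) => o; exact: islin_var.
have P2 : pres (fun e : vec pi => forall pi', pi' \in enum_fset pats ->
    forall e' : vec pi', best_in e e').
  apply: pres_all_seq => pi' _; apply: (@pres_all_fun _ _ (fun e e' => @best_in pi pi' e e')).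
  apply: pres_imp; first exact: (pres_nonneg inr).
  by apply: pres_imp; [exact: pres_cl_values|exact: (pres_le (islin_l _) (islin_r _))].
have P3 : pres (fun e : vec pi => forall e', best_exponents e e').
  apply: (@pres_all_fun _ _ (fun e e' => @best_exponents pi e e')).
  apply: pres_imp; first exact: (pres_nonneg inr).
  apply: pres_imp; first exact: pres_cl_values.
  apply: pres_imp; first exact: (pres_eq (islin_l _) (islin_r _)).
  by apply: pres_not; apply: pres_lexlt => t; exact: islin_var.
apply: pres_ext (pres_and P1 (pres_and P2 P3)) => e.
by split => [[? [? ?]]|[]].
Qed.

Definition zvec (pi : seq G) (i : (pattern_dim r pi).-tuple nat) : vec pi := fun o => (tnth i o)%:Z.

Definition geodesics (pi : seq G) : set (seq G) :=
  [set w | exists2 i : (pattern_dim r pi).-tuple nat, geodesic (zvec i) & w = pattern_word x i].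

Lemma pval_zvec (pi : seq G) (i : (pattern_dim r pi).-tuple nat) :
  pval pi (zext (zvec i)) = word_val (pattern_word x i).
Proof. by rewrite zext_tuple (pattern_wordE cd HV). Qed.

Lemma pkey_zvec (pi : seq G) (i : (pattern_dim r pi).-tuple nat) :
  pkey pi (zext (zvec i)) =
  (word_weight sw (pattern_word x i) * #|` pats| + index pi pats)%N%:Z.
Proof. by rewrite /pkey zext_tuple -pattern_weightE PoszD PoszM. Qed.

Lemma zvec_surj (pi : seq G) (e : vec pi) : (forall o, 0 <= e o) ->
  exists i : (pattern_dim r pi).-tuple nat, e = zvec i.
Proof.
move=> e0; exists [tuple `|e o|%N | o < pattern_dim r pi].
by apply/funext => o; rewrite /zvec tnth_mktuple gez0_abs.
Qed.

Lemma index_pats pi : patterns N d Sigma pi -> (index pi pats < #|` pats|)%N.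
Proof. by move=> /patsP; rewrite -index_mem. Qed.

(** The least key in the class is taken first, and then the lexicographically least exponents with
    this key and this pattern; both exist because exponents are natural numbers. *)
Lemma geodesic_exists (C : set G) g : C = cl g ->
  exists (pi : seq G) (i : (pattern_dim r pi).-tuple nat),
    [/\ patterns N d Sigma pi, geodesic (zvec i) & C (word_val (pattern_word x i))].
Proof.
move=> EC.
pose A n := exists (pi : seq G) (i : (pattern_dim r pi).-tuple nat),
   [/\ patterns N d Sigma pi, C (word_val (pattern_word x i)) &
      pkey pi (zext (zvec i)) = n%:Z].
have ex : exists n, `[< A n >].
  have [v Hv Ev] := wg.1 g.
  have [pi [i [Hpi Ei _]]] := patterned_exists cd fN wt exX Hv.
  exists (word_weight sw (pattern_word x i) * #|` pats| + index pi pats)%N.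
  apply/asboolP; exists pi, i; split => //; last exact: pkey_zvec.
  by rewrite Ei Ev EC; exact: clxx.
case: (ex_minnP ex) => n /asboolP[pi [i0 [Hpi Ci0 ni0]]] min.
pose toN (y : 'I_(pattern_dim r pi) -> nat) : (pattern_dim r pi).-tuple nat :=
  [tuple y o | o < pattern_dim r pi].
have zvec_toN y : zvec (toN y) = fun o => (y o)%:Z.
  by apply/funext => o; rewrite /zvec tnth_mktuple.
have toNK (i : (pattern_dim r pi).-tuple nat) : toN (tnth i) = i.
  by apply: eq_from_tnth => o; rewrite tnth_mktuple.
have [y [Cy ny] ymin] := @lexlt_min _ (enum 'I_(pattern_dim r pi))
  [set y | C (word_val (pattern_word x (toN y))) /\ pkey pi (zext (zvec (toN y))) = n%:Z]
  (ex_intro _ (tnth i0) (conj (eq_ind_r (fun i => C (word_val (pattern_word x i))) Ci0 (toNK i0))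
     (eq_ind_r (fun i => pkey pi (zext (zvec i)) = n%:Z) ni0 (toNK i0)))).
have Ccl : C = cl (word_val (pattern_word x (toN y))).
  by rewrite EC; apply: cl_eq; rewrite -EC.
exists pi, (toN y); split => //; split.
- by move=> o; rewrite zvec_toN.
- move=> pi' /patsP Hpi' e' e'0; have [i' ->] := zvec_surj e'0.
  rewrite !pval_zvec -Ccl => Ci'; rewrite ny pkey_zvec lez_nat; apply: min.
  by apply/asboolP; exists pi', i'; split => //; exact: pkey_zvec.
- move=> e' e'0; have [i' ->] := zvec_surj e'0.
  rewrite !pval_zvec -Ccl => Ci' En lt; apply: (ymin (tnth i')).
    by rewrite /= toNK -En.
  by move: lt; rewrite zvec_toN.
Qed.

Lemma geodesic_le (pi : seq G) (i : (pattern_dim r pi).-tuple nat) (pi' : seq G)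
    (i' : (pattern_dim r pi').-tuple nat) : patterns N d Sigma pi' ->
  geodesic (zvec i) -> cl (word_val (pattern_word x i)) (word_val (pattern_word x i')) ->
  (word_weight sw (pattern_word x i) * #|` pats| + index pi pats <=
   word_weight sw (pattern_word x i') * #|` pats| + index pi' pats)%N.
Proof.
move=> /patsP Hpi' [_ H _] Hcl; rewrite -lez_nat -!pkey_zvec.
by apply: H => //; rewrite !pval_zvec.
Qed.

Lemma geodesic_unique (pi : seq G) (i : (pattern_dim r pi).-tuple nat) (pi' : seq G)
    (i' : (pattern_dim r pi').-tuple nat) : patterns N d Sigma pi -> patterns N d Sigma pi' ->
  geodesic (zvec i) -> geodesic (zvec i') ->
  cl (word_val (pattern_word x i)) (word_val (pattern_word x i')) ->
  pattern_word x i = pattern_word x i'.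
Proof.
move=> Hpi Hpi' Gi Gi' Hcl.
have Hcl' : cl (word_val (pattern_word x i')) (word_val (pattern_word x i)).
  by rewrite -(cl_eq Hcl); exact: clxx.
have E : (word_weight sw (pattern_word x i) * #|` pats| + index pi pats =
   word_weight sw (pattern_word x i') * #|` pats| + index pi' pats)%N.
  by apply/eqP; rewrite eqn_leq !geodesic_le.
(* The index is smaller than the number of patterns, so it is the remainder of the key modulo that
   number. *)
have Epi : pi = pi'.
  have lt := index_pats Hpi; have lt' := index_pats Hpi'.
  have /(congr1 (modn^~ #|` pats|)) := E; rewrite !modnMDl !modn_small //.
  move=> Ei; rewrite -(nth_index pi (s := enum_fset pats) (x := pi)); last exact/patsP.
  by rewrite Ei nth_index //; exact/patsP.
subst pi'; congr (pattern_word x _).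
have Ek : pkey pi (zext (zvec i)) = pkey pi (zext (zvec i')) by rewrite !pkey_zvec E.
have [i0 _ Bi] := Gi; have [i'0 _ Bi'] := Gi'.
have := lexlt_total (enum 'I_(pattern_dim r pi)) (zvec i) (zvec i').
case=> [H|H|H].
- by apply: eq_from_tnth => o; have [] := H o (mem_enum _ _).
- by case: (Bi' (zvec i)) => //; rewrite !pval_zvec.
- by case: (Bi (zvec i')) => //; rewrite !pval_zvec.
Qed.

Lemma geodesics_system :
  polyhedral_geodesic_system N d Sigma wt x (range cl) geodesics.
Proof.
split.
- by move=> pi _ w [i _ ->]; exists i.
- move=> C [g _ EC]; have [pi [i [Hpi Gi Ci]]] := geodesic_exists (esym EC).
  exists (pattern_word x i); split.
    by split => //; exists pi => //; exists i.
  move=> w' [[pi' Hpi' [i' Gi' ->]] Ci'].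
  apply: geodesic_unique => //; rewrite -EC in Ci Ci'.
  by rewrite -(cl_eq Ci).
- move=> C w [g _ EC] [pi Hpi [i Gi ->]] Ci v Hv Cv.
  have [u [Hu Eu <-]] := short_expand wt Hv.
  have [pi' [i' [Hpi' Ei' Wi']]] := patterned_exists cd fN wt exX Hu.
  apply: leq_trans Wi'; rewrite -EC in Ci Cv.
  have := @geodesic_le pi i pi' i' Hpi' Gi.
  rewrite Ei' Eu -(cl_eq Ci) => /(_ Cv).
  have lt' := index_pats Hpi'; rewrite -ltnS => H.
  rewrite -ltnS -(@ltn_pmul2r #|` pats|); last exact: leq_ltn_trans lt'.
  rewrite mulSnr; lia.
- move=> pi Hpi; apply: pres_polyhedral.
  apply: pres_ext (pres_geodesic pi) => e; split.
    move=> Ge; have [e0 _ _] := Ge; have [i Ei] := zvec_surj e0; exists i.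
      by exists i => //; rewrite -Ei.
    by apply/rowP => o; rewrite !mxE Ei.
  move=> [i [i' Gi' /(pattern_word_inj exX Hpi) ->] Ee].
  suff -> : e = zvec i' by [].
  by apply/funext => o; have := congr1 (fun M : 'rV[int]__ => M ord0 o) Ee; rewrite !mxE.
Qed.

(** Nothing is used about how [U] was obtained: membership says that some exponents in the
    polyhedral set of some pattern have the given value, and values are affine in coordinates. *)
Lemma defset_system_elements U :
  polyhedral_geodesic_system N d Sigma wt x (range cl) U ->
  defset f c (system_elements N d Sigma U).
Proof.
move=> [Usub _ _ Upol] j.
have P pi : pi \in enum_fset pats -> pres (fun v : 'I_k -> int => exists e : vec pi,
    pattern_exponents x (U pi) (\row_o e o) /\ (f v * c j)%g = pval pi (zext e)).
  move=> /patsP Hpi; apply: (@pres_ex_fun _ _ (fun v (e : vec pi) =>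
    pattern_exponents x (U pi) (\row_o e o) /\ (f v * c j)%g = pval pi (zext e))).
  apply: pres_and.
    have Hs (o : 'I_(pattern_dim r pi)) :
        islin (fun e : 'I_k + 'I_(pattern_dim r pi) -> int => e (inr o)).
      exact: islin_var.
    exact: pres_subst Hs (polyhedral_pres (Upol _ Hpi)).
  have [j' [L [HL E]]] := crep_pattern_value cd r V pi.
  (* All words of one pattern have values in the same coset [j'], so for another [j] the condition
     is never met. *)
  have [<-|ne] := eqVneq j' j; last first.
    apply: pres_ext (pres_const _ False) => e; split => //; rewrite E.
    by move/(coords_inj cd) => Ej; move/eqP: ne; apply.
  apply: pres_ext (pres_kernel cd (L := fun e q => e (inl q) - L (zext (fun o => e (inr o))) q) _).
    by move=> e; rewrite E; split => /(coords_eq cd).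
  move=> q; apply: islinB; first exact: islin_var.
  by apply: (islin_zext _ (HL q)) => o; exact: islin_var.
apply: pres_ext (pres_ex_seq P) => v; split.
  move=> [pi /patsP Hpi [e [[i Ui Ei] Ev]]]; exists (pattern_word x i).
    by exists pi.
  rewrite Ev -pval_zvec; congr (pval pi (zext _)); apply/funext => o.
  by have := congr1 (fun M : 'rV[int]__ => M ord0 o) Ei; rewrite !mxE.
move=> [w [pi Hpi Uw] Ew]; exists pi; first exact/patsP.
have [i _ Ei] := Usub _ Hpi _ Uw; exists (zvec i).
split; last by rewrite pval_zvec Ei.
by exists i => //; rewrite /= Ei.
Qed.

End System.

Theorem geodesic_system_exists :
  exists U, polyhedral_geodesic_system N d Sigma wt x (range cl) U.
Proof.
have [V HV] := X_vectors cd fN exX.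
by exists (geodesics V); exact: geodesics_system.
Qed.

Theorem defset_system U : polyhedral_geodesic_system N d Sigma wt x (range cl) U ->
  defset f c (system_elements N d Sigma U).
Proof. by have [V HV] := X_vectors cd fN exX; exact: (defset_system_elements HV). Qed.

Lemma pattern_word_short pi (i : (pattern_dim r pi).-tuple nat) :
  patterns N d Sigma pi -> short_product_word d Sigma (pattern_word x i).
Proof.
move=> [_ Hpi] s; have /seteqP[HX _] := exX.2.
have Xs j : s \in X_block x i j -> short_products d Sigma s.
  by move=> sX; have [] := HX s (@Xword_letters _ _ x (fun t => nth 0 i (j * r + t))%N s sX).
rewrite mem_cat => /orP[/Xs//|/flatten_mapP[j]].
rewrite mem_iota add0n => /andP[_ jpi]; rewrite inE => /predU1P[->|/Xs//].
by have [] := Hpi _ (mem_nth 1%g jpi).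
Qed.

(** A shortest word over [Sigma] is also a word over the short products of no larger weight, and
    conversely expanding short products keeps the weight; minimality among words thus becomes
    minimality of elements. *)
Theorem system_minimal_representatives U :
  polyhedral_geodesic_system N d Sigma wt x (range cl) U ->
  minimal_representatives Sigma wt (range cl) (system_elements N d Sigma U).
Proof.
move=> [Usub Uuniq Umin _] C rC; have [w [[Sw Cw] wU]] := Uuniq C rC.
exists (word_val w).
  apply/seteqP; split => h; last by move=> ->; split => //; exists w.
  by move=> [[w' Sw' <-] Cw']; rewrite (wU w').
move=> h Ch; have [v [Hv Ev Wv]] := elt_weight_word cd wg h.
apply: leq_trans Wv; apply: (leq_trans _ (Umin C w rC Sw Cw v Hv _)); last by rewrite Ev.
apply: elt_weight_le => //; have [pi Hpi Uw] := Sw.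
by have [i _ <-] := Usub _ Hpi _ Uw; exact: pattern_word_short.
Qed.

End GeodesicSystem.

(** * Cosets, conjugacy classes and assembly of the theorem *)

Lemma gpres_lcoset (G : groupType) (I J : finType) (f : (I -> int) -> G) (c : J -> G)
    (H : set G) : coords f c -> is_subgroup H ->
  gpres f c (fun e : bool -> G => lcoset H (e false) (e true)).
Proof.
move=> cd HH.
have := gpres_term cd (TMul (TInv (TVar false)) (TVar true)) (defset_subgroup cd HH).
apply: gpres_ext => e /=; split; first by move=> h; exists ((e false)^-1 * e true)%g; rewrite // mulVKg.
by move=> [h Hh <-]; rewrite mulKg.
Qed.

Lemma gpres_conj (G : groupType) (I J : finType) (f : (I -> int) -> G) (c : J -> G) :
  coords f c -> gpres f c (fun e : bool -> G => conj_class (e false) (e true)).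
Proof.
move=> cd.
pose F : gformula bool := FEx (FEq
  (TMul (TInv (TVar None)) (TMul (TVar (Some false)) (TVar None))) (TVar (Some true))).
apply: gpres_ext (gpres_holds cd F) => e /=.
by split => [[h Eh]|[h _ Eh]]; exists h.
Qed.

Theorem theorem1p1 (G : groupType)
    (fgG : finitely_generated G) (vaG : virtually_abelian G) :
  (* (1) *)
  (forall R : set G, rational_set R -> rational_growth R) /\
  (* (2a) *)
  (forall H : set G, is_subgroup H -> rational_set H /\ rational_growth H) /\
  (* (2b) *)
  (forall (k d : nat) (N : set G),
     is_normal N -> free_abelian_rank k N -> has_index N d ->
   forall H : set G, is_subgroup H ->
   forall (Sigma : {fset G}) (wt : G -> nat), weighted_generating Sigma wt ->
   forall (r : nat) (x : r.-tuple G), enumerates_X N d Sigma x ->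
     (exists U : seq G -> set (seq G),
        polyhedral_geodesic_system N d Sigma wt x (range (lcoset H)) U) /\
     (forall U : seq G -> set (seq G),
        polyhedral_geodesic_system N d Sigma wt x (range (lcoset H)) U ->
        minimal_representatives Sigma wt (range (lcoset H))
          (system_elements N d Sigma U) /\
        rational_set (system_elements N d Sigma U) /\
        rational_growth (system_elements N d Sigma U))) /\
  (* (2c) *)
  (forall (q : nat) (V : set {ffun 'I_q -> G}), (0 < q)%N ->
     algebraic_set V -> rational_set V /\ rational_growth V) /\
  (* (2d) *)
  (forall (q : nat) (V : set {ffun 'I_q -> G}), (0 < q)%N ->
     definable_set V -> rational_set V /\ rational_growth V) /\
  (* (2e) *)
  (forall (k d : nat) (N : set G),
     is_normal N -> free_abelian_rank k N -> has_index N d ->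
   forall (Sigma : {fset G}) (wt : G -> nat), weighted_generating Sigma wt ->
   forall (r : nat) (x : r.-tuple G), enumerates_X N d Sigma x ->
     (exists U : seq G -> set (seq G),
        polyhedral_geodesic_system N d Sigma wt x (range (@conj_class G)) U) /\
     (forall U : seq G -> set (seq G),
        polyhedral_geodesic_system N d Sigma wt x (range (@conj_class G)) U ->
        minimal_representatives Sigma wt (range (@conj_class G))
          (system_elements N d Sigma U) /\
        rational_set (system_elements N d Sigma U) /\
        rational_growth (system_elements N d Sigma U))).
Proof.
have [I [J [f [c cd]]]] := coords_exist fgG vaG.
have growth (M : groupType) (I' J' : finType) (f' : (I' -> int) -> M) (c' : J' -> M) R :
    coords f' c' -> defset f' c' R -> rational_set R /\ rational_growth R.
  move=> cd' HR; split; first exact: (rational_defset cd' HR).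
  by move=> Sigma wt wg; exact: (growth_defset wg cd' HR).
split; [|split; [|split; [|split; [|split]]]].
- by move=> R /(defset_rational cd) HR; have [] := growth _ _ _ _ _ _ cd HR.
- by move=> H /(defset_subgroup cd); exact: growth.
- move=> k d N Nn Nk Nd H HH Sigma wt wg r x exX.
  (* Patterns refer to the given [N] and [d], so the coordinates are rebuilt from these instead of
     the ones obtained from virtual abelianness. *)
  have [f' [c' [cd' fN]]] := coords_free_abelian Nn Nk Nd.
  have [H1 _ _] := (is_subgroupP H).1 HH.
  have lxx g : lcoset H g g by exists 1%g => //; rewrite mulg1.
  have leq g h : lcoset H g h -> lcoset H g = lcoset H h.
    by move=> [a Ha <-]; apply/(lcosetP _ _ HH); rewrite mulKg.
  have lp := gpres_lcoset cd' HH.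
  split; first exact: (geodesic_system_exists cd' fN wg exX lxx leq lp).
  move=> U PU; split; first exact: (system_minimal_representatives cd' wg exX PU).
  exact: (growth _ _ _ _ _ _ cd' (defset_system cd' fN exX PU)).
- move=> q V _ /(defset_algebraic cd); exact: (growth _ _ _ _ _ _ (coords_pow cd q)).
- move=> q V _ /(defset_definable cd); exact: (growth _ _ _ _ _ _ (coords_pow cd q)).
- move=> k d N Nn Nk Nd Sigma wt wg r x exX.
  have [f' [c' [cd' fN]]] := coords_free_abelian Nn Nk Nd.
  have lxx (g : G) : conj_class g g by exists 1%g => //; rewrite conjg1.
  have leq (g h : G) : conj_class g h -> conj_class g = conj_class h.
    move=> [a _ <-]; apply/seteqP; split => _ [b _ <-].
      by exists (a^-1 * b)%g => //; rewrite -conjgM mulVKg.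
    by exists (a * b)%g => //; rewrite conjgM.
  have lp := gpres_conj cd'.
  split; first exact: (geodesic_system_exists cd' fN wg exX lxx leq lp).
  move=> U PU; split; first exact: (system_minimal_representatives cd' wg exX PU).
  exact: (growth _ _ _ _ _ _ cd' (defset_system cd' fN exX PU)).
Qed.
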